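(* Let $\mathbb G=(G_N,\theta_N)_{N\ge0}$ be an inductive system of compact quantum groups with $G_0=(\mathbb C,\mathrm{id})$. For every extremal quantized character $\chi\in\mathrm{ex}(\mathrm{Ch}(\mathbb G))$ there exists a sequence $\pi(1)\prec\pi(2)\prec\cdots$ with $\pi(N)\in\widehat G_N$ such that for every $K\ge1$ $$\chi|_{C^*(G_K)}=\lim_{N\to\infty,\,K\le N}\chi_{\pi(N)}\circ\Theta_{N,K}$$ on $C^*(G_K)$ (i.e. $\chi(x)=\lim_{N\to\infty}\chi_{\pi(N)}(\Theta_{N,K}(x))$ for every $x\in C^*(G_K)$), where $\Theta_{N,K}:=\Theta_{N-1}\circ\Theta_{N-2}\circ\cdots\circ\Theta_K$.
   Context: **Compact quantum groups.** A compact quantum group (CQG) $G=(A,\delta)$ is a unital $C^*$-algebra $A$ with a unital $*$-homomorphism $\delta:A\to A\otimes A$ (minimal tensor product) such that $(\mathrm{id}\otimes\delta)\delta=(\delta\otimes\mathrm{id})\delta$ and $\delta(A)(A\otimes1)$, $\delta(A)(1\otimes A)$ are dense in $A\otimes A$. A finite-dimensional representation on $V$ is an invertible $U\in B(V)\otimes A$ with $(\mathrm{id}\otimes\delta)(U)=U_{12}U_{13}$; unitary if $V$ is a Hilbert space and $U$ is unitary. $\mathrm{Mor}(U,V)=\{T:(T\otimes1)U=V(T\otimes1)\}$, $\mathrm{End}(U)=\mathrm{Mor}(U,U)$; irreducible means $\mathrm{End}(U)=\mathbb C1$. $\widehat G$ is the set of unitary equivalence classes of irreducible unitary representations, with fixed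 representatives $U_\pi\in B(\mathcal H_\pi)\otimes A$. $U^c=(j\otimes\mathrm{id})(U^{-1})$, $j:B(\mathcal H)\to B(\mathcal H^* )$ the transpose map. For each finite-dimensional unitary $U$ there is a unique positive invertible $F_U\in\mathrm{Mor}(U,U^{cc})$ with $\mathrm{Tr}(F_U\,\cdot)=\mathrm{Tr}(F_U^{-1}\,\cdot)$ on $\mathrm{End}(U)$; $F_\pi:=F_{U_\pi}$, $\dim_q(\pi):=\mathrm{Tr}(F_\pi)$. $\mathcal A\subset A$ is the dense Hopf $*$-algebra spanned by matrix coefficients, and $A$ is assumed to be the universal $C^*$-algebra of $\mathcal A$. $\mathcal U(G)=\mathcal A^*$ is a $*$-algebra with $f_1*f_2=(f_1\otimes f_2)\delta$, $f^*(a)=\overline{f(S(a^* ))}$; $f\mapsto((\mathrm{id}\otimes f)(U_\pi))_\pi$ is a $*$-isomorphism onto $\prod_\pi B(\mathcal H_\pi)$, used as an identification. $W^*(G)$: norm-bounded families; $\mathbb C[G]$: algebraic direct sum; $C^*(G)$: norm closure of $\mathbb C[G]$. Scaling group: $(\mathrm{id}\otimes\tau^G_t)(U)=(F_U^{it}\otimes1)U(F_U^{-it}\otimes1)$; $\widehat\tau^G_t(f)=f\circ\tau^G_t$. **Inductive systems and quantized characters.** $\mathbb G=(G_N,\theta_N)_{N\ge0}$, $G_N=(A_N,\delta_N)$, each $\widehat G_N$ countable, $\theta_N:A_{N+1}\to A_N$ a surjective $*$-homomorphism with $\delta_N\theta_N=(\theta_N\otimes\theta_N)\delta_{N+1}$.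 $\Theta_N(f)=f\circ\theta_N$ gives injective unital $*$-homomorphisms $W^*(G_N)\to W^*(G_{N+1})$; $\mathfrak A(\mathbb G)$ is the $C^*$-subalgebra of the $C^*$-inductive limit $\varinjlim(W^*(G_N),\Theta_N)$ generated by all $C^*(G_N)$, with flow $\widehat\tau^{\mathbb G}$ induced by the $\widehat\tau^{G_N}$. A state $\chi$ is $\widehat\tau^{\mathbb G}$-KMS at inverse temperature $\beta$ if $\chi(x\widehat\tau^{\mathbb G}_{i\beta}(y))=\chi(yx)$ for $x,y$ in a norm-dense $\widehat\tau^{\mathbb G}$-invariant $*$-subalgebra of entire analytic elements. $\mathrm{Ch}(\mathbb G)$ (quantized characters) is the convex set of $\widehat\tau^{\mathbb G}$-KMS states $\chi$ on $\mathfrak A(\mathbb G)$ at inverse temperature $-1$ with $\|\chi|_{C^*(G_N)}\|=1$ for all $N\ge1$; $\mathrm{ex}$ denotes extreme points. For $\rho\in\widehat G_N$, $\pi\in\widehat G_{N+1}$, $\rho\prec\pi$ means that $U_\rho$ is contained in the restriction $(\mathrm{id}\otimes\theta_N)(U_\pi)$. For $\pi\in\widehat G_N$, $\chi_\pi$ is the state on $W^*(G_N)$ given by $\chi_\pi(x)=\mathrm{Tr}(F_\pi x_\pi)/\dim_q(\pi)$. *)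

(* Defs.v *)
From HB Require Import structures.
From mathcomp Require Import all_boot all_order all_algebra.
From mathcomp Require Import all_classical all_reals all_analysis.
From mathcomp Require Import complex.

Set Implicit Arguments.
Unset Strict Implicit.
Unset Printing Implicit Defensive.

Import Order.TTheory GRing.Theory Num.Theory.
Import numFieldNormedType.Exports.

Local Open Scope classical_set_scope.
Local Open Scope sesquilinear_scope.
Local Open Scope ring_scope.

(* Nonzero unital C*-algebras.  The multiplication is part of the mixin because
   the library hierarchy has no join of its ring and normed-module structures. *)
HB.mixin Record isCStarAlgebra (R : realType) A
    of CompleteNormedModule R[i] A := {
  cone : A ;
  cmul : A -> A -> A ;
  cstar : A -> A ;
  cmulA : associative cmul ;
  cmul1l : left_id cone cmul ;
  cmul1r : right_id cone cmul ;
  cmul_linearl : forall (c : R[i]) (x y z : A),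
    cmul (c *: x + y) z = c *: cmul x z + cmul y z ;
  cmul_linearr : forall (c : R[i]) (x y z : A),
    cmul z (c *: x + y) = c *: cmul z x + cmul z y ;
  cone_neq0 : cone != 0 ;
  cstarK : involutive cstar ;
  cstar_antilinear : forall (c : R[i]) (x y : A),
    cstar (c *: x + y) = c^* *: cstar x + cstar y ;
  cstarM : forall x y : A, cstar (cmul x y) = cmul (cstar y) (cstar x) ;
  cnormM : forall x y : A, `|cmul x y| <= `|x| * `|y| ;
  cnorm_starM : forall x : A, `|cmul (cstar x) x| = `|x| ^+ 2
}.

#[short(type="cstarAlgType")]
HB.structure Definition CStarAlgebra (R : realType) :=
  { A of CompleteNormedModule R[i] A & isCStarAlgebra R A }.

Notation "x ** y" := (cmul x y) (at level 40, left associativity) : ring_scope.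

Definition lin_subspace (R : realType) (V : normedModType R[i]) (S : set V) : Prop :=
  S 0 /\ forall (c : R[i]) (x y : V), S x -> S y -> S (c *: x + y).

Definition lspan (R : realType) (V : normedModType R[i]) (S : set V) : set V :=
  smallest (@lin_subspace R V) S.

Definition star_subalg (R : realType) (A : cstarAlgType R) (S : set A) : Prop :=
  [/\ lin_subspace S, (forall x y, S x -> S y -> S (x ** y))
    & (forall x, S x -> S (cstar x))].

Definition cstar_subalg (R : realType) (A : cstarAlgType R) (S : set A) : Prop :=
  star_subalg S /\ closed S.

Definition linear_on (R : realType) (V : normedModType R[i]) (S : set V)
    (f : V -> R[i]) : Prop :=
  forall (c : R[i]) (x y : V), S x -> S y -> f (c *: x + y) = c * f x + f y.

(* Unital *-homomorphism on a unital *-subalgebra S; the values of f outside S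
   are irrelevant. *)
Definition star_hom_on (R : realType) (A B : cstarAlgType R) (S : set A)
    (f : A -> B) : Prop :=
  [/\ (forall (c : R[i]) x y, S x -> S y -> f (c *: x + y) = c *: f x + f y),
      (forall x y, S x -> S y -> f (x ** y) = f x ** f y),
      (forall x, S x -> f (cstar x) = cstar (f x))
    & f (cone : A) = cone].

Definition star_hom (R : realType) (A B : cstarAlgType R) (f : A -> B) : Prop :=
  star_hom_on setT f.

Record hilbert (R : realType) := Hilbert {
  hsort :> completeNormedModType R[i] ;
  dot : hsort -> hsort -> R[i] ;
  dot_linear : forall (c : R[i]) (x y z : hsort),
    dot (c *: x + y) z = c * dot x z + dot y z ;
  dotC : forall x y : hsort, dot x y = (dot y x)^* ;
  dot_norm : forall x : hsort, `|x| ^+ 2 = dot x x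
}.

(* Boundedness of the operators [p a] is automatic for a *-representation of a
   C*-algebra by everywhere defined operators. *)
Definition faithful_rep (R : realType) (A : cstarAlgType R) (H : hilbert R)
    (p : A -> H -> H) : Prop :=
  [/\ (forall a, linear (p a)),
      (forall (c : R[i]) a b x, p (c *: a + b) x = c *: p a x + p b x),
      (forall a b x, p (a ** b) x = p a (p b x)) /\ (forall x, p cone x = x),
      (forall a x y, dot (p a x) y = dot x (p (cstar a) y))
    & (forall a, (forall x, p a x = 0) -> a = 0)].

(* L, together with the bilinear map t, is the Hilbert tensor product of H, K. *)
Definition hilbert_tensor (R : realType) (H K L : hilbert R) (t : H -> K -> L) :
    Prop :=
  [/\ (forall y, linear (t^~ y)), (forall x, linear (t x)),
      (forall x x' y y', dot (t x y) (t x' y') = dot x x' * dot y y')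
    & closure (lspan [set z : L | exists x y, z = t x y]) = setT].

(* T, with the embeddings a |-> a (x) 1 and b |-> 1 (x) b, is the spatial tensor
   product of A and B: the closed span of the operators p a (x) q b on the
   Hilbert tensor product of the spaces of faithful representations p and q. *)
Record min_tensor (R : realType) (A B : cstarAlgType R) := MinTensor {
  tens :> cstarAlgType R ;
  tinl : A -> tens ;
  tinr : B -> tens ;
  tinl_hom : star_hom tinl ;
  tinr_hom : star_hom tinr ;
  tin_comm : forall a b, tinl a ** tinr b = tinr b ** tinl a ;
  tens_dense :
    closure (lspan [set z : tens | exists a b, z = tinl a ** tinr b]) = setT ;
  tens_spatial : exists (H K L : hilbert R) (t : H -> K -> L)
      (p : A -> H -> H) (q : B -> K -> K) (w : tens -> L -> L),
    [/\ hilbert_tensor t, faithful_rep p, faithful_rep q, faithful_rep w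
      & forall a b x y, w (tinl a ** tinr b) (t x y) = t (p a x) (q b y)]
}.

(* AAA is A (x) (A (x) A), and f is the canonical isomorphism from
   (A (x) A) (x) 1 onto its image, so that e, g are id (x) delta and
   delta (x) id. *)
Definition coassociative (R : realType) (A : cstarAlgType R)
    (AA : min_tensor A A) (delta : A -> AA) : Prop :=
  exists (AAA : min_tensor A AA) (f e g : AA -> AAA),
    [/\ star_hom f /\ (forall a,
          f (tinl AA a) = tinl AAA a /\ f (tinr AA a) = tinr AAA (tinl AA a)),
        star_hom e /\ (forall a,
          e (tinl AA a) = tinl AAA a /\ e (tinr AA a) = tinr AAA (delta a)),
        star_hom g /\ (forall a,
          g (tinl AA a) = f (delta a) /\ g (tinr AA a) = tinr AAA (tinr AA a))
      & forall a, e (delta a) = g (delta a)].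

Record cqg (R : realType) := CQG {
  qalg :> cstarAlgType R ;
  qalg2 : min_tensor qalg qalg ;
  qdelta : qalg -> qalg2 ;
  qdelta_hom : star_hom qdelta ;
  qdelta_coassoc : coassociative qdelta ;
  qdelta_densel : closure (lspan
    [set z : qalg2 | exists a b, z = qdelta a ** tinl qalg2 b]) = setT ;
  qdelta_denser : closure (lspan
    [set z : qalg2 | exists a b, z = qdelta a ** tinr qalg2 b]) = setT
}.

(* An element of B(C^n, C^m) (x) A is an m x n matrix over A. *)
Definition amul (R : realType) (A : cstarAlgType R) (m n p : nat)
    (U : 'M[A]_(m, n)) (V : 'M[A]_(n, p)) : 'M[A]_(m, p) :=
  \matrix_(i, k) \sum_j U i j ** V j k.

(* T (x) 1 *)
Definition amp (R : realType) (A : cstarAlgType R) (m n : nat)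
    (T : 'M[R[i]]_(m, n)) : 'M[A]_(m, n) :=
  map_mx (fun c : R[i] => c *: (cone : A)) T.

Definition is_ainv (R : realType) (A : cstarAlgType R) (n : nat)
    (U V : 'M[A]_n) : Prop :=
  amul U V = amp A 1%:M /\ amul V U = amp A 1%:M.

Definition ainv (R : realType) (A : cstarAlgType R) (n : nat) (U : 'M[A]_n) :
    'M[A]_n := xget 0 [set V | is_ainv U V].

Definition aunitary (R : realType) (A : cstarAlgType R) (n : nat)
    (U : 'M[A]_n) : Prop :=
  is_ainv U (map_mx cstar U^T).

Definition is_rep (R : realType) (G : cqg R) (n : nat) (U : 'M[G]_n) : Prop :=
  (exists V, is_ainv U V) /\
  forall i j, qdelta (U i j) =
    \sum_k tinl (qalg2 G) (U i k) ** tinr (qalg2 G) (U k j).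

Definition Mor (R : realType) (A : cstarAlgType R) (n m : nat)
    (U : 'M[A]_n) (V : 'M[A]_m) : set 'M[R[i]]_(m, n) :=
  [set T | amul (amp A T) U = amul V (amp A T)].

Definition unitary_rep (R : realType) (G : cqg R) (n : nat) (U : 'M[G]_n) :
    Prop := is_rep U /\ aunitary U.

Definition irreducible_rep (R : realType) (G : cqg R) (n : nat) (U : 'M[G]_n) :
    Prop :=
  (0 < n)%N /\ Mor U U = [set T | exists c : R[i], T = c%:M].

Definition isometry_mx (R : realType) (m n : nat) (T : 'M[R[i]]_(m, n)) : Prop :=
  T^t* *m T = 1%:M.

Definition contained (R : realType) (A : cstarAlgType R) (n m : nat)
    (U : 'M[A]_n) (V : 'M[A]_m) : Prop :=
  exists2 T, Mor U V T & isometry_mx T.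

Definition unitarily_equiv (R : realType) (A : cstarAlgType R) (n m : nat)
    (U : 'M[A]_n) (V : 'M[A]_m) : Prop :=
  exists2 T, Mor U V T & isometry_mx T /\ isometry_mx (T^t*).

(* U^c; the transpose map B(H) -> B(H^* ) is matrix transposition in dual
   bases. *)
Definition contragredient (R : realType) (A : cstarAlgType R) (n : nat)
    (U : 'M[A]_n) : 'M[A]_n := (ainv U)^T.

Definition positive_mx (R : realType) (n : nat) (F : 'M[R[i]]_n) : Prop :=
  forall v : 'cV[R[i]]_n, 0 <= (v^t* *m F *m v) 0 0.

Definition is_modular (R : realType) (A : cstarAlgType R) (n : nat)
    (U : 'M[A]_n) (F : 'M[R[i]]_n) : Prop :=
  [/\ positive_mx F, F \in unitmx,
      Mor U (contragredient (contragredient U)) F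
    & forall T, Mor U U T -> \tr (F *m T) = \tr (invmx F *m T)].

Definition coef_alg (R : realType) (G : cqg R) : set G :=
  lspan [set a | exists (n : nat) (U : 'M[G]_n) (i j : 'I_n),
                   is_rep U /\ a = U i j].
Arguments coef_alg {R} G _.

Definition universal_cqg (R : realType) (G : cqg R) : Prop :=
  forall (B : cstarAlgType R) (f : G -> B), star_hom_on (coef_alg G) f ->
    exists2 g : G -> B, star_hom g & forall a, coef_alg G a -> g a = f a.

(* A compact quantum group as in [cqg], with the universal C*-algebra, the set
   [irr] of classes of irreducible unitary representations, their fixed
   representatives U_pi, and the (unique) matrices F_pi. *)
Record ucqg (R : realType) := UCQG {
  ucqg_cqg :> cqg R ;
  ucqg_universal : universal_cqg ucqg_cqg ;
  irr : choiceType ;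
  irr_dim : irr -> nat ;
  irr_rep : forall pi : irr, 'M[ucqg_cqg]_(irr_dim pi) ;
  irr_repP : forall pi, unitary_rep (irr_rep pi) /\ irreducible_rep (irr_rep pi) ;
  irr_inj : forall pi rho,
    unitarily_equiv (irr_rep pi) (irr_rep rho) -> pi = rho ;
  irr_surj : forall (n : nat) (U : 'M[ucqg_cqg]_n),
    unitary_rep U -> irreducible_rep U ->
    exists pi, unitarily_equiv U (irr_rep pi) ;
  irr_F : forall pi : irr, 'M[R[i]]_(irr_dim pi) ;
  irr_FP : forall pi, is_modular (irr_rep pi) (irr_F pi)
}.
Arguments irr_dim {R u} pi.
Arguments irr_rep {R u} pi.
Arguments irr_F {R u} pi.

(* U(G), identified with the product of the B(H_pi); its operations are the
   pointwise ones. *)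
Definition dualU (R : realType) (G : ucqg R) : Type :=
  forall pi : irr G, 'M[R[i]]_(irr_dim pi).

(* f |-> ((id (x) f)(U_pi))_pi and its inverse.  Only the values on the
   subspace [coef_alg G] of the functional returned by the latter are
   meaningful. *)
Definition fam_of (R : realType) (G : ucqg R) (f : G -> R[i]) : dualU G :=
  fun pi => map_mx f (irr_rep pi).

Definition functional_of (R : realType) (G : ucqg R) (x : dualU G) :
    G -> R[i] :=
  xget (fun=> 0) [set f | linear_on (coef_alg G) f /\ fam_of f = x].

Definition l2norm (R : realType) (n : nat) (v : 'cV[R[i]]_n) : R :=
  Num.sqrt (\sum_i complex.Re `|v i 0| ^+ 2).

Definition opnorm (R : realType) (n : nat) (M : 'M[R[i]]_n) : R :=
  sup [set l2norm (M *m v) | v in [set v | l2norm v <= 1]].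

Definition Wstar (R : realType) (G : ucqg R) : set (dualU G) :=
  [set x | has_ubound [set opnorm (x pi) | pi in setT]].

Definition Wnorm (R : realType) (G : ucqg R) (x : dualU G) : R :=
  sup [set opnorm (x pi) | pi in setT].

Definition CG (R : realType) (G : ucqg R) : set (dualU G) :=
  [set x | finite_set [set pi | x pi != 0]].

Definition Cstar (R : realType) (G : ucqg R) : set (dualU G) :=
  [set x | Wstar x /\ forall e : R, 0 < e ->
     exists2 y, CG y & Wnorm (fun pi => x pi - y pi) < e].

(* F^{it} for positive invertible F, by diagonalization. *)
Definition imag_pow (R : realType) (n : nat) (F : 'M[R[i]]_n) (t : R) :
    'M[R[i]]_n :=
  let phase (l : R[i]) : R[i] :=
    Complex (cos (t * ln (complex.Re l))) (sin (t * ln (complex.Re l))) in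
  invmx (spectralmx F) *m diag_mx (map_mx phase (spectral_diag F))
    *m spectralmx F.

(* f |-> f \o tau_t read on families, as
   (id (x) tau_t)(U_pi) = (F_pi^{it} (x) 1) U_pi (F_pi^{-it} (x) 1). *)
Definition tau_hat (R : realType) (G : ucqg R) (t : R) (x : dualU G) : dualU G :=
  fun pi => imag_pow (irr_F pi) t *m x pi *m imag_pow (irr_F pi) (- t).

Definition dim_q (R : realType) (G : ucqg R) (pi : irr G) : R[i] :=
  \tr (irr_F pi).

Definition chi_irr (R : realType) (G : ucqg R) (pi : irr G) (x : dualU G) :
    R[i] := \tr (irr_F pi *m x pi) / dim_q pi.

Definition cqg_hom (R : realType) (G H : cqg R) (theta : G -> H) : Prop :=
  star_hom theta /\
  exists tt : qalg2 G -> qalg2 H,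
    [/\ star_hom tt,
        (forall a, tt (tinl (qalg2 G) a) = tinl (qalg2 H) (theta a)),
        (forall a, tt (tinr (qalg2 G) a) = tinr (qalg2 H) (theta a))
      & forall a, qdelta (theta a) = tt (qdelta a)].

Record ind_system (R : realType) := IndSystem {
  isys :> nat -> ucqg R ;
  isys_countable : forall N, countable [set: irr (isys N)] ;
  theta : forall N, isys N.+1 -> isys N ;
  theta_hom : forall N, cqg_hom (@theta N) ;
  theta_surj : forall N (b : isys N), exists a, theta a = b
}.
Arguments theta {R i N}.

(* G = (C, id) *)
Definition trivial_cqg (R : realType) (G : cqg R) : Prop :=
  forall a : G, exists c : R[i], a = c *: cone.

Definition prec (R : realType) (GG : ind_system R) (N : nat)
    (rho : irr (GG N)) (pi : irr (GG N.+1)) : Prop :=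
  contained (irr_rep rho) (map_mx theta (irr_rep pi)).

(* f |-> f \o theta_N *)
Definition Theta (R : realType) (GG : ind_system R) (N : nat)
    (x : dualU (GG N)) : dualU (GG N.+1) :=
  fam_of (functional_of x \o theta).

(* Theta_{m + K, K} *)
Fixpoint Theta_iter (R : realType) (GG : ind_system R) (K m : nat)
    (x : dualU (GG K)) : dualU (GG (m + K)%N) :=
  if m is m'.+1 return dualU (GG (m + K)%N)
  then Theta (@Theta_iter R GG K m' x) else x.
Arguments Theta_iter {R GG K} m x.

(* The C*-inductive limit of the W*(G_N): as the Theta_N are isometric, it is
   the completion of the union.  The values of [iota N] outside W*(G_N) are
   irrelevant. *)
Record ind_limit (R : realType) (GG : ind_system R) := IndLimit {
  ilim :> cstarAlgType R ;
  iota_lim : forall N, dualU (GG N) -> ilim ;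
  iota_linear : forall N (c : R[i]) (x y : dualU (GG N)), Wstar x -> Wstar y ->
    iota_lim (fun pi => c *: x pi + y pi) = c *: iota_lim x + iota_lim y ;
  iota_mul : forall N (x y : dualU (GG N)), Wstar x -> Wstar y ->
    iota_lim (fun pi => x pi *m y pi) = iota_lim x ** iota_lim y ;
  iota_star : forall N (x : dualU (GG N)), Wstar x ->
    iota_lim (fun pi => (x pi)^t*) = cstar (iota_lim x) ;
  iota_one : forall N,
    iota_lim (fun pi : irr (GG N) => 1%:M) = cone ;
  iota_norm : forall N (x : dualU (GG N)), Wstar x ->
    `|iota_lim x| = (Wnorm x)%:C%C ;
  iota_Theta : forall N (x : dualU (GG N)), Wstar x ->
    iota_lim (Theta x) = iota_lim x ;
  iota_dense : closure
    [set z | exists N (x : dualU (GG N)), Wstar x /\ z = iota_lim x] = setT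
}.
Arguments iota_lim {R GG} i {N}.

Definition Cstar_in (R : realType) (GG : ind_system R) (B : ind_limit GG)
    (N : nat) : set B := iota_lim B @` @Cstar R (GG N).
Arguments Cstar_in {R GG} B N.

Definition frakA (R : realType) (GG : ind_system R) (B : ind_limit GG) : set B :=
  smallest (@cstar_subalg R B) (\bigcup_N Cstar_in B N).
Arguments frakA {R GG} B.

(* The flow induced by the flows [tau_hat] on the W*(G_N); it is determined by
   this property, the union of the W*(G_N) being dense. *)
Definition induced_flow (R : realType) (GG : ind_system R) (B : ind_limit GG)
    (tau : R -> B -> B) : Prop :=
  forall t, star_hom (tau t) /\
    forall N (x : dualU (GG N)), Wstar x ->
      tau t (iota_lim B x) = iota_lim B (tau_hat t x).

(* Functionals on a C*-subalgebra S of B are functions on B of which only the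
   values on S matter. *)
Definition norm_on (R : realType) (B : cstarAlgType R) (S : set B)
    (chi : B -> R[i]) : R :=
  sup [set complex.Re `|chi x| | x in S `&` [set x | `|x| <= 1]].

Definition state_on (R : realType) (B : cstarAlgType R) (S : set B)
    (chi : B -> R[i]) : Prop :=
  [/\ linear_on S chi, (forall x, S x -> 0 <= chi (cstar x ** x))
    & norm_on S chi = 1].

(* f is the entire S-valued extension of t |-> tau_t y. *)
Definition entire_orbit (R : realType) (B : cstarAlgType R) (S : set B)
    (tau : R -> B -> B) (y : B) (f : R[i] -> B) : Prop :=
  [/\ (forall t : R, f (t%:C)%C = tau t y), (forall z, S (f z))
    & (forall z : R[i]^o, derivable (f : R[i]^o -> B) z 1)].

Definition KMS (R : realType) (B : cstarAlgType R) (S : set B)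
    (tau : R -> B -> B) (beta : R) (chi : B -> R[i]) : Prop :=
  exists D : set B,
    [/\ star_subalg D, D `<=` S, S `<=` closure D,
        (forall t y, D y -> D (tau t y))
      & forall y, D y -> exists2 f, entire_orbit S tau y f &
          forall x, D x -> chi (x ** f (Complex 0 beta)) = chi (y ** x)].

Definition Ch (R : realType) (GG : ind_system R) (B : ind_limit GG)
    (tau : R -> B -> B) : set (B -> R[i]) :=
  [set chi | [/\ state_on (frakA B) chi, KMS (frakA B) tau (-1) chi
    & forall N, (1 <= N)%N -> norm_on (Cstar_in B N) chi = 1]].
Arguments Ch {R GG} B tau _.

(* Extreme points of a convex set K of functionals on S. *)
Definition extreme_on (R : realType) (B : cstarAlgType R) (S : set B)
    (K : set (B -> R[i])) : set (B -> R[i]) :=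
  [set chi | K chi /\ forall (t : R) (chi1 chi2 : B -> R[i]), 0 < t -> t < 1 ->
     K chi1 -> K chi2 ->
     (forall x, S x ->
        chi x = (t%:C)%C * chi1 x + ((1 - t)%:C)%C * chi2 x) ->
     forall x, S x -> chi1 x = chi x /\ chi2 x = chi x].

(* Main.v *)
(* A quantized character chi is determined by its weights P_N(rho) = chi(1_rho),
   because the KMS condition forces chi(x) = P_N(rho) chi_rho(x) for x supported
   at rho.  Decomposing restrictions of irreducible representations gives
   cotransition probabilities with chi_pi o Theta_N = sum_rho lambda(pi, rho)
   chi_rho, under which the measures P_N are coherent; conversely every coherent
   family of measures defines a quantized character.

   For a function f on level K let f_n denote its image on level n under the
   cotransitions.  If E is the coherent family of chi, then E_n(M_n^2) is
   nonincreasing for every transported function M_n, so by polarization the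
   correlations c(h) = lim E_n((M_n - p) h_n) exist, where M_n is transported
   from the indicator of rho and p = P_K(rho).  Both E + c and E - c are coherent,
   so extremality gives c = 0, and the fluctuations E_n((M_n - p)^2) tend to 0.

   A potential that charges 1 for leaving a large finite set, or for a large
   deviation of one of countably many M_n, has mean less than 1 at each level, and
   every point of small potential has a predecessor of small potential.  Koenig's
   lemma gives a path along which each M_n tends to p, that is, along which the
   states chi_pi converge to chi on finitely supported elements, hence on
   C^*(G_K) by density. *)

Require Import Defs.
From HB Require Import structures.
From mathcomp Require Import all_boot all_order all_algebra.
From mathcomp Require Import all_classical all_reals all_analysis.
From mathcomp Require Import complex ring lra.

Set Implicit Arguments.
Unset Strict Implicit.
Unset Printing Implicit Defensive.

Import Order.TTheory GRing.Theory Num.Theory.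
Import numFieldNormedType.Exports.

Local Open Scope classical_set_scope.
Local Open Scope sesquilinear_scope.
Local Open Scope ring_scope.

(** * Norms and complex differentiation *)

(** The KMS condition supplies entire orbits only for the elements of some unspecified dense algebra
    D, which may contain neither 1 nor the matrix units, whereas the weights P_N come from matrix
    units. The complex analysis bridges this gap: extended by density to all x, the condition at x =
    1 makes chi invariant under the flow, and the identity theorem then moves the condition to
    eigenvectors of the flow, among them the matrix units in an eigenbasis of F_pi. These arguments
    need tau to be contractive on B, which is derived from tau being a star homomorphism. In the
    other direction, extremality speaks of states on the inductive limit, so E + c and E - c have to
    be turned into KMS states; the level states are 1-Lipschitz on the dense union of the
    W*-algebras of the levels, which determines the extension. Measures are handled as positive
    functionals on bounded functions, with tightness in place of countable additivity. *)

Section ComplexNorm.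
Variable R : realType.
Local Notation C := R[i].
Implicit Types (V : normedModType C).

(** The norm of a complex normed module takes its values in C; its real part allows real order
    reasoning. *)
Definition nrm V (v : V) : R := complex.Re `|v|.

Lemma nrmE V (v : V) : `|v| = (nrm v)%:C%C.
Proof. by rewrite /nrm RRe_real // ger0_real. Qed.

Lemma nrm_ge0 V (v : V) : 0 <= nrm v.
Proof. by rewrite -ler0c -nrmE. Qed.

Lemma nrm0 V : nrm (0 : V) = 0.
Proof. by rewrite /nrm normr0. Qed.

Lemma nrm0_eq0 V (v : V) : nrm v = 0 -> v = 0.
Proof. by move=> v0; apply/eqP; rewrite -normr_eq0 nrmE v0. Qed.

Lemma nrmN V (v : V) : nrm (- v) = nrm v.
Proof. by rewrite /nrm normrN. Qed.

Lemma nrmB V (u v : V) : nrm (u - v) = nrm (v - u).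
Proof. by rewrite /nrm distrC. Qed.

Lemma nrmD V (u v : V) : nrm (u + v) <= nrm u + nrm v.
Proof. by rewrite -lecR rmorphD /= -!nrmE ler_normD. Qed.

Lemma nrm_tri V (w u v : V) : nrm (u - v) <= nrm (u - w) + nrm (w - v).
Proof. by rewrite (le_trans _ (nrmD _ _)) // addrA subrK. Qed.

Lemma nrm_sum V I (r : seq I) (P : pred I) (F : I -> V) :
  nrm (\sum_(i <- r | P i) F i) <= \sum_(i <- r | P i) nrm (F i).
Proof.
elim/big_ind2 : _ => [|x a y b xa yb|//]; first by rewrite nrm0.
exact: le_trans (nrmD _ _) (lerD xa yb).
Qed.

Lemma nrmZ V (c : C) (v : V) : nrm (c *: v) = nrm (c : C^o) * nrm v.
Proof. by apply: complexI; rewrite rmorphM /= -!nrmE normrZ. Qed.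

Lemma nrmCM (x y : C^o) : nrm (x * y : C^o) = nrm x * nrm y.
Proof. by apply: complexI; rewrite rmorphM /= -!nrmE normrM. Qed.

Lemma nrmCV (x : C^o) : nrm (x^-1 : C^o) = (nrm x)^-1.
Proof. by apply: complexI; rewrite fmorphV /= -!nrmE normfV. Qed.

Lemma nrmCX (x : C^o) n : nrm (x ^+ n : C^o) = nrm x ^+ n.
Proof. by apply: complexI; rewrite rmorphXn /= -!nrmE normrX. Qed.

Lemma nrm_real (x : R) : nrm (x%:C%C : C^o) = `|x|.
Proof. by rewrite /nrm normc_def /= expr0n addr0 sqrtr_sqr. Qed.

Lemma nrm_i : nrm (Complex 0 1 : C^o) = 1.
Proof. by rewrite /nrm normc_def /= expr0n add0r expr1n sqrtr1. Qed.

Lemma nrm_Complex (x y : R) : nrm (Complex x y : C^o) <= `|x| + `|y|.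
Proof.
have -> : Complex x y = x%:C%C + y%:C%C * Complex 0 1.
  by apply/eqP; rewrite eq_complex /=; apply/andP; split; apply/eqP; ring.
by rewrite (le_trans (nrmD _ _))// nrmCM !nrm_real nrm_i mulr1.
Qed.

Lemma Re_le_nrm (z : C^o) : `|complex.Re z| <= nrm z.
Proof. by rewrite -lecR -nrmE normc_ge_Re. Qed.

Lemma Im_le_nrm (z : C^o) : `|complex.Im z| <= nrm z.
Proof.
case: z => a b; rewrite /nrm normc_def /= -sqrtr_sqr ler_wsqrtr //.
by rewrite lerDr sqr_ge0.
Qed.

Lemma sqr_nrm (z : C^o) :
  nrm z ^+ 2 = complex.Re z ^+ 2 + complex.Im z ^+ 2.
Proof. by rewrite /nrm normc_def /= sqr_sqrtr // addr_ge0 ?sqr_ge0. Qed.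

Lemma nrm_le_lim (M : R) V (v : V) :
  (forall e : R, 0 < e -> nrm v <= M + e) -> nrm v <= M.
Proof. by move=> h; apply/ler_addgt0Pr => e /h. Qed.

Lemma lt0C (e : C) : 0 < e -> exists2 d : R, 0 < d & e = d%:C%C.
Proof.
move=> e0; have er : e = (complex.Re e)%:C%C.
  by rewrite RRe_real // gtr0_real.
by exists (complex.Re e) => //; rewrite -ltcR -er.
Qed.

(** The derivative estimate is kept multiplied out and with real tolerances, so that h = 0 is no
    exception and every use is a plain norm inequality. *)
Definition vdiff V (f : C -> V) (z : C) := exists L : V,
  forall e : R, 0 < e -> exists2 d : R, 0 < d & forall h : C^o, nrm h < d ->
    nrm (f (z + h) - f z - h *: L) <= e * nrm h.

Lemma derivable_vdiff V (f : C^o -> V) (z : C^o) :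
  derivable f z 1 -> vdiff f z.
Proof.
move=> /cvg_ex[L /cvgrPdist_lt fL]; exists L => e e0.
have /fL : 0 < (e%:C)%C by rewrite ltcR.
move=> /nbhs_ballP[d /= /lt0C[r r0 ->]] rf; exists r => // h hr.
have [->|h0] := eqVneq h 0.
  by rewrite addr0 subrr scale0r subr0 !nrm0 mulr0.
have /rf/(_ h0)/= : ball (0 : C^o) r%:C%C h.
  by rewrite -ball_normE /= sub0r normrN nrmE ltcR.
rewrite nrmE ltcR => /ltW le_e.
have -> : f (z + h) - f z - h *: L =
    - h *: (L - h^-1 *: (f (h *: 1 + z) - f z)).
  rewrite scalerBr !scaleNr opprK scalerA mulfV // scale1r [h *: 1]mulr1.
  by rewrite [h + z]addrC [RHS]addrC.
by rewrite nrmZ nrmN mulrC ler_wpM2r // nrm_ge0.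
Qed.

Lemma vdiff_derivable V (f : C^o -> V) (z : C^o) :
  vdiff f z -> derivable f z 1.
Proof.
move=> [L fL]; apply/cvg_ex; exists L; apply/cvgrPdist_le => e /lt0C[r r0 ->].
have [d d0 df] := fL _ r0; apply/nbhs_ballP; exists d%:C%C; rewrite /= ?ltcR //.
move=> h; rewrite -ball_normE /= sub0r normrN nrmE ltcR => /df {}df h0.
rewrite nrmE lecR.
have hn0 : 0 < nrm (h : C^o).
  by rewrite lt_neqAle nrm_ge0 andbT eq_sym; apply: contraNneq h0 => /nrm0_eq0->.
rewrite -(ler_pM2r hn0) (le_trans _ df) // mulrC -nrmZ -nrmN scalerBr.
rewrite scalerA mulfV // scale1r [h *: 1]mulr1 [h + z]addrC opprB.
by rewrite -addrA -opprD.
Qed.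

Lemma vdiff_cst V (v : V) z : vdiff (fun=> v) z.
Proof.
exists 0 => e e0; exists 1 => // h _.
by rewrite subrr scaler0 subr0 nrm0 mulr_ge0 ?nrm_ge0 // ltW.
Qed.

Lemma vdiff_id z : vdiff (fun x => x : C^o) z.
Proof.
exists 1 => e e0; exists 1 => // h _.
by rewrite [_ *: _]mulr1 [z + h]addrC addrK subrr nrm0 mulr_ge0 ?nrm_ge0 // ltW.
Qed.

Lemma vdiffD V (f g : C -> V) z :
  vdiff f z -> vdiff g z -> vdiff (fun x => f x + g x) z.
Proof.
move=> /vdiff_derivable df /vdiff_derivable dg.
exact/derivable_vdiff/derivableD.
Qed.

Lemma vdiffB V (f g : C -> V) z :
  vdiff f z -> vdiff g z -> vdiff (fun x => f x - g x) z.
Proof.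
move=> /vdiff_derivable df /vdiff_derivable dg.
exact/derivable_vdiff/derivableB.
Qed.

Lemma vdiffM (f g : C -> C^o) z :
  vdiff f z -> vdiff g z -> vdiff (fun x => f x * g x : C^o) z.
Proof.
move=> /vdiff_derivable df /vdiff_derivable dg.
exact: (derivable_vdiff (@derivableM C C^o f g z 1 df dg)).
Qed.

Lemma vdiffX (f : C -> C^o) n z :
  vdiff f z -> vdiff (fun x => f x ^+ n : C^o) z.
Proof.
move=> df; elim: n => [|n ih]; first exact: (vdiff_cst (1 : C^o)).
by under eq_fun do rewrite exprS; exact: vdiffM.
Qed.

Lemma vdiffV (f : C -> C^o) z :
  f z != 0 -> vdiff f z -> vdiff (fun x => (f x)^-1 : C^o) z.
Proof.
by move=> fz /vdiff_derivable df; exact: (derivable_vdiff (@derivableV C C^o f z 1 fz df)).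
Qed.

Lemma vdiff_bound V (f : C -> V) z : vdiff f z ->
  exists2 K : R, 0 < K & exists2 d : R, 0 < d &
    forall h : C^o, nrm h < d -> nrm (f (z + h) - f z) <= K * nrm h.
Proof.
move=> [L /(_ 1 ltr01)[d d0 df]]; exists (1 + nrm L).
  by rewrite ltr_wpDr ?nrm_ge0.
exists d => // h /df {}df.
rewrite -[f _ - _](subrK (h *: L)) (le_trans (nrmD _ _)) // mulrDl lerD //.
by rewrite nrmZ mulrC.
Qed.

Lemma vdiff_comp V (f : C -> V) (g : C -> C^o) z :
  vdiff g z -> vdiff f (g z) -> vdiff (f \o g) z.
Proof.
move=> dg [L fL]; have [K K0 [d1 d10 gK]] := vdiff_bound dg.
case: dg => M gM; exists (M *: L) => e e0.
(* With k = g (z + h) - g z, the remainder is (f (g z + k) - f (g z) - k L) + (k - h M) L; each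
   summand gets e / 2. The first uses |k| <= K |h|; in the second, 1 + |L| replaces |L| to avoid
   dividing by 0. *)
have [d2 d20 fd] := fL (e / (2 * K)) ltac:(by rewrite divr_gt0 // mulr_gt0).
have L1 : 0 < 2 * (1 + nrm L) by rewrite mulr_gt0 // ltr_wpDr ?nrm_ge0.
have [d3 d30 gd] := gM (e / (2 * (1 + nrm L))) ltac:(by rewrite divr_gt0).
exists (Num.min d1 (Num.min d3 (d2 / K))).
  by rewrite !lt_min d10 d30 divr_gt0.
move=> h; rewrite !lt_min => /and3P[h1 h3 h2] /=.
have gh := gK _ h1; set k : C^o := g (z + h) - g z in gh *.
have kd : nrm k < d2.
  by rewrite (le_lt_trans gh) // mulrC -ltr_pdivlMr.
have gk : g z + k = g (z + h) by rewrite /k addrC subrK.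
have := fd k kd; rewrite gk => H1.
have H2 := gd _ h3.
rewrite -[X in nrm (X - _)](subrK (k *: L)) -addrA.
rewrite scalerA -scalerBl (le_trans (nrmD _ _)) //.
rewrite [leRHS](_ : _ = e / 2 * nrm h + e / 2 * nrm h); last by field.
rewrite lerD //.
  rewrite (le_trans H1) // (le_trans (ler_wpM2l _ gh)) //.
    by rewrite divr_ge0 ?mulr_ge0 // ltW.
  rewrite [leLHS](_ : _ = e / 2 * nrm h) //; field; exact: lt0r_neq0.
rewrite nrmZ (le_trans (ler_wpM2r (nrm_ge0 _) H2)) //.
have L2 : 0 < 1 + nrm L by rewrite ltr_wpDr ?nrm_ge0.
rewrite [leLHS](_ : _ = e / 2 * nrm h * (nrm L / (1 + nrm L))); last first.
  by field; rewrite lt0r_neq0.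
rewrite ler_piMr ?mulr_ge0 ?nrm_ge0 ?invr_ge0 ?(ltW e0) //.
by rewrite ler_pdivrMr // mul1r lerDr.
Qed.

End ComplexNorm.

(** * Goursat's lemma *)

Section Goursat.
Variable R : realType.
Local Notation C := R[i].

(** With 2^n equal steps, halving the interval splits a sum of order n.+1 exactly into two sums of
    order n. *)
Definition dyadic_sum n (phi : R -> C^o) (a w : R) : C^o :=
  \sum_(k < 2 ^ n) phi (a + k%:R * (w / 2 ^+ n)) * (w / 2 ^+ n)%:C%C.

Lemma dyadic_sumS n phi a w : dyadic_sum n.+1 phi a w =
  dyadic_sum n phi a (w / 2) + dyadic_sum n phi (a + w / 2) (w / 2).
Proof.
have e1 : w / 2 / 2 ^+ n = w / 2 ^+ n.+1 by rewrite exprS invfM mulrA.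
rewrite /dyadic_sum e1 expnS mul2n -addnn big_split_ord /=; congr (_ + _).
apply: eq_bigr => k _; congr (phi _ * _).
rewrite natrD mulrDl addrA; congr (_ + _ + _).
rewrite natrX exprS; field; exact: expf_neq0.
Qed.

Lemma dyadic_sumB n phi psi a w :
  dyadic_sum n (fun x => phi x - psi x) a w =
  dyadic_sum n phi a w - dyadic_sum n psi a w.
Proof. by rewrite -sumrB; apply: eq_bigr => k _; rewrite mulrBl. Qed.

Lemma dyadic_sum_cst n (c : C) a w : dyadic_sum n (fun=> c) a w = c * w%:C%C.
Proof.
rewrite /dyadic_sum sumr_const card_ord -[LHS]mulr_natr -mulrA; congr (_ * _).
have -> : (2 ^ n)%:R = (2 ^+ n : R)%:C%C :> C by rewrite -natrX rmorph_nat.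
by rewrite -rmorphM divfK // expf_neq0.
Qed.

Lemma dyadic_sum_le n phi a w M : 0 <= w ->
  (forall x, a <= x <= a + w -> nrm (phi x) <= M) ->
  nrm (dyadic_sum n phi a w) <= M * w.
Proof.
move=> w0 hM; apply: le_trans (nrm_sum _ _ _) _.
have w2 : 0 <= w / 2 ^+ n by rewrite divr_ge0 // exprn_ge0.
apply: (@le_trans _ _ (\sum_(k < 2 ^ n) M * (w / 2 ^+ n))).
  apply: ler_sum => k _; rewrite nrmCM nrm_real ger0_norm // ler_wpM2r //.
  apply: hM; rewrite lerDl mulr_ge0 //= lerD2l.
  rewrite mulrCA ler_piMr //.
  by rewrite ler_pdivrMr ?exprn_gt0 // mul1r -natrX ler_nat ltnW.
rewrite sumr_const card_ord -[leLHS]mulr_natr -mulrA natrX divfK //.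
Qed.

(** Riemann sum for the counterclockwise contour integral around the rectangle with lower left
    corner (a, b); opposite sides are paired under one sum. *)
Definition rect_sum (f : C -> C^o) n (a b w h : R) : C^o :=
  dyadic_sum n (fun x => f (Complex x b) - f (Complex x (b + h))) a w +
  Complex 0 1 *
  dyadic_sum n (fun y => f (Complex (a + w) y) - f (Complex a y)) b h.

(** The sides interior to the subdivision are run through once in each direction and cancel. *)
Lemma rect_sumS f n a b w h : rect_sum f n.+1 a b w h =
  rect_sum f n a b (w / 2) (h / 2) + rect_sum f n (a + w / 2) b (w / 2) (h / 2)
  + (rect_sum f n a (b + h / 2) (w / 2) (h / 2)
  + rect_sum f n (a + w / 2) (b + h / 2) (w / 2) (h / 2)).
Proof.
have e2 (x y : R) : x + y / 2 + y / 2 = x + y by field.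
rewrite /rect_sum !dyadic_sumB !dyadic_sumS !e2; ring.
Qed.

Lemma rect_sumB f g n a b w h :
  rect_sum (fun z => f z - g z) n a b w h =
  rect_sum f n a b w h - rect_sum g n a b w h.
Proof. rewrite /rect_sum !dyadic_sumB; ring. Qed.

(** Across the rectangle an affine function changes by constants, i L h vertically and L w
    horizontally, and the two resulting contributions are opposite. *)
Lemma rect_sum_affine (c L : C) n a b w h :
  rect_sum (fun z => c + L * z) n a b w h = 0.
Proof.
rewrite /rect_sum.
under [X in dyadic_sum _ X]eq_fun => x.
  have -> : c + L * Complex x b - (c + L * Complex x (b + h)) =
    - (L * (Complex 0 1 * h%:C%C)).
    have -> : Complex x (b + h) = Complex x b + Complex 0 1 * h%:C%C.
      by apply/eqP; rewrite eq_complex /=; apply/andP; split; apply/eqP; ring.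
    ring.
  over.
under [X in _ + _ * dyadic_sum _ X _ _]eq_fun => y.
  have -> : c + L * Complex (a + w) y - (c + L * Complex a y) = L * w%:C%C.
    have -> : Complex (a + w) y = Complex a y + w%:C%C.
      by apply/eqP; rewrite eq_complex /=; apply/andP; split; apply/eqP; ring.
    ring.
  over.
rewrite !dyadic_sum_cst; ring.
Qed.

Lemma rect_sum_le f n a b w h M : 0 <= w -> 0 <= h ->
  (forall x y, a <= x <= a + w -> b <= y <= b + h ->
     nrm (f (Complex x y)) <= M) ->
  nrm (rect_sum f n a b w h) <= 2 * M * (w + h).
Proof.
move=> w0 h0 hM; apply: le_trans (nrmD _ _) _; rewrite nrmCM nrm_i mul1r.
rewrite mulrDr; apply: lerD.
  apply: dyadic_sum_le => // x xab; apply: le_trans (nrmD _ _) _.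
  by rewrite nrmN mulr2n mulrDl mul1r lerD // hM // lexx /= ?lerDl ?h0.
apply: dyadic_sum_le => // x xab; apply: le_trans (nrmD _ _) _.
by rewrite nrmN mulr2n mulrDl mul1r lerD // hM // lexx /= ?lerDl ?w0.
Qed.

(** Left end points increase and right end points decrease, so the supremum of the left end points
    lies in every interval. *)
Lemma nested_halving (a : nat -> R) (w : R) : 0 < w ->
  (forall m, a m.+1 = a m \/ a m.+1 = a m + w / 2 ^+ m.+1) ->
  exists x, forall m, a m <= x <= a m + w / 2 ^+ m.
Proof.
move=> w0 aS.
have w2 m : 0 < w / 2 ^+ m by rewrite divr_gt0 // exprn_gt0.
have half m : w / 2 ^+ m = w / 2 ^+ m.+1 + w / 2 ^+ m.+1.
  by rewrite exprS; field; exact: expf_neq0.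
have incr m k : a m <= a (m + k)%N.
  elim: k => [|k ih]; first by rewrite addn0.
  rewrite addnS (le_trans ih) //.
  by case: (aS (m + k)%N) => -> //; rewrite lerDl ltW.
have decr m k : a (m + k)%N + w / 2 ^+ (m + k) <= a m + w / 2 ^+ m.
  elim: k => [|k ih]; first by rewrite addn0.
  rewrite addnS (le_trans _ ih) //.
  rewrite [w / 2 ^+ (m + k)]half; case: (aS (m + k)%N) => ->.
    by rewrite addrA lerDl ltW.
  by rewrite addrA.
pose A := [set a m | m in setT].
have ubA m : ubound A (a m + w / 2 ^+ m).
  move=> _ [k _ <-]; have [km|mk] := leqP k m.
    rewrite -(subnKC km) (le_trans (incr k (m - k)%N)) // lerDl ltW //.
  rewrite -(subnKC (ltnW mk)) (le_trans _ (decr m (k - m)%N)) //.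
  by rewrite lerDl ltW.
have supA : has_sup A.
  by split; [exists (a 0%N); exists 0%N|exists (a 0%N + w / 2 ^+ 0); exact: ubA].
exists (sup A) => m; apply/andP; split.
  by apply: sup_upper_bound => //; exists m.
by apply: ge_sup; [case: supA|exact: ubA].
Qed.

(* Goursat's subdivision, on Riemann sums: [rect_sum] is exactly additive under
   halving and vanishes on affine functions, so no integral is needed. *)
Lemma goursat (f : C -> C^o) (a b w h : R) : 0 < w -> 0 < h ->
  (forall z, vdiff f z) ->
  forall e : R, 0 < e ->
    exists N, forall n, (N <= n)%N -> nrm (rect_sum f n a b w h) <= e.
Proof.
move=> w0 h0 df e e0.
pose W m := w / 2 ^+ m; pose H m := h / 2 ^+ m.
have W0 m : 0 < W m by rewrite divr_gt0 // exprn_gt0.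
have H0 m : 0 < H m by rewrite divr_gt0 // exprn_gt0.
(* Badness is required at arbitrarily large n: subdividing lowers n by one, and the choice of a bad
   quarter must not depend on n. *)
pose bad m (p : R * R) := forall N, exists2 n, (N <= n)%N &
  e / 4 ^+ m < nrm (rect_sum f n p.1 p.2 (W m) (H m)).
pose child m (p q : R * R) :=
  (q.1 = p.1 \/ q.1 = p.1 + W m.+1) /\ (q.2 = p.2 \/ q.2 = p.2 + H m.+1).
have notbad m p : ~ bad m p -> exists N, forall n, (N <= n)%N ->
    nrm (rect_sum f n p.1 p.2 (W m) (H m)) <= e / 4 ^+ m.
  move=> /existsNP[N hN]; exists N => n Nn; rewrite leNgt; apply/negP => bd.
  by apply: hN; exists n.
have step m p : bad m p -> exists2 q, child m p q & bad m.+1 q.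
  move=> bmp; apply: contrapT => nq.
  have good q : child m p q -> exists N, forall n, (N <= n)%N ->
      nrm (rect_sum f n q.1 q.2 (W m.+1) (H m.+1)) <= e / 4 ^+ m.+1.
    by move=> cq; apply: notbad => bq; apply: nq; exists q.
  have [N1 h1] := good (p.1, p.2) (conj (or_introl erefl) (or_introl erefl)).
  have [N2 h2] := good (p.1 + W m.+1, p.2)
    (conj (or_intror erefl) (or_introl erefl)).
  have [N3 h3] := good (p.1, p.2 + H m.+1)
    (conj (or_introl erefl) (or_intror erefl)).
  have [N4 h4] := good (p.1 + W m.+1, p.2 + H m.+1)
    (conj (or_intror erefl) (or_intror erefl)).
  have [[|n]] := bmp (maxn (maxn N1 N2) (maxn N3 N4)).+1; first by [].
  rewrite ltnS !geq_max => /andP[/andP[n1 n2] /andP[n3 n4]].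
  apply/negP; rewrite -leNgt rect_sumS.
  have eW : W m / 2 = W m.+1 by rewrite /W exprSr invfM mulrA.
  have eH : H m / 2 = H m.+1 by rewrite /H exprSr invfM mulrA.
  rewrite eW eH.
  have -> : e / 4 ^+ m = e / 4 ^+ m.+1 + e / 4 ^+ m.+1 +
      (e / 4 ^+ m.+1 + e / 4 ^+ m.+1).
    by rewrite exprS; field; exact: expf_neq0.
  rewrite (le_trans (nrmD _ _)) // lerD // (le_trans (nrmD _ _)) // lerD //.
  - exact: h1.
  - exact: h2.
  - exact: h3.
  - exact: h4.
apply: contrapT => nN.
have bad0 : bad 0%N (a, b).
  move=> N; apply: contrapT => nb; apply: nN; exists N => n Nn.
  rewrite leNgt; apply/negP => lt; apply: nb; exists n => //.
  by rewrite /W /H !expr0 !divr1.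
(* Totalized for the iteration: a rectangle that is not bad is sent to itself. *)
have step' m p : exists q, bad m p -> child m p q /\ bad m.+1 q.
  by have [/step[q ? ?]|?] := pselect (bad m p); [exists q|exists p].
pose nxt m p := projT1 (cid (step' m p)).
have nxtP m p : bad m p -> child m p (nxt m p) /\ bad m.+1 (nxt m p).
  by rewrite /nxt; case: cid.
pose s := fix s m := if m is m'.+1 then nxt m' (s m') else (a, b).
have sb m : bad m (s m) by elim: m => [//|m /nxtP[]].
have sc m : child m (s m) (s m.+1) by have /nxtP[] := sb m.
have [x hx] := @nested_halving (fun m => (s m).1) w w0 (fun m => (sc m).1).
have [y hy] := @nested_halving (fun m => (s m).2) h h0 (fun m => (sc m).2).
have [L fL] := df (Complex x y).
have wh0 : 0 < w + h by rewrite addr_gt0.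
(* Chosen so that the final bound 2 e' ((w + h) / 2^m)^2 equals e / 4^m. *)
pose e' := e / (2 * (w + h) ^+ 2).
have e'0 : 0 < e' by rewrite divr_gt0 // mulr_gt0 // exprn_gt0.
have [d d0 fd] := fL _ e'0.
have [m hm] : exists m, (w + h) / 2 ^+ m < d.
  exists (Num.bound ((w + h) / d)).
  rewrite ltr_pdivrMr ?exprn_gt0 // mulrC -ltr_pdivrMr //.
  rewrite (lt_le_trans (archi_boundP (ltW (divr_gt0 wh0 d0)))) //.
  by rewrite -natrX ler_nat ltnW // ltn_expl.
have [n _] := sb m 0%N; apply/negP; rewrite -leNgt.
pose z0 := Complex x y.
(* The tangent map at the limit point has vanishing contour sums, so only the differentiability
   remainder has to be estimated. *)
pose g z := (f z0 - L * z0) + L * z.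
have -> : rect_sum f n (s m).1 (s m).2 (W m) (H m) =
    rect_sum (fun z => f z - g z) n (s m).1 (s m).2 (W m) (H m).
  by rewrite rect_sumB rect_sum_affine subr0.
have WH : W m + H m = (w + h) / 2 ^+ m by rewrite /W /H mulrDl.
have le : nrm (rect_sum (fun z => f z - g z) n (s m).1 (s m).2 (W m) (H m)) <=
    2 * (e' * (W m + H m)) * (W m + H m).
  apply: rect_sum_le; [exact: ltW|exact: ltW|] => u v hu hv.
  have dist : nrm (Complex u v - z0 : C^o) <= W m + H m.
    have -> : Complex u v - z0 = Complex (u - x) (v - y) by [].
    have := hx m; have := hy m; rewrite -/(W m) -/(H m).
    move=> /andP[y1 y2] /andP[x1 x2]; case/andP: hu hv => u1 u2 /andP[v1 v2].
    rewrite (le_trans (nrm_Complex _ _)) // lerD // ler_norml; lra.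
  have := fd (Complex u v - z0 : C^o); rewrite WH in dist.
  move=> /(_ (le_lt_trans dist hm)).
  rewrite -/z0 subrKC /g => le1.
  have -> : f (Complex u v) - (f z0 - L * z0 + L * Complex u v) =
      f (Complex u v) - f z0 - (Complex u v - z0 : C^o) *: L.
    have aux (F A Z U l : C) : F - (A - l * Z + l * U) = F - A - (U - Z) * l.
      by ring.
    exact: aux.
  by rewrite (le_trans le1) // WH ler_wpM2l // ltW.
rewrite (le_trans le) // WH.
have -> : (4 : R) ^+ m = 2 ^+ m * 2 ^+ m by rewrite -exprMn; congr (_ ^+ _); ring.
rewrite /e' [leLHS](_ : _ = e / (2 ^+ m * 2 ^+ m)) //.
by field; rewrite !expf_neq0 ?(lt0r_neq0 wh0).
Qed.

End Goursat.

(** * Entire functions *)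

Section ComplexExp.
Variable R : realType.
Local Notation C := R[i].

Definition cexp (z : C) : C :=
  (expR (complex.Re z))%:C%C *
  Complex (cos (complex.Im z)) (sin (complex.Im z)).

Definition cis (t : R) : C := Complex (cos t) (sin t).

Lemma cexpD z w : cexp (z + w) = cexp z * cexp w.
Proof.
case: z w => [a b] [c d]; rewrite /cexp /= expRD cosD sinD.
by apply/eqP; rewrite eq_complex /=; apply/andP; split; apply/eqP; ring.
Qed.

Lemma cexp0 : cexp 0 = 1.
Proof. by rewrite /cexp /= expR0 cos0 sin0 mul1r. Qed.

Lemma cexp_real (t : R) : cexp t%:C%C = (expR t)%:C%C.
Proof. by rewrite /cexp /= cos0 sin0 mulr1. Qed.

Lemma cexp_imag (t : R) : cexp (Complex 0 t) = cis t.
Proof. by rewrite /cexp /= expR0 mul1r. Qed.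

Lemma cexp_neq0 z : cexp z != 0.
Proof.
apply/eqP => z0; have := cexpD z (- z).
by rewrite subrr cexp0 z0 mul0r => /eqP; rewrite oner_eq0.
Qed.

Lemma cexp_2pi x : cexp (Complex x (2 * pi)) = cexp (Complex x 0).
Proof. by rewrite /cexp /= mulr_natl cos2pi sin2pi cos0 sin0. Qed.

Lemma nrm_cis t : nrm (cis t : C^o) = 1.
Proof. by rewrite /nrm normc_def /= cos2Dsin2 sqrtr1. Qed.

Lemma nrm_cexp z : nrm (cexp z : C^o) = expR (complex.Re z).
Proof.
by rewrite /cexp nrmCM nrm_real -/(cis _) nrm_cis mulr1 ger0_norm ?expR_ge0.
Qed.

Lemma cis0 : cis 0 = 1.
Proof. by rewrite /cis cos0 sin0. Qed.

Lemma cisD s t : cis (s + t) = cis s * cis t.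
Proof.
rewrite /cis cosD sinD.
by apply/eqP; rewrite eq_complex /=; apply/andP; split; apply/eqP; ring.
Qed.

Lemma cisN t : cis (- t) = (cis t)^*.
Proof. by rewrite /cis cosN sinN. Qed.

(** At t = pi / (a - b) the quotient of the two sides would be -1. *)
Lemma cis_inj (a b : R) : (forall t, cis (t * a) = cis (t * b)) -> a = b.
Proof.
move=> ab; apply/eqP; rewrite -subr_eq0; apply/negP => /negP d0.
have key t : cis (t * (a - b)) = 1.
  by rewrite mulrBr cisD ab -cisD subrr cis0.
have := key (pi / (a - b)); rewrite divfK // => /eqP.
by rewrite eq_complex /= cospi => /andP[/eqP n1 _]; lra.
Qed.

Lemma real_vdiff0 (f : R -> R) (l : R) : is_derive (0 : R) (1 : R) f l ->
  forall e : R, 0 < e -> exists2 d : R, 0 < d & forall h : R, `|h| < d ->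
    `|f h - f 0 - h * l| <= e * `|h|.
Proof.
move=> [df dl] e e0; have : h^-1 *: ((f \o shift 0) (h *: 1) - f 0) @[h --> 0^']
    --> l by rewrite -dl; exact: df.
move=> /cvgrPdist_lt/(_ _ e0) /nbhs_ballP[d /= d0 fd]; exists d => // h hd.
have [->|h0] := eqVneq h 0; first by rewrite subrr mul0r subr0 normr0 mulr0.
have := fd h; rewrite -ball_normE /= sub0r normrN => /(_ hd h0)/ltW.
rewrite [h *: 1]mulr1 addr0 => le.
have -> : f h - f 0 - h * l = - (h * (l - h^-1 *: (f h - f 0))).
  by rewrite mulrBr [h * (h^-1 *: _)]mulrA mulfV // mul1r opprB.
by rewrite normrN normrM mulrC ler_wpM2r.
Qed.

Lemma real_is_derive0 (u : R -> R) (x : R) :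
  (forall e : R, 0 < e -> exists2 d : R, 0 < d & forall h : R, `|h| < d ->
     `|u (x + h) - u x| <= e * `|h|) ->
  is_derive x (1 : R) u (0 : R).
Proof.
move=> hu.
have cv : h^-1 *: ((u \o shift x) (h *: (1 : R)) - u x) @[h --> 0^'] --> (0 : R).
  apply/cvgrPdist_le => e e0; have [d d0 hd] := hu _ e0.
  apply/nbhs_ballP; exists d => //= h; rewrite -ball_normE /= sub0r normrN.
  move=> hh h0; rewrite sub0r normrN normrM normfV [h *: 1]mulr1.
  by rewrite mulrC ler_pdivrMr ?normr_gt0 // [h + x]addrC hd.
split; first by apply/cvg_ex; exists 0.
exact: cvg_lim cv.
Qed.

Lemma vdiff_cexp0 : vdiff (cexp : C -> C^o) 0.
Proof.
(* Below, four errors of at most e', 2e', 2e' and e' times |h| are added, which stays within e / 8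
   each twice over; the cap 1 bounds [expR u] by 2. *)
exists 1 => e e0; pose e' := Num.min (e / 8) 1.
have e'0 : 0 < e' by rewrite lt_min ltr01 divr_gt0.
have e'1 : e' <= 1 by rewrite /e' ge_min lexx orbT.
have e'8 : 8 * e' <= e by have := ge_min (e/8) (e/8) 1; rewrite -/e'; rewrite lexx /=; lra.
have [d1 d10 h1] := real_vdiff0 (is_derive_expR (0 : R)) e'0.
have [d2 d20 h2] := real_vdiff0 (is_derive_cos (0 : R)) e'0.
have [d3 d30 h3] := real_vdiff0 (is_derive_sin (0 : R)) e'0.
exists (Num.min (Num.min d1 d2) (Num.min d3 (e' / 4))).
  by rewrite !lt_min d10 d20 d30 divr_gt0.
case=> u v; rewrite !lt_min => /andP[/andP[b1 b2] /andP[b3 b4]].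
set m := nrm _ in b1 b2 b3 b4 *.
have um : `|u| <= m := Re_le_nrm (Complex u v : C^o).
have vm : `|v| <= m := Im_le_nrm (Complex u v : C^o).
have := h1 u (le_lt_trans um b1); rewrite expR0 mulr1 => hu.
have := h2 v (le_lt_trans vm b2); rewrite cos0 sin0 oppr0 mulr0 subr0 => hv.
have := h3 v (le_lt_trans vm b3); rewrite sin0 cos0 mulr1 subr0 => hs.
rewrite add0r cexp0 [_ *: _]mulr1.
have -> : cexp (Complex u v) - 1 - Complex u v = Complex
    ((expR u - 1 - u) + expR u * (cos v - 1))
    (expR u * (sin v - v) + v * (expR u - 1)).
  by apply/eqP; rewrite /cexp eq_complex /=; apply/andP; split; apply/eqP; ring.
apply: le_trans (nrm_Complex _ _) _.
have m0 : 0 <= m := nrm_ge0 _.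
have eu1 : `|expR u - 1| <= e'.
  have -> : expR u - 1 = (expR u - 1 - u) + u by ring.
  apply: le_trans (ler_normD _ _) _.
  have := ler_wpM2l (ltW e'0) um.
  have : e' * m <= 1 * m by exact: ler_wpM2r.
  lra.
have eu2 : `|expR u| <= 2.
  have -> : expR u = (expR u - 1) + 1 by ring.
  by apply: le_trans (ler_normD _ _) _; rewrite normr1; lra.
have p1 : e' * `|u| <= e' * m by rewrite ler_wpM2l // ltW.
have p2 : e' * `|v| <= e' * m by rewrite ler_wpM2l // ltW.
have q1 : `|expR u * (cos v - 1)| <= 2 * (e' * m).
  by rewrite normrM ler_pM // (le_trans hv).
have q2 : `|expR u * (sin v - v)| <= 2 * (e' * m).
  by rewrite normrM ler_pM // (le_trans hs).
have q3 : `|v * (expR u - 1)| <= m * e' by rewrite normrM ler_pM.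
have r1 := ler_normD (expR u - 1 - u) (expR u * (cos v - 1)).
have r2 := ler_normD (expR u * (sin v - v)) (v * (expR u - 1)).
have : 8 * e' * m <= e * m by exact: ler_wpM2r.
have : 0 <= e' * m by rewrite mulr_ge0 // ltW.
lra.
Qed.

Lemma vdiff_cexp z : vdiff (cexp : C -> C^o) z.
Proof.
have [L hL] := vdiff_cexp0; exists (cexp z * L) => e e0.
have c0 : 0 < nrm (cexp z : C^o) by rewrite nrm_cexp expR_gt0.
have [d d0 hd] := hL (e / nrm (cexp z : C^o)) ltac:(by rewrite divr_gt0).
exists d => // h /hd; rewrite add0r cexp0 => le.
rewrite cexpD.
have -> : cexp z * cexp h - cexp z - h *: (cexp z * L : C^o) =
    cexp z * (cexp h - 1 - h *: L : C^o).
  have aux (a b l k : C) : a * b - a - k * (a * l) = a * (b - 1 - k * l).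
    by ring.
  exact: aux.
rewrite nrmCM (le_trans (ler_wpM2l (nrm_ge0 _) le)) //.
by rewrite mulrA mulrCA mulfV ?mulr1 // lt0r_neq0.
Qed.

Lemma vdiff_cexp_lin (c : C) z : vdiff (fun z => cexp (c * z) : C^o) z.
Proof.
apply: (@vdiff_comp _ _ (cexp : C -> C^o) (fun z => c * z : C^o)).
  by apply: vdiffM; [exact: vdiff_cst|exact: vdiff_id].
exact: vdiff_cexp.
Qed.

(* Goursat applied to [q \o cexp], which is 2 pi i-periodic: circle means of [q]
   do not depend on the radius, and tend to [L] at the origin. *)
Lemma mean_value_bound (q : C -> C^o) (L : C^o) (r M : R) : 0 < r ->
  (forall z, z != 0 -> vdiff q z) ->
  (forall e : R, 0 < e -> exists2 d : R, 0 < d &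
     forall z : C^o, z != 0 -> nrm z < d -> nrm (q z - L) <= e) ->
  (forall y : R, 0 <= y <= 2 * pi -> nrm (q (r%:C%C * cis y)) <= M) ->
  nrm L <= M.
Proof.
move=> r0 dq q0 qM.
have pi2 : 0 < 2 * pi :> R by rewrite mulr_gt0 // pi_gt0.
have key (e : R) : 0 < e -> nrm L <= M + 2 * e.
  move=> e0; have [d d0 qd] := q0 _ e0.
  (* The exponential wraps the rectangle over [a, b] of height 2 pi around the annulus between the
     radii e^a <= d / 2 and e^b = r; the term b - 1 keeps the width positive. *)
  pose b := ln r; pose a := Num.min (b - 1) (ln (d / 2)).
  have ab : 0 < b - a by rewrite subr_gt0 /a gt_min ltrBlDr ltrDl ltr01.
  pose G z := q (cexp z).
  have dG z : vdiff G z.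
    apply: (@vdiff_comp _ _ q (cexp : C -> C^o)); first exact: vdiff_cexp.
    exact/dq/cexp_neq0.
  have [N hN] := goursat a 0 ab pi2 dG (mulr_gt0 e0 pi2).
  have := hN N (leqnn N); rewrite /rect_sum.
  (* The horizontal sides cancel by periodicity. The vertical ones are the two circle means: A at
     radius r, bounded by M, and D at the small radius, close to L. *)
  under [X in dyadic_sum _ X _ _ + _]eq_fun => x.
    rewrite add0r /G cexp_2pi subrr; over.
  rewrite dyadic_sum_cst mul0r add0r nrmCM nrm_i mul1r subrKC dyadic_sumB.
  set A := dyadic_sum _ _ _ _; set D := dyadic_sum _ _ _ _ => le.
  have Ale : nrm A <= M * (2 * pi).
    apply: dyadic_sum_le => [|y]; first exact: ltW.
    by rewrite add0r => /qM; rewrite /G /cexp /= lnK.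
  have Dle : nrm (D - L * (2 * pi)%:C%C : C^o) <= e * (2 * pi).
    rewrite -(dyadic_sum_cst N L 0) -dyadic_sumB.
    apply: dyadic_sum_le => [|y _]; first exact: ltW.
    apply: qd; first exact: cexp_neq0.
    rewrite nrm_cexp /= (@le_lt_trans _ _ (d / 2)) //; last first.
      by rewrite ltr_pdivrMr // ltr_pMr // ltr1n.
    rewrite -[leRHS]lnK ?posrE ?divr_gt0 // ler_expR /a ge_min lexx orbT //.
  rewrite -(ler_pM2r pi2).
  have -> : nrm L * (2 * pi) = nrm (L * (2 * pi)%:C%C : C^o).
    by rewrite nrmCM nrm_real gtr0_norm.
  have -> : L * (2 * pi)%:C%C = A - (A - D) - (D - L * (2 * pi)%:C%C) by ring.
  apply: le_trans (nrmD _ _) _; rewrite nrmN.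
  have := nrmD A (- (A - D)); rewrite nrmN.
  move: le Ale Dle; set n1 := nrm _; set n2 := nrm _; set n3 := nrm _.
  set n4 := nrm _; move=> *; lra.
apply: nrm_le_lim => e e0; have := key (e / 2) ltac:(by rewrite divr_gt0).
by rewrite mulrC divfK.
Qed.

Definition entire (f : C -> C^o) := forall z, vdiff f z.

Lemma entire_shift f (c : C) : entire f -> entire (fun z => f (z + c)).
Proof.
move=> df z; apply: (@vdiff_comp _ _ f (fun z => z + c : C^o)); last exact: df.
by apply: vdiffD; [exact: vdiff_id|exact: vdiff_cst].
Qed.

(** Cauchy's estimate: the difference quotient at z extends to h = 0 by the derivative and is at
    most 2 M / r on the circle of radius r, so all derivatives vanish. On the real line the real and
    imaginary parts then have derivative 0. *)
Lemma liouville (f : C -> C^o) (M : R) : entire f ->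
  (forall z, nrm (f z) <= M) -> forall s t : R, f s%:C%C = f t%:C%C.
Proof.
move=> df fM.
have M0 : 0 <= M by apply: le_trans (nrm_ge0 _) (fM 0).
have D0 z (L : C^o) : (forall e : R, 0 < e -> exists2 d : R, 0 < d &
      forall h : C^o, nrm h < d ->
      nrm (f (z + h) - f z - h *: L) <= e * nrm h) -> L = 0.
  move=> hL; apply: nrm0_eq0; apply/eqP; rewrite eq_le nrm_ge0 andbT.
  apply/ler_addgt0Pr => e e0; rewrite add0r.
  (* Makes 2 M <= e r; the summand 1 keeps r positive when M = 0. *)
  pose r := 2 * M / e + 1.
  have r0 : 0 < r by rewrite ltr_wpDl // divr_ge0 ?mulr_ge0 // ltW.
  have := @mean_value_bound (fun h => (f (h + z) - f z) / h : C^o) L r e r0.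
  apply.
  - move=> h h0; apply: vdiffM; last first.
      by apply: (@vdiffV _ (fun z => z : C^o)) => //; exact: vdiff_id.
    by apply: vdiffB; [exact: entire_shift|exact: vdiff_cst].
  - move=> e1 e10; have [d d0 hd] := hL _ e10; exists d => // h h0 /hd.
    rewrite [z + h]addrC => le.
    have hn : 0 < nrm h.
      rewrite lt_neqAle nrm_ge0 andbT eq_sym; apply/eqP => /nrm0_eq0/eqP.
      by rewrite (negPf h0).
    rewrite -(ler_pM2r hn) -nrmCM mulrBl divfK //.
    by move: le; rewrite [h *: L]mulrC.
  - move=> y _; set h : C^o := _ * cis y.
    have hr : nrm h = r by rewrite nrmCM nrm_real nrm_cis mulr1 gtr0_norm.
    rewrite nrmCM nrmCV hr ler_pdivrMr //.
    apply: le_trans (nrmD _ _) _; rewrite nrmN.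
    have h1 := fM (h + z); have h2 := fM z.
    have -> : e * r = 2 * M + e by rewrite /r; field; exact: lt0r_neq0.
    move: h1 h2; set n1 := nrm _; set n2 := nrm _; lra.
have der (v : C -> R) : (forall z w, v z - v w = v (z - w)) ->
    (forall z : C^o, `|v z| <= nrm z) ->
    forall x : R, is_derive x (1 : R) (fun x => v (f x%:C%C)) (0 : R).
  move=> vB vn x; have [L hL] := df x%:C%C; have L0 := D0 _ _ hL.
  apply: real_is_derive0 => e e0; have [d d0 hd] := hL _ e0; exists d => // h hh.
  rewrite vB (le_trans (vn _)) // rmorphD /=.
  by have := hd h%:C%C; rewrite nrm_real L0 scaler0 subr0 => ->.
have ReB (z w : C) : complex.Re z - complex.Re w = complex.Re (z - w).
  by case: z w => ? ? [].
have ImB (z w : C) : complex.Im z - complex.Im w = complex.Im (z - w).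
  by case: z w => ? ? [].
move=> s t; apply/eqP; rewrite eq_complex; apply/andP; split; apply/eqP.
  exact: is_derive_0_is_cst (der (@complex.Re R) ReB (@Re_le_nrm R)).
exact: is_derive_0_is_cst (der (@complex.Im R) ImB (@Im_le_nrm R)).
Qed.

Lemma vdiff_bounded_imag (V : normedModType C) (F : C -> V) (a b : R) : a <= b ->
  (forall z, vdiff F z) ->
  exists K : R, forall t, a <= t <= b -> nrm (F (Complex 0 t)) <= K.
Proof.
move=> ab dF; pose g (t : R) : R := nrm (F (Complex 0 t)).
have cg : {within `[a, b], continuous g}.
  apply: continuous_subspaceT => t; apply/cvgrPdist_le => e e0.
  have [K K0 [d d0 hd]] := vdiff_bound (dF (Complex 0 t)).
  apply/nbhs_ballP; exists (Num.min d (e / K)) => /=.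
    by rewrite lt_min d0 divr_gt0.
  move=> s; rewrite /ball /= lt_min => /andP[sd se].
  have := hd (Complex 0 (s - t)).
  have -> : Complex 0 t + Complex 0 (s - t) = Complex 0 s :> C.
    by apply/eqP; rewrite eq_complex /=; apply/andP; split; apply/eqP; ring.
  have n1 : nrm (Complex 0 (s - t) : C^o) <= `|t - s|.
    by rewrite (le_trans (nrm_Complex _ _)) // normr0 add0r distrC.
  move=> /(_ (le_lt_trans n1 sd)) le1.
  have le2 : nrm (F (Complex 0 s) - F (Complex 0 t)) <= e.
    rewrite (le_trans le1) // (le_trans (ler_wpM2l (ltW K0) n1)) //.
    by rewrite mulrC -ler_pdivlMr // ltW.
  rewrite /g ler_norml lerBrDl lerBlDl; apply/andP; split.
    have := nrmD (F (Complex 0 s) - F (Complex 0 t)) (F (Complex 0 t)).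
    by rewrite subrK; lra.
  have := nrmD (F (Complex 0 t) - F (Complex 0 s)) (F (Complex 0 s)).
  by rewrite subrK nrmB; lra.
have [c _ hc] := EVT_max ab cg.
by exists (g c) => t tab; apply: hc; rewrite in_itv.
Qed.

Lemma vdiff_local (V : normedModType C) (f g : C -> V) z (d : R) : 0 < d ->
  (forall h : C^o, nrm h < d -> f (z + h) = g (z + h)) ->
  vdiff g z -> vdiff f z.
Proof.
move=> d0 fg [L gL]; exists L => e e0; have [d1 d10 h1] := gL _ e0.
exists (Num.min d d1); first by rewrite lt_min d0.
move=> h; rewrite lt_min => /andP[hd hd1]; rewrite fg //.
have -> : f z = g z by have := fg 0; rewrite nrm0 addr0; exact.
exact: h1.
Qed.

(** The hypothesis bounds x (3/2)^n by K, while (3/2)^n grows at least linearly by Bernoulli's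
    inequality. *)
Lemma geometric_decay (x K : R) : 0 <= x ->
  (forall n, x / 2 ^+ n <= K / 3 ^+ n) -> x = 0.
Proof.
move=> x0 xK; apply/eqP; rewrite eq_le x0 andbT leNgt; apply/negP => xp.
have bern n : 1 + n%:R / 2 <= ((3 / 2) ^+ n : R).
  elim: n => [|n ih]; first by rewrite expr0 mul0r addr0.
  have n0 : (0 : R) <= n%:R by [].
  have h32 : (0 : R) <= 3 / 2 by lra.
  have := ler_wpM2l h32 ih; rewrite -exprS => le1; apply: le_trans le1.
  have -> : n.+1%:R = n%:R + 1 :> R by rewrite natr1.
  lra.
have xn n : x * n%:R / 2 <= K.
  have : x * (3 / 2) ^+ n <= K.
    rewrite expr_div_n mulrA ler_pdivrMr ?exprn_gt0 //.
    have := xK n; rewrite ler_pdivrMr ?exprn_gt0 // mulrAC.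
    by rewrite ler_pdivlMr ?exprn_gt0.
  apply: le_trans; rewrite -mulrA ler_wpM2l // (le_trans _ (bern n)) //.
  by rewrite lerDr.
have K0 : 0 <= K by have := xn 0%N; rewrite mulr0 mul0r.
have := archi_boundP (divr_ge0 (mulr_ge0 (ler0n R 2) K0) (ltW xp)).
rewrite ltr_pdivrMr //.
by have := xn (Num.bound (2 * K / x)); rewrite mulrC; lra.
Qed.

(* Cut [f] off above the real line and divide by [(z - i)^n]: the part of the
   circle of radius 3 about -i where the cut-off survives is at distance >= 3
   from i, while -i is at distance 2, so |f(-i)| <= K (2/3)^n. *)
Lemma entire_zero_Ni (f : C -> C^o) : entire f ->
  (forall t : R, f t%:C%C = 0) -> f (Complex 0 (-1)) = 0.
Proof.
move=> df f0.
pose ci : C := Complex 0 1; pose z0 : C := Complex 0 (-1).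
pose m n (z : C) : C^o :=
  if 0 <= complex.Im z then 0 else f z * ((z - ci) ^+ n)^-1.
(* In the closed lower half plane the divisor has modulus at least 1, so it has no zero there and
   dividing by it does not enlarge f. *)
have far (z : C) : complex.Im z <= 0 -> 1 <= nrm (z - ci : C^o).
  move=> z1; apply: le_trans (Im_le_nrm _); case: z z1 => u v /= v0.
  by rewrite ler0_norm; lra.
have far_neq0 (z : C) : complex.Im z <= 0 -> z - ci != 0.
  move=> /far; apply: contraTneq => ->; rewrite nrm0 -ltNge; exact: ltr01.
have dm n z : vdiff (m n) z.
  have [zp|zn|z0'] := ltgtP (complex.Im z) 0.
  - apply: (@vdiff_local _ _ (fun z => f z * ((z - ci) ^+ n)^-1 : C^o) z
      (- complex.Im z)); first by rewrite oppr_gt0.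
      move=> h hh; rewrite /m ifF //; apply/negbTE; rewrite -ltNge.
      rewrite raddfD /=; have := Im_le_nrm h; rewrite ler_norml; lra.
    apply: vdiffM => //; apply: (@vdiffV _ (fun z => (z - ci) ^+ n : C^o)).
      by rewrite expf_neq0 // far_neq0 // ltW.
    apply: (@vdiffX _ (fun z => z - ci : C^o)); apply: vdiffB.
      exact: vdiff_id.
    exact: vdiff_cst.
  - apply: (@vdiff_local _ _ (fun=> 0) z (complex.Im z)) => //.
      move=> h hh; rewrite /m ifT // raddfD /=.
      by have := Im_le_nrm h; rewrite ler_norml; lra.
    exact: vdiff_cst.
  have zr : z = (complex.Re z)%:C%C.
    by apply/eqP; rewrite eq_complex /= z0' !eqxx.
  have [L hL] := df z.
  (* At a real point f vanishes along the real direction, so its derivative is 0 and the two pieces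
     of [m n] glue differentiably. *)
  have L0 : L = 0.
    apply: nrm0_eq0; apply/eqP; rewrite eq_le nrm_ge0 andbT.
    apply/ler_addgt0Pr => e e0; rewrite add0r; have [d d0 hd] := hL _ e0.
    have d20 : 0 < d / 2 by rewrite divr_gt0.
    have := hd (d / 2)%:C%C; rewrite zr -rmorphD !f0 subrr sub0r nrmN nrmZ.
    rewrite nrm_real (gtr0_norm d20) => le1.
    rewrite -(ler_pM2r d20) [leLHS]mulrC le1 //.
    by rewrite ltr_pdivrMr // ltr_pMr // ltr1n.
  exists 0 => e e0; have [d d0 hd] := hL _ e0; exists d => // h /hd.
  rewrite L0 scaler0 !subr0 {2}zr f0 subr0 {2}/m z0' lexx subr0 => le1.
  rewrite /m; case: ifPn => [_|]; first by rewrite nrm0 mulr_ge0 ?nrm_ge0 // ltW.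
  rewrite -ltNge => im0; apply: le_trans le1.
  rewrite nrmCM ler_piMr ?nrm_ge0 // nrmCV nrmCX invf_le1.
    by rewrite exprn_ege1 // far // ltW.
  by rewrite exprn_gt0 // (lt_le_trans ltr01) // far // ltW.
have [K hK] : exists K : R, forall y, 0 <= y <= 2 * pi ->
    nrm (f ((3 : R)%:C%C * cis y + z0)) <= K.
  pose F (w : C) := f ((3 : R)%:C%C * cexp w + z0).
  have dF w : vdiff F w.
    apply: (@vdiff_comp _ _ f (fun w => (3 : R)%:C%C * cexp w + z0 : C^o)) => //.
    apply: vdiffD; last exact: vdiff_cst.
    by apply: vdiffM; [exact: vdiff_cst|exact: vdiff_cexp].
  have pi0 : 0 <= 2 * pi :> R by rewrite mulr_ge0 // pi_ge0.
  have [K hK] := vdiff_bounded_imag pi0 dF.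
  by exists K => y /hK; rewrite /F cexp_imag.
apply: nrm0_eq0; apply: (@geometric_decay _ K); first exact: nrm_ge0.
move=> n.
have := @mean_value_bound (fun w => m n (w + z0)) (m n z0) 3 (K / 3 ^+ n).
have -> : nrm (m n z0) = nrm (f z0) / 2 ^+ n.
  have imz0 : (0 <= complex.Im z0) = false.
    by apply/negbTE; rewrite -ltNge /=; lra.
  rewrite /m imz0 nrmCM nrmCV nrmCX; congr (_ / _ ^+ _).
  rewrite /nrm normc_def /= subr0 expr0n add0r -opprD sqrrN sqrtr_sqr.
  by rewrite ger0_norm.
apply => //.
- by move=> z _; exact: (entire_shift z0 (dm n)).
- move=> e e0; have [K' K'0 [d d0 hd]] := vdiff_bound (dm n z0).
  exists (Num.min d (e / K')); first by rewrite lt_min d0 divr_gt0.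
  move=> z _; rewrite lt_min => /andP[/hd le1 le2].
  rewrite [z + z0]addrC (le_trans le1) // mulrC -ler_pdivlMr //; exact: ltW.
move=> y /hK le1; rewrite /m; set z := _ + z0 in le1 *.
have K0 : 0 <= K := le_trans (nrm_ge0 _) le1.
case: ifPn => [_|]; first by rewrite nrm0 divr_ge0 // exprn_ge0.
rewrite -ltNge => im0; rewrite nrmCM ler_pM ?nrm_ge0 //.
rewrite nrmCV nrmCX lef_pV2 ?posrE ?exprn_gt0 //; last first.
  by rewrite (lt_le_trans ltr01) // far // ltW.
apply: lerXn2r; rewrite ?nnegrE ?nrm_ge0 //.
(* On the circle |z - i|^2 = 13 - 12 sin y, and Im z < 0 means sin y < 1/3. *)
rewrite -(@ler_pXn2r _ 2) ?nnegrE ?nrm_ge0 // sqr_nrm.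
move: im0; rewrite /z /= !subr0 !mul0r !subr0 !addr0 => im0.
have := cos2Dsin2 y; set c := cos y; set s := sin y in im0 *; nra.
Qed.

(** An affine change of variable with real coefficients preserves the real line and can send -i to
    any given z. *)
Lemma entire_zero (f : C -> C^o) : entire f ->
  (forall t : R, f t%:C%C = 0) -> forall z, f z = 0.
Proof.
move=> df f0 z.
have := @entire_zero_Ni
  (fun w => f ((- complex.Im z)%:C%C * w + (complex.Re z)%:C%C)).
have -> : (- complex.Im z)%:C%C * Complex 0 (-1) + (complex.Re z)%:C%C = z.
  by apply/eqP; rewrite eq_complex /=; apply/andP; split; apply/eqP; ring.
apply => [w|t]; last by rewrite -rmorphM -rmorphD f0.
apply: (@vdiff_comp _ _ f
  (fun w => (- complex.Im z)%:C%C * w + (complex.Re z)%:C%C : C^o)); last exact: df.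
apply: vdiffD; last exact: vdiff_cst.
by apply: vdiffM; [exact: vdiff_cst|exact: vdiff_id].
Qed.

End ComplexExp.

(** * Operator norm of matrices *)

Section MatrixNorm.
Variable R : realType.
Local Notation C := R[i].

Lemma ctM m n p (A : 'M[C]_(m, n)) (B : 'M[C]_(n, p)) :
  (A *m B)^t* = B^t* *m A^t*.
Proof. by rewrite trmx_mul map_mxM. Qed.

Lemma ctD m n (A B : 'M[C]_(m, n)) : (A + B)^t* = A^t* + B^t*.
Proof. by rewrite linearD /= map_mxD. Qed.

Lemma ctB m n (A B : 'M[C]_(m, n)) : (A - B)^t* = A^t* - B^t*.
Proof. by rewrite linearB /= map_mxB. Qed.

Lemma ctZ m n c (A : 'M[C]_(m, n)) : (c *: A)^t* = c^* *: A^t*.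
Proof. by rewrite linearZ /= map_mxZ. Qed.

Lemma ct1 n : (1%:M : 'M[C]_n)^t* = 1%:M.
Proof. by rewrite trmx1 map_mx1. Qed.

Lemma ct0 m n : (0 : 'M[C]_(m, n))^t* = 0.
Proof. by rewrite trmx0 map_mx0. Qed.

Lemma ct_mxE m n (A : 'M[C]_(m, n)) i j : A^t* i j = (A j i)^*.
Proof. by rewrite !mxE. Qed.

Lemma nrm_conj (z : C) : nrm (z^* : C^o) = nrm (z : C^o).
Proof. by rewrite /nrm norm_conjC. Qed.

Lemma conjC_nrm (z : C) : z^* * z = (nrm (z : C^o) ^+ 2)%:C%C.
Proof. by rewrite mulrC -normCK nrmE rmorphXn. Qed.

Lemma l2normE n (v : 'cV[C]_n) :
  l2norm v ^+ 2 = \sum_i nrm (v i 0 : C^o) ^+ 2.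
Proof. by rewrite sqr_sqrtr // sumr_ge0 // => i _; exact: sqr_ge0. Qed.

Lemma l2norm_ge0 n (v : 'cV[C]_n) : 0 <= l2norm v.
Proof. exact: sqrtr_ge0. Qed.

Lemma l2norm_sq n (v : 'cV[C]_n) : (v^t* *m v) 0 0 = (l2norm v ^+ 2)%:C%C.
Proof.
rewrite l2normE rmorph_sum mxE; apply: eq_bigr => i _.
by rewrite ct_mxE conjC_nrm.
Qed.

Lemma l2norm_le n (v : 'cV[C]_n) (c : R) : 0 <= c ->
  l2norm v ^+ 2 <= c ^+ 2 -> l2norm v <= c.
Proof.
by move=> c0; rewrite ler_sqr ?nnegrE ?l2norm_ge0.
Qed.

Lemma l2norm_eq0 n (v : 'cV[C]_n) : l2norm v = 0 -> v = 0.
Proof.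
move=> v0; have := l2normE v; rewrite v0 expr0n => /esym/eqP.
rewrite psumr_eq0 => [/allP v0'|i _]; last exact: sqr_ge0.
apply/colP => i; rewrite mxE; apply: (@nrm0_eq0 _ (C^o)).
by have := v0' i (mem_index_enum _); rewrite sqrf_eq0 => /eqP.
Qed.

Lemma l2norm0 n : l2norm (0 : 'cV[C]_n) = 0.
Proof.
apply/eqP; rewrite -sqrf_eq0 l2normE big1 // => i _.
by rewrite mxE nrm0 expr0n.
Qed.

Lemma l2normZ n c (v : 'cV[C]_n) : l2norm (c *: v) = nrm (c : C^o) * l2norm v.
Proof.
apply/eqP; rewrite -(@eqrXn2 _ 2) ?mulr_ge0 ?l2norm_ge0 ?nrm_ge0 //.
rewrite exprMn !l2normE mulr_sumr; apply/eqP; apply: eq_bigr => i _.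
by rewrite mxE nrmCM exprMn.
Qed.

Lemma real_cauchy_schwarz (I : finType) (a b : I -> R) :
  (\sum_i a i * b i) ^+ 2 <= (\sum_i a i ^+ 2) * (\sum_i b i ^+ 2).
Proof.
set S := \sum_i _ * _; set A := \sum_i a i ^+ 2; set B := \sum_i b i ^+ 2.
have B0 : 0 <= B by apply: sumr_ge0 => i _; exact: sqr_ge0.
have [Bz|Bz] := eqVneq B 0.
  have b0 i : b i = 0.
    move/eqP: Bz; rewrite psumr_eq0 => [/allP/(_ i (mem_index_enum _))|j _].
      by rewrite sqrf_eq0 => /eqP.
    exact: sqr_ge0.
  rewrite Bz mulr0 /S big1 ?expr0n // => i _; by rewrite b0 mulr0.
have Bp : 0 < B by rewrite lt_neqAle eq_sym Bz.
have : 0 <= \sum_i (B * a i - S * b i) ^+ 2.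
  by apply: sumr_ge0 => i _; exact: sqr_ge0.
have -> : \sum_i (B * a i - S * b i) ^+ 2 =
    B ^+ 2 * A - 2 * B * S * S + S ^+ 2 * B.
  transitivity (\sum_i (B ^+ 2 * a i ^+ 2 - 2 * B * S * (a i * b i) +
      S ^+ 2 * b i ^+ 2)); first by apply: eq_bigr => i _; ring.
  by rewrite big_split sumrB /= -!mulr_sumr.
have -> : B ^+ 2 * A - 2 * B * S * S + S ^+ 2 * B = B * (A * B - S ^+ 2) by ring.
by rewrite pmulr_rge0 // subr_ge0.
Qed.

Lemma dot_cauchy_schwarz n (u v : 'cV[C]_n) :
  nrm ((u^t* *m v) 0 0 : C^o) <= l2norm u * l2norm v.
Proof.
rewrite -ler_sqr ?nnegrE ?mulr_ge0 ?l2norm_ge0 ?nrm_ge0 // exprMn !l2normE.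
apply: le_trans (real_cauchy_schwarz _ _).
rewrite ler_sqr ?nnegrE ?nrm_ge0 ?sumr_ge0 // => [|i _]; last first.
  by rewrite mulr_ge0 ?nrm_ge0.
rewrite mxE; apply: le_trans (nrm_sum _ _ _) _; apply: ler_sum => i _.
by rewrite nrmCM ct_mxE nrm_conj.
Qed.

Lemma mx11D (A B : 'M[C]_1) : (A + B) 0 0 = A 0 0 + B 0 0.
Proof. by rewrite mxE. Qed.

Lemma mx11B (A B : 'M[C]_1) : (A - B) 0 0 = A 0 0 - B 0 0.
Proof. by rewrite !mxE. Qed.

Lemma l2normD n (u v : 'cV[C]_n) : l2norm (u + v) <= l2norm u + l2norm v.
Proof.
apply: l2norm_le; first by rewrite addr_ge0 ?l2norm_ge0.
have e : ((l2norm (u + v) ^+ 2)%:C)%C = (l2norm u ^+ 2 + l2norm v ^+ 2)%:C%C +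
    ((u^t* *m v) 0 0 + (v^t* *m u) 0 0).
  rewrite rmorphD /= -!l2norm_sq ctD mulmxDl !mulmxDr !mx11D; ring.
have : nrm ((l2norm (u + v) ^+ 2)%:C%C : C^o) <= (l2norm u + l2norm v) ^+ 2.
  rewrite e (le_trans (nrmD _ _)) // nrm_real ger0_norm; last first.
    by rewrite addr_ge0 ?sqr_ge0.
  have := nrmD ((u^t* *m v) 0 0 : C^o) ((v^t* *m u) 0 0 : C^o).
  have := dot_cauchy_schwarz u v; have := dot_cauchy_schwarz v u.
  set n1 := nrm _; set n2 := nrm _; set n3 := nrm _; set x := l2norm u.
  set y := l2norm v; move=> *; have -> : (x + y) ^+ 2 = x ^+ 2 + y ^+ 2 +
    (x * y + y * x) by ring.
  lra.
by rewrite nrm_real ger0_norm ?sqr_ge0.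
Qed.

Lemma l2norm_isometry m n (T : 'M[C]_(m, n)) (v : 'cV_n) :
  isometry_mx T -> l2norm (T *m v) = l2norm v.
Proof.
move=> iT; apply/eqP; rewrite -(@eqrXn2 _ 2) ?l2norm_ge0 //.
by apply/eqP/complexI; rewrite -!l2norm_sq ctM mulmxA -(mulmxA (v^t*)) iT mulmx1.
Qed.

(** The Hilbert-Schmidt norm is a bound, by Cauchy-Schwarz in each row. *)
Lemma opnorm_set_bound n (M : 'M[C]_n) :
  has_ubound [set l2norm (M *m v) | v in [set v | l2norm v <= 1]].
Proof.
pose K := \sum_i \sum_j nrm (M i j : C^o) ^+ 2.
have K0 : 0 <= K.
  by apply: sumr_ge0 => i _; apply: sumr_ge0 => j _; exact: sqr_ge0.
exists (Num.sqrt K) => _ [v v1 <-]; apply: l2norm_le; first exact: sqrtr_ge0.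
rewrite [leRHS]sqr_sqrtr // l2normE; apply: ler_sum => i _.
have -> : (M *m v) i 0 = (((row i M)^t*)^t* *m v) 0 0.
  by rewrite trmxCK -row_mul [RHS]mxE.
apply: le_trans (_ : (l2norm ((row i M)^t*) * l2norm v) ^+ 2 <= _).
  rewrite ler_sqr ?nnegrE ?nrm_ge0 ?mulr_ge0 ?l2norm_ge0 //.
  exact: dot_cauchy_schwarz.
have -> : \sum_j nrm (M i j : C^o) ^+ 2 = l2norm ((row i M)^t*) ^+ 2.
  by rewrite l2normE; apply: eq_bigr => j _; rewrite ct_mxE mxE nrm_conj.
by rewrite exprMn ler_piMr ?sqr_ge0 // expr_le1 ?l2norm_ge0.
Qed.

Lemma opnorm_has_sup n (M : 'M[C]_n) :
  has_sup [set l2norm (M *m v) | v in [set v | l2norm v <= 1]].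
Proof.
split; last exact: opnorm_set_bound.
by exists (l2norm (M *m 0)), 0 => //=; rewrite l2norm0.
Qed.

Lemma opnorm_ge0 n (M : 'M[C]_n) : 0 <= opnorm M.
Proof.
apply: (@le_trans _ _ (l2norm (M *m 0))); first exact: l2norm_ge0.
apply: sup_upper_bound; first exact: opnorm_has_sup.
by exists 0 => //=; rewrite l2norm0.
Qed.

Lemma opnormP n (M : 'M[C]_n) v : l2norm (M *m v) <= opnorm M * l2norm v.
Proof.
have [v0|v0] := eqVneq (l2norm v) 0.
  by rewrite (l2norm_eq0 v0) mulmx0 l2norm0 mulr_ge0 ?opnorm_ge0 ?l2norm_ge0.
have vp : 0 < l2norm v by rewrite lt_neqAle eq_sym v0 l2norm_ge0.
have e1 : nrm ((l2norm v)^-1%:C%C : C^o) = (l2norm v)^-1.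
  by rewrite nrm_real gtr0_norm ?invr_gt0.
have : l2norm (M *m ((l2norm v)^-1%:C%C *: v)) <= opnorm M.
  apply: sup_upper_bound; first exact: opnorm_has_sup.
  by eexists; last reflexivity; rewrite /= l2normZ e1 mulVf.
by rewrite -scalemxAr l2normZ e1 mulrC ler_pdivrMr.
Qed.

Lemma opnorm_le n (M : 'M[C]_n) c : 0 <= c ->
  (forall v, l2norm (M *m v) <= c * l2norm v) -> opnorm M <= c.
Proof.
move=> c0 hM; apply: ge_sup; first by case: (opnorm_has_sup M).
by move=> _ [v /= v1 <-]; apply: le_trans (hM v) _; rewrite ler_piMr.
Qed.

Lemma opnorm0 n : opnorm (0 : 'M[C]_n) = 0.
Proof.
apply/eqP; rewrite eq_le opnorm_ge0 andbT; apply: opnorm_le => // v.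
by rewrite mul0mx l2norm0 mul0r.
Qed.

Lemma nrm_entry_le n (M : 'M[C]_n) i j : nrm (M i j : C^o) <= opnorm M.
Proof.
pose d k : 'cV[C]_n := delta_mx k 0.
have d1 k : l2norm (d k) = 1.
  apply/eqP; rewrite -(@eqrXn2 _ 2) ?l2norm_ge0 // l2normE (bigD1 k) //=.
  rewrite mxE !eqxx /= (nrm_real 1) normr1 big1 ?addr0 // => l lk.
  by rewrite mxE (negPf lk) nrm0 expr0n.
have -> : M i j = ((d i)^t* *m (M *m d j)) 0 0.
  rewrite -colE mxE (bigD1 i) //= !mxE !eqxx /= rmorph1 mul1r big1 ?addr0 //.
  by move=> k ki; rewrite !mxE (negPf ki) rmorph0 mul0r.
apply: le_trans (dot_cauchy_schwarz _ _) _; rewrite d1 mul1r.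
by apply: le_trans (opnormP _ _) _; rewrite d1 mulr1.
Qed.

Lemma opnorm_eq0 n (M : 'M[C]_n) : opnorm M <= 0 -> M = 0.
Proof.
move=> M0; apply/matrixP => i j; rewrite mxE; apply: (@nrm0_eq0 _ (C^o)).
by apply/eqP; rewrite eq_le nrm_ge0 andbT (le_trans (nrm_entry_le _ _ _)).
Qed.

Lemma opnormD n (M N : 'M[C]_n) : opnorm (M + N) <= opnorm M + opnorm N.
Proof.
apply: opnorm_le => [|v]; first by rewrite addr_ge0 ?opnorm_ge0.
by rewrite mulmxDl mulrDl (le_trans (l2normD _ _)) // lerD // opnormP.
Qed.

Lemma opnormZ n c (M : 'M[C]_n) : opnorm (c *: M) <= nrm (c : C^o) * opnorm M.
Proof.
apply: opnorm_le => [|v]; first by rewrite mulr_ge0 ?opnorm_ge0 ?nrm_ge0.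
by rewrite -scalemxAl l2normZ -mulrA ler_wpM2l ?nrm_ge0 // opnormP.
Qed.

Lemma opnormM n (M N : 'M[C]_n) : opnorm (M *m N) <= opnorm M * opnorm N.
Proof.
apply: opnorm_le => [|v]; first by rewrite mulr_ge0 ?opnorm_ge0.
rewrite -mulmxA -mulrA (le_trans (opnormP _ _)) // ler_wpM2l ?opnorm_ge0 //.
exact: opnormP.
Qed.

Lemma opnorm_adj n (M : 'M[C]_n) : opnorm (M^t*) <= opnorm M.
Proof.
apply: opnorm_le => [|v]; first exact: opnorm_ge0.
have [->|w0] := eqVneq (l2norm (M^t* *m v)) 0.
  by rewrite mulr_ge0 ?opnorm_ge0 ?l2norm_ge0.
have wp : 0 < l2norm (M^t* *m v) by rewrite lt_neqAle eq_sym w0 l2norm_ge0.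
rewrite -(ler_pM2r wp) -expr2 -lecR -l2norm_sq.
rewrite ctM trmxCK -mulmxA.
have /ger0_norm <- : 0 <= (v^t* *m (M *m (M^t* *m v))) 0 0.
  have -> : v^t* *m (M *m (M^t* *m v)) = (M^t* *m v)^t* *m (M^t* *m v).
    by rewrite ctM trmxCK !mulmxA.
  by rewrite l2norm_sq ler0c sqr_ge0.
rewrite (@nrmE _ (C^o)) lecR (le_trans (dot_cauchy_schwarz _ _)) //.
by rewrite mulrAC mulrC ler_wpM2r ?l2norm_ge0 // opnormP.
Qed.

Lemma opnorm_isometry n (T : 'M[C]_n) : isometry_mx T -> opnorm T <= 1.
Proof.
by move=> iT; apply: opnorm_le => // v; rewrite l2norm_isometry // mul1r.
Qed.

Lemma opnorm1 n : opnorm (1%:M : 'M[C]_n) <= 1.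
Proof. by apply: opnorm_isometry; rewrite /isometry_mx ct1 mulmx1. Qed.

(** For self-adjoint X and Z one has |Xv|^2 + |Zv|^2 = |v|^2 - <v, Ev>. This is the matrix estimate
    behind the contractivity of star homomorphisms of B. *)
Lemma opnorm_of_sum_squares n (X Z : 'M[C]_n) e : 0 <= e ->
  X^t* = X -> Z^t* = Z -> opnorm (1%:M - X *m X - Z *m Z) <= e ->
  opnorm X ^+ 2 <= 1 + e.
Proof.
move=> e0 hX hZ hE; set E := _ - _ in hE.
have e1 : 0 <= 1 + e by rewrite addr_ge0.
have : opnorm X <= Num.sqrt (1 + e).
  apply: opnorm_le => [|v]; first exact: sqrtr_ge0.
  rewrite -ler_sqr ?nnegrE ?mulr_ge0 ?sqrtr_ge0 ?l2norm_ge0 //.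
  rewrite exprMn (sqr_sqrtr e1).
  have eq : ((l2norm (X *m v) ^+ 2 + l2norm (Z *m v) ^+ 2)%:C)%C =
      (l2norm v ^+ 2)%:C%C - (v^t* *m (E *m v)) 0 0.
    rewrite rmorphD /= -!l2norm_sq !ctM hX hZ.
    have -> : v^t* *m (E *m v) = v^t* *m v - v^t* *m X *m (X *m v) -
        v^t* *m Z *m (Z *m v).
      by rewrite /E !mulmxBl mul1mx !mulmxBr !mulmxA.
    by rewrite !mx11B; ring.
  have : nrm ((l2norm v ^+ 2)%:C%C - (v^t* *m (E *m v)) 0 0 : C^o) <=
      (1 + e) * l2norm v ^+ 2.
    rewrite (le_trans (nrmD _ _)) // nrmN nrm_real ger0_norm ?sqr_ge0 //.
    rewrite mulrDl mul1r lerD2l (le_trans (dot_cauchy_schwarz _ _)) //.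
    rewrite expr2 mulrA [leRHS]mulrC ler_wpM2l ?l2norm_ge0 //.
    by rewrite (le_trans (opnormP _ _)) // ler_wpM2r ?l2norm_ge0.
  rewrite -eq nrm_real ger0_norm ?addr_ge0 ?sqr_ge0 //.
  by apply: le_trans; rewrite lerDl sqr_ge0.
by rewrite -ler_sqr ?nnegrE ?opnorm_ge0 ?sqrtr_ge0 // sqr_sqrtr.
Qed.

End MatrixNorm.

(** * Families of matrices and the states chi_pi *)

Section DualFamilies.
Variable R : realType.
Local Notation C := R[i].

(** Positivity makes the quadratic form real; polarization with u + v and u + i v then gives
    hermitian symmetry. *)
Lemma positive_mx_hermitian n (F : 'M[C]_n) : positive_mx F -> F^t* = F.
Proof.
move=> posF; pose b (u v : 'cV[C]_n) : C := (u^t* *m F *m v) 0 0.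
have bD u v w : b (u + v) w = b u w + b v w.
  by rewrite /b ctD !mulmxDl mx11D.
have bDr u v w : b w (u + v) = b w u + b w v by rewrite /b mulmxDr mx11D.
have bZ c u v : b u (c *: v) = c * b u v by rewrite /b -scalemxAr mxE.
have bZl c u v : b (c *: u) v = c^* * b u v.
  by rewrite /b ctZ -!scalemxAl mxE.
have q0 v : complex.Im (b v v) = 0.
  have := posF v; rewrite -/(b v v) => /ger0_Im; exact.
have sym u v : b v u = (b u v)^*.
  have h1 := q0 (u + v); have h2 := q0 (u + Complex 0 1 *: v).
  move: h1 h2; rewrite !(bD, bDr, bZ, bZl).
  have := q0 u; have := q0 v; case: (b u u) (b v v) (b u v) (b v u).
  move=> a1 a2 [c1 c2] [d1 d2] [e1 e2] /=; rewrite !mul0r !mul1r => *.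
  by apply/eqP; rewrite eq_complex /=; apply/andP; split; apply/eqP; lra.
have bE i j : b (delta_mx i 0) (delta_mx j 0) = F i j.
  rewrite /b -colE mxE mxE (bigD1 i) //= !mxE !eqxx /= rmorph1 mul1r.
  by rewrite big1 ?addr0 // => k ki; rewrite !mxE (negPf ki) rmorph0 mul0r.
apply/matrixP => i j; rewrite ct_mxE -(bE j i) -(bE i j).
by rewrite (sym (delta_mx i 0) (delta_mx j 0)) conjCK.
Qed.

Variable G : ucqg R.
Implicit Types (x y : dualU G) (pi rho : irr G).

Definition specV pi : 'M[C]_(irr_dim pi) := spectralmx (irr_F pi).
Definition specl pi (i : 'I_(irr_dim pi)) : R :=
  complex.Re (spectral_diag (irr_F pi) 0 i).

Lemma specVV pi : specV pi *m (specV pi)^t* = 1%:M.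
Proof. exact/unitarymxP/spectral_unitarymx. Qed.

Lemma specVK pi : (specV pi)^t* *m specV pi = 1%:M.
Proof. exact/mulmx1C/specVV. Qed.

Lemma invmx_specV pi : invmx (specV pi) = (specV pi)^t*.
Proof. exact/invmx_unitary/spectral_unitarymx. Qed.

(** Passage from coordinates in an eigenbasis of [irr_F pi] back to the given ones. It is an
    automorphism for product and adjoint and preserves the trace. *)
Definition sconj pi (A : 'M[C]_(irr_dim pi)) : 'M[C]_(irr_dim pi) :=
  (specV pi)^t* *m A *m specV pi.

Lemma sconjM pi (A B : 'M[C]_(irr_dim pi)) :
  sconj A *m sconj B = sconj (A *m B).
Proof.
rewrite /sconj -!mulmxA; congr (_ *m (_ *m _)).
by rewrite !mulmxA specVV mul1mx.
Qed.

Lemma sconjK pi (z : 'M[C]_(irr_dim pi)) :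
  sconj (specV pi *m z *m (specV pi)^t*) = z.
Proof. by rewrite /sconj !mulmxA specVK mul1mx -mulmxA specVK mulmx1. Qed.

Lemma sconjVK pi (A : 'M[C]_(irr_dim pi)) :
  specV pi *m sconj A *m (specV pi)^t* = A.
Proof. by rewrite /sconj !mulmxA specVV mul1mx -mulmxA specVV mulmx1. Qed.

Lemma sconj_inj pi : injective (@sconj pi).
Proof. by move=> A B AB; rewrite -[A]sconjVK AB sconjVK. Qed.

Lemma sconjZ pi c (A : 'M[C]_(irr_dim pi)) : sconj (c *: A) = c *: sconj A.
Proof. by rewrite /sconj -scalemxAr -scalemxAl. Qed.

Lemma sconj1 pi : sconj (1%:M : 'M[C]_(irr_dim pi)) = 1%:M.
Proof. by rewrite /sconj mulmx1 specVK. Qed.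

Lemma sconj_ct pi (A : 'M[C]_(irr_dim pi)) : (sconj A)^t* = sconj (A^t*).
Proof. by rewrite /sconj !ctM trmxCK mulmxA. Qed.

Lemma tr_sconj pi (A : 'M[C]_(irr_dim pi)) : \tr (sconj A) = \tr A.
Proof. by rewrite /sconj mxtrace_mulC mulmxA specVV mul1mx. Qed.

Lemma irr_F_spec0 pi : irr_F pi = sconj (diag_mx (spectral_diag (irr_F pi))).
Proof.
rewrite /sconj -invmx_specV; apply/orthomx_spectralP/normalmxP.
by have [/positive_mx_hermitian -> _ _ _] := irr_FP pi.
Qed.

(** An eigenvalue is the value of the positive form at a unit eigenvector, and 0 would contradict
    invertibility. *)
Lemma spectral_diagE pi i :
  spectral_diag (irr_F pi) 0 i = (specl i)%:C%C /\ 0 < specl i.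
Proof.
set d := spectral_diag _.
have e1 : specV pi *m irr_F pi *m (specV pi)^t* = diag_mx d.
  by rewrite {1}irr_F_spec0 sconjVK.
have [posF unitF _ _] := irr_FP pi.
have d0 : 0 <= d 0 i.
  have := posF ((specV pi)^t* *m delta_mx i 0); rewrite ctM trmxCK.
  rewrite -!mulmxA (mulmxA (irr_F pi)) (mulmxA (specV pi)) (mulmxA (specV pi)).
  rewrite e1 -colE mxE (bigD1 i) //= !mxE !eqxx /= rmorph1 mul1r mulr1n.
  rewrite big1 ?addr0 // => k ki.
  by rewrite !mxE (negPf ki) /= rmorph0 mul0r.
have dE : d 0 i = (specl i)%:C%C by rewrite RRe_real // ger0_real.
split=> //; rewrite lt_neqAle -ler0c -dE d0 andbT eq_sym.
apply: contraTneq unitF => l0.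
rewrite unitmxE irr_F_spec0 /sconj !det_mulmx det_diag (bigD1 i) //= -/d dE l0.
by rewrite mul0r mulr0 mul0r unitr0.
Qed.

Lemma specl_gt0 pi (i : 'I_(irr_dim pi)) : 0 < specl i.
Proof. by have [] := spectral_diagE i. Qed.

Lemma irr_F_spec pi : irr_F pi = sconj (diag_mx (\row_i (specl i)%:C%C)).
Proof.
rewrite {1}irr_F_spec0; congr (sconj (diag_mx _)).
by apply/rowP => i; rewrite mxE; have [] := spectral_diagE i.
Qed.

Lemma imag_powE pi t : imag_pow (irr_F pi) t =
  sconj (diag_mx (\row_i cis (t * ln (specl i)))).
Proof.
rewrite /imag_pow -/(specV pi) invmx_specV; congr (_ *m diag_mx _ *m _).
by apply/rowP => i; rewrite !mxE.
Qed.

Definition munit pi (i j : 'I_(irr_dim pi)) : 'M[C]_(irr_dim pi) :=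
  sconj (delta_mx i j).

(** The flow multiplies [munit i j] by (specl i / specl j)^(it), so this is its frequency. *)
Definition freq pi (i j : 'I_(irr_dim pi)) : R := ln (specl i) - ln (specl j).

Lemma expR_freq pi (i j : 'I_(irr_dim pi)) :
  expR (freq i j) = specl i / specl j.
Proof. by rewrite expRB !lnK // posrE specl_gt0. Qed.

Lemma munitM pi (i j k l : 'I_(irr_dim pi)) :
  munit i j *m munit k l = if j == k then munit i l else 0.
Proof.
rewrite /munit sconjM mul_delta_mx_cond mulrb; case: eqP => // _.
by rewrite /sconj mulmx0 mul0mx.
Qed.

Lemma munit_decomp pi (z : 'M[C]_(irr_dim pi)) :
  z = \sum_i \sum_j (specV pi *m z *m (specV pi)^t*) i j *: munit i j.
Proof.
rewrite -{1}[z]sconjK /sconj {1}[X in _ *m X *m _]matrix_sum_delta.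
rewrite mulmx_sumr mulmx_suml; apply: eq_bigr => i _.
rewrite mulmx_sumr mulmx_suml; apply: eq_bigr => j _.
by rewrite -scalemxAr -scalemxAl.
Qed.

Definition qdim pi : R := \sum_i @specl pi i.

Lemma irr_dim_gt0 pi : (0 < irr_dim pi)%N.
Proof. by have [_ []] := irr_repP pi. Qed.

Lemma qdim_gt0 pi : 0 < qdim pi.
Proof.
rewrite /qdim (bigD1 (Ordinal (irr_dim_gt0 pi))) //= ltr_pwDl ?specl_gt0 //.
by apply: sumr_ge0 => i _; rewrite ltW // specl_gt0.
Qed.

Lemma tr_irr_F pi (z : 'M[C]_(irr_dim pi)) : \tr (irr_F pi *m z) =
  \sum_i (specl i)%:C%C * (specV pi *m z *m (specV pi)^t*) i i.
Proof.
rewrite irr_F_spec -{1}[z]sconjK sconjM tr_sconj; apply: eq_bigr => i _.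
by rewrite mul_diag_mx !mxE.
Qed.

Lemma dim_qE pi : dim_q pi = (qdim pi)%:C%C.
Proof.
rewrite /dim_q -[irr_F pi]mulmx1 tr_irr_F mulmx1 rmorph_sum /=.
by apply: eq_bigr => i _; rewrite specVV mxE eqxx mulr1.
Qed.

Lemma dim_q_neq0 pi : dim_q pi != 0.
Proof. by rewrite dim_qE eq_complex /= negb_and gt_eqF // qdim_gt0. Qed.

(** A convex combination of diagonal entries in the eigenbasis, from which positivity and the norm
    bound are read off. *)
Lemma chi_irrE pi x : chi_irr pi x = \sum_i (specl i / qdim pi)%:C%C *
  (specV pi *m x pi *m (specV pi)^t*) i i.
Proof.
rewrite /chi_irr dim_qE tr_irr_F mulr_suml; apply: eq_bigr => i _.
by rewrite mulrAC -fmorphV -rmorphM.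
Qed.

Lemma chi_irr_lin pi c x y :
  chi_irr pi (fun rho => c *: x rho + y rho) = c * chi_irr pi x + chi_irr pi y.
Proof.
by rewrite /chi_irr mulmxDr -scalemxAr linearD linearZ /= mulrDl mulrA.
Qed.

Lemma chi_irr_scalar pi (h : irr G -> C) :
  chi_irr pi (fun rho => (h rho)%:M) = h pi.
Proof.
rewrite /chi_irr mul_mx_scalar linearZ /= -mulrA divff ?mulr1 //.
exact: dim_q_neq0.
Qed.

Lemma opnorm_conj_specV pi (z : 'M[C]_(irr_dim pi)) :
  opnorm (specV pi *m z *m (specV pi)^t*) <= opnorm z.
Proof.
have V1 : opnorm (specV pi) <= 1.
  by apply: opnorm_isometry; exact: specVK.
have V2 : opnorm ((specV pi)^t*) <= 1 := le_trans (opnorm_adj _) V1.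
rewrite (le_trans (opnormM _ _)) // (le_trans (ler_wpM2l (opnorm_ge0 _) V2)) //.
rewrite mulr1 (le_trans (opnormM _ _)) //.
by rewrite (le_trans (ler_wpM2r (opnorm_ge0 _) V1)) // mul1r.
Qed.

Lemma chi_irr_le pi x : nrm (chi_irr pi x : C^o) <= opnorm (x pi).
Proof.
rewrite chi_irrE; apply: le_trans (nrm_sum _ _ _) _.
have q0 := qdim_gt0 pi.
apply: (@le_trans _ _ (\sum_i specl i / qdim pi * opnorm (x pi))).
  apply: ler_sum => i _; have l0 := specl_gt0 i.
  have p0 : 0 <= specl i / qdim pi by rewrite divr_ge0 // ltW.
  rewrite nrmCM nrm_real (ger0_norm p0) ler_wpM2l //.
  exact: le_trans (nrm_entry_le _ _ _) (opnorm_conj_specV _).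
by rewrite -mulr_suml -mulr_suml divff ?mul1r // lt0r_neq0.
Qed.

Lemma chi_irr_ge0 pi x : 0 <= chi_irr pi (fun rho => (x rho)^t* *m x rho).
Proof.
rewrite chi_irrE; apply: sumr_ge0 => i _; apply: mulr_ge0.
  by rewrite ler0c divr_ge0 // ltW // ?specl_gt0 ?qdim_gt0.
have -> : specV pi *m ((x pi)^t* *m x pi) *m (specV pi)^t* =
    (x pi *m (specV pi)^t*)^t* *m (x pi *m (specV pi)^t*).
  by rewrite ctM trmxCK !mulmxA.
rewrite mxE; apply: sumr_ge0 => k _.
by rewrite ct_mxE conjC_nrm ler0c sqr_ge0.
Qed.

(** Uniqueness of the KMS functional on a matrix algebra: the condition for [munit k i] and
    [munit i j] kills the off-diagonal values and makes the diagonal ones proportional to the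
    eigenvalues [specl i]. *)
Lemma kms_functional pi (phi : 'M[C]_(irr_dim pi) -> C) :
  (forall c u v, phi (c *: u + v) = c * phi u + phi v) ->
  (forall i j z, (expR (freq i j))%:C%C * phi (z *m munit i j) =
                 phi (munit i j *m z)) ->
  forall z, phi z = phi 1%:M * (\tr (irr_F pi *m z) / dim_q pi).
Proof.
move=> philin kms.
have phi0 : phi 0 = 0.
  by have := philin (-1) 0 0; rewrite scaler0 addr0 mulN1r addNr.
have phisum (I : finType) (c : I -> C) (F : I -> 'M[C]_(irr_dim pi)) :
    phi (\sum_i c i *: F i) = \sum_i c i * phi (F i).
  elim/big_rec2 : _ => [|i y1 y2 _ <-]; first exact: phi0.
  by rewrite philin.
have lp i : (@specl pi i)%:C%C != 0.
  by rewrite eq_complex /= negb_and gt_eqF // specl_gt0.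
have off i j k : (expR (freq i j))%:C%C * phi (munit k j) =
    if j == k then phi (munit i i) else 0.
  have := kms i j (munit k i); rewrite !munitM eqxx => ->.
  by case: eqP => //.
pose i0 := Ordinal (irr_dim_gt0 pi).
pose c := phi (munit i0 i0) / (specl i0)%:C%C.
have diag i : phi (munit i i) = c * (specl i)%:C%C.
  have := off i i0 i0; rewrite eqxx expR_freq rmorphM fmorphV /= => <-.
  by rewrite /c; field; exact: lp.
have offd k j : k != j -> phi (munit k j) = 0.
  move=> kj; have := off k j k; rewrite eq_sym (negPf kj) => /eqP.
  have ne : (expR (freq k j))%:C%C != 0.
    by rewrite eq_complex /= negb_and gt_eqF // expR_gt0.
  by rewrite mulf_eq0 (negPf ne) /= => /eqP.
have phiE z : phi z = c * \tr (irr_F pi *m z).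
  have phiS (F : 'I_(irr_dim pi) -> 'M[C]_(irr_dim pi)) :
      phi (\sum_i F i) = \sum_i phi (F i).
    by under eq_bigr do rewrite -[F _]scale1r; rewrite phisum;
      apply: eq_bigr => i _; rewrite mul1r.
  rewrite {1}[z]munit_decomp tr_irr_F mulr_sumr phiS; apply: eq_bigr => i _.
  rewrite phisum (bigD1 i) //= big1 ?addr0; last first.
    by move=> j ji; rewrite offd ?mulr0 // eq_sym.
  by rewrite diag; ring.
move=> z; rewrite (phiE z) (phiE 1%:M) mulmx1 -/(dim_q pi).
by field; exact: dim_q_neq0.
Qed.

(** The matrix type at pi depends on pi, hence the cast along the equation pi = rho. *)
Definition blk rho (z : 'M[C]_(irr_dim rho)) : dualU G := fun pi =>
  if rho =P pi is ReflectT e then ecast r 'M[C]_(irr_dim r) e z else 0.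

Lemma blkE rho z : @blk rho z rho = z.
Proof. by rewrite /blk; case: eqP => // e; rewrite eq_axiomK. Qed.

Lemma blk_neq rho z pi : pi != rho -> @blk rho z pi = 0.
Proof. by rewrite /blk => ne; case: eqP => // e; case/eqP: ne. Qed.

Lemma blk_lin rho c u v pi : @blk rho (c *: u + v) pi = c *: blk u pi + blk v pi.
Proof.
have [->|ne] := eqVneq pi rho; first by rewrite !blkE.
by rewrite !blk_neq // scaler0 addr0.
Qed.

Lemma blkM rho u v pi : @blk rho (u *m v) pi = blk u pi *m blk v pi.
Proof.
have [->|ne] := eqVneq pi rho; first by rewrite !blkE.
by rewrite !blk_neq // mulmx0.
Qed.

Lemma blk_adj rho u pi : @blk rho (u^t*) pi = (blk u pi)^t*.
Proof.
have [->|ne] := eqVneq pi rho; first by rewrite !blkE.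
by rewrite !blk_neq // ct0.
Qed.

Lemma WstarP x : Wstar x <-> exists c, forall pi, opnorm (x pi) <= c.
Proof.
split=> [[c hc]|[c hc]]; exists c.
  by move=> pi; apply: hc; exists pi.
by move=> _ [pi _ <-].
Qed.

Lemma opnorm_le_Wnorm x pi : Wstar x -> opnorm (x pi) <= Wnorm x.
Proof.
move=> hx; apply: sup_upper_bound; last by exists pi.
by split=> //; exists (opnorm (x pi)), pi.
Qed.

Lemma Wnorm_le x c : 0 <= c -> (forall pi, opnorm (x pi) <= c) -> Wnorm x <= c.
Proof.
move=> c0 hc; have [[r hr]|n0] := pselect ([set opnorm (x pi) | pi in setT] !=set0).
  by apply: ge_sup; [exists r|move=> _ [pi _ <-]].
(* Without any class the supremum is taken over the empty set, where [sup] is 0. *)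
by rewrite /Wnorm; have /set0P/negP := n0; rewrite negbK => /eqP ->; rewrite sup0.
Qed.

Lemma Wnorm_ge0 x : 0 <= Wnorm x.
Proof.
rewrite /Wnorm; have [hs|/sup_out->//] := pselect (has_sup [set opnorm (x pi) | pi in setT]).
have [[r [pi _ hr]] hb] := hs.
by apply: le_trans (opnorm_ge0 (x pi)) _;
  apply: sup_upper_bound => //; exists pi.
Qed.

Lemma Wstar_lin c x y : Wstar x -> Wstar y ->
  Wstar (fun pi => c *: x pi + y pi).
Proof.
move=> /WstarP[a ha] /WstarP[b hb]; apply/WstarP.
exists (nrm (c : C^o) * a + b) => pi.
rewrite (le_trans (opnormD _ _)) // lerD // (le_trans (opnormZ _ _)) //.
by rewrite ler_wpM2l ?nrm_ge0.
Qed.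

Lemma Wstar_mul x y : Wstar x -> Wstar y -> Wstar (fun pi => x pi *m y pi).
Proof.
move=> /WstarP[a ha] /WstarP[b hb]; apply/WstarP; exists (a * b) => pi.
by rewrite (le_trans (opnormM _ _)) // ler_pM ?opnorm_ge0.
Qed.

Lemma Wstar_adj x : Wstar x -> Wstar (fun pi => (x pi)^t*).
Proof.
move=> /WstarP[a ha]; apply/WstarP; exists a => pi.
exact: le_trans (opnorm_adj _) (ha pi).
Qed.

Lemma Wstar_scalar (h : irr G -> C) (c : R) :
  (forall pi, nrm (h pi : C^o) <= c) -> Wstar (fun pi => (h pi)%:M).
Proof.
move=> hc; apply/WstarP; exists c => pi.
rewrite -scalemx1 (le_trans (opnormZ _ _)) //.
rewrite (le_trans (ler_wpM2l (nrm_ge0 _) (opnorm1 _ _))) // mulr1 //.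
Qed.

Lemma Wstar1 : Wstar (fun pi : irr G => 1%:M).
Proof.
by apply: (@Wstar_scalar (fun=> 1) 1) => pi; rewrite (nrm_real 1) normr1.
Qed.

Lemma Wstar0 : Wstar (fun pi : irr G => 0).
Proof. by apply/WstarP; exists 0 => pi; rewrite opnorm0. Qed.

Lemma Wstar_blk rho z : Wstar (@blk rho z).
Proof.
apply/WstarP; exists (opnorm z) => pi.
have [->|ne] := eqVneq pi rho; first by rewrite blkE.
by rewrite blk_neq // opnorm0 opnorm_ge0.
Qed.

Lemma Wnorm_eq0 x : Wstar x -> Wnorm x <= 0 -> x = fun=> 0.
Proof.
move=> hx x0; apply: functional_extensionality_dep => pi; apply: opnorm_eq0.
exact: le_trans (opnorm_le_Wnorm _ hx) x0.
Qed.

Lemma CG_decomp x : CG x -> exists s : seq (irr G), uniq s /\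
  x = fun pi => \sum_(rho <- s) blk (x rho) pi.
Proof.
move=> /finite_seqP[s hs]; exists (undup s); rewrite undup_uniq; split=> //.
apply: functional_extensionality_dep => pi.
have [pis|pis] := boolP (pi \in undup s).
  rewrite (bigD1_seq pi) ?undup_uniq //= blkE big1 ?addr0 // => rho ne.
  by rewrite blk_neq // eq_sym.
rewrite big_seq_cond big1 => [|rho /andP[rs _]].
  apply/eqP; apply: contraNT pis => x0; rewrite mem_undup.
  by have : [set pi | x pi != 0] pi by []; rewrite hs.
by rewrite blk_neq //; apply: contraNneq pis => ->.
Qed.

Lemma CG_blk rho z : CG (@blk rho z).
Proof.
apply: (@sub_finite_set _ _ [set rho]); last exact: finite_set1.
by move=> pi /= h; apply/eqP; apply: contraNT h => /blk_neq ->.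
Qed.

Lemma CG_mull x y : CG y -> CG (fun pi => x pi *m y pi).
Proof.
apply: sub_finite_set => pi /=; apply: contraNN => /eqP ->.
by rewrite mulmx0.
Qed.

Lemma CG_adj x : CG x -> CG (fun pi => (x pi)^t*).
Proof.
apply: sub_finite_set => pi /=; apply: contraNN => /eqP ->.
by rewrite ct0.
Qed.

Lemma CG_Wstar x : CG x -> Wstar x.
Proof.
move=> /CG_decomp[s [_ ->]]; elim: s => [|rho s ih].
  have -> : (fun pi => \sum_(rho <- [::]) blk (x rho) pi) = fun=> 0.
    by apply: functional_extensionality_dep => pi; rewrite big_nil.
  exact: Wstar0.
have := Wstar_lin 1 (Wstar_blk (x rho)) ih.
congr Wstar; apply: functional_extensionality_dep => pi.
by rewrite big_cons scale1r.
Qed.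

Lemma CG_Cstar x : CG x -> Cstar x.
Proof.
move=> hx; split; first exact: CG_Wstar.
move=> e e0; exists x => //; apply: le_lt_trans e0; apply: Wnorm_le => // pi.
by rewrite subrr opnorm0.
Qed.

Lemma isometry_imag_pow pi t : isometry_mx (imag_pow (irr_F pi) t).
Proof.
rewrite /isometry_mx imag_powE sconj_ct sconjM.
rewrite tr_diag_mx map_diag_mx mulmx_diag -[RHS]sconj1 -diag_const_mx.
congr (sconj (diag_mx _)).
have cc (u : R) : (cis u)^* * cis u = 1 by rewrite -cisN -cisD addNr cis0.
by apply/rowP => i; rewrite !mxE; exact: cc.
Qed.

Lemma imag_powD pi s t :
  imag_pow (irr_F pi) s *m imag_pow (irr_F pi) t = imag_pow (irr_F pi) (s + t).
Proof.
rewrite !imag_powE sconjM mulmx_diag; congr (sconj (diag_mx _)).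
by apply/rowP => i; rewrite !mxE -cisD mulrDl.
Qed.

Lemma imag_pow0 pi : imag_pow (irr_F pi) 0 = 1%:M.
Proof.
rewrite imag_powE -[RHS]sconj1 -diag_const_mx; congr (sconj (diag_mx _)).
by apply/rowP => i; rewrite !mxE mul0r cis0.
Qed.

Lemma tau_hatD s t x : tau_hat s (tau_hat t x) = tau_hat (s + t) x.
Proof.
apply: functional_extensionality_dep => pi; rewrite /tau_hat opprD.
rewrite [- s - t]addrC -(imag_powD pi s t) -(imag_powD pi (- t) (- s)).
move: (imag_pow (irr_F pi) s) (imag_pow (irr_F pi) t) => A B.
move: (imag_pow (irr_F pi) (- s)) (imag_pow (irr_F pi) (- t)) => D E.
by rewrite !mulmxA.
Qed.

Lemma tau_hat0 x : tau_hat 0 x = x.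
Proof.
apply: functional_extensionality_dep => pi.
by rewrite /tau_hat oppr0 imag_pow0 mul1mx mulmx1.
Qed.

Lemma opnorm_tau_hat t x pi : opnorm (tau_hat t x pi) <= opnorm (x pi).
Proof.
have i1 := opnorm_isometry (isometry_imag_pow pi t).
have i2 := opnorm_isometry (isometry_imag_pow pi (- t)).
rewrite (le_trans (opnormM _ _)) // (le_trans (ler_wpM2l (opnorm_ge0 _) i2)) //.
rewrite mulr1 (le_trans (opnormM _ _)) //.
by rewrite (le_trans (ler_wpM2r (opnorm_ge0 _) i1)) // mul1r.
Qed.

Lemma Wstar_tau_hat t x : Wstar x -> Wstar (tau_hat t x).
Proof.
move=> /WstarP[c hc]; apply/WstarP; exists c => pi.
exact: le_trans (opnorm_tau_hat _ _ _) (hc pi).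
Qed.

(** The orbit of such an x extends to the entire function z |-> e^(iaz) x, whose value at z = -i is
    e^a x. This is the origin of the factor [expR a] in the KMS identities. *)
Definition eigen (a : R) x :=
  forall t pi, tau_hat t x pi = cis (t * a) *: x pi.

Lemma eigen_munit rho i j : eigen (freq i j) (blk (@munit rho i j)).
Proof.
move=> t pi; rewrite /tau_hat; have [->|ne] := eqVneq pi rho; last first.
  by rewrite blk_neq // mulmx0 mul0mx scaler0.
rewrite blkE !imag_powE /munit !sconjM -sconjZ; congr sconj.
apply/matrixP => k l; rewrite mul_mx_diag mul_diag_mx !mxE.
have [->|_] := eqVneq k i; last by rewrite /= mulr0 mul0r mulr0.
have [->|_] := eqVneq l j; last by rewrite /= mulr0 mul0r mulr0.
by rewrite /= !mulr1 -cisD mulNr -mulrBr.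
Qed.

(** In the eigenbasis, a nonzero entry (i, j) of y forces [freq i j] = a, because the phases agree
    for all times; hence the relation holds entry by entry at imaginary time as well. *)
Lemma eigen_irr_F a y pi : eigen a y ->
  irr_F pi *m y pi = (expR a)%:C%C *: (y pi *m irr_F pi).
Proof.
move=> ea; pose Y := specV pi *m y pi *m (specV pi)^t*.
have yE : y pi = sconj Y by rewrite sconjK.
have ent i j t : cis (t * freq i j) * Y i j = cis (t * a) * Y i j.
  have := ea t pi; rewrite /tau_hat !imag_powE yE !sconjM -sconjZ => /sconj_inj.
  move=> /matrixP/(_ i j); rewrite mul_mx_diag mul_diag_mx !mxE => <-.
  by rewrite mulrBr cisD -mulNr; ring.
have ent2 i j : (specl i)%:C%C * Y i j = (expR a * specl j)%:C%C * Y i j.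
  have [->|Y0] := eqVneq (Y i j) 0; first by rewrite !mulr0.
  have <- : freq i j = a by apply: cis_inj => t; apply: (mulIf Y0); exact: ent.
  by rewrite expR_freq divfK // lt0r_neq0 // specl_gt0.
move: Y yE ent2 {ent} => Y yE ent2.
rewrite irr_F_spec yE !sconjM -sconjZ; congr sconj.
apply/matrixP => i j; rewrite mul_mx_diag mul_diag_mx !mxE ent2 rmorphM /=.
by ring.
Qed.

Lemma chi_irr_kms a y x pi : eigen a y ->
  (expR a)%:C%C * chi_irr pi (fun rho => x rho *m y rho) =
  chi_irr pi (fun rho => y rho *m x rho).
Proof.
move=> /eigen_irr_F => /(_ pi) ea; rewrite /chi_irr mulrA; congr (_ / _).
rewrite !mulmxA ea -scalemxAl linearZ /=; congr (_ * _).
by rewrite mxtrace_mulC !mulmxA.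
Qed.

End DualFamilies.

(** * Matrices over a C*-algebra and complete reducibility *)

(* The multiplication of a C*-algebra, repackaged so that matrices over it
   inherit the theory of [mulmx]. *)
Definition cring (R : realType) (A : cstarAlgType R) : Type := A.

Section CRing.
Variables (R : realType) (A : cstarAlgType R).
HB.instance Definition _ := GRing.Zmodule.copy (cring A) A.

Lemma cmulDl (x y z : A) : (x + y) ** z = x ** z + y ** z.
Proof. by have := cmul_linearl 1 x y z; rewrite !scale1r. Qed.

Lemma cmulDr (x y z : A) : z ** (x + y) = z ** x + z ** y.
Proof. by have := cmul_linearr 1 x y z; rewrite !scale1r. Qed.

HB.instance Definition _ := GRing.Zmodule_isPzRing.Build (cring A)
  (@cmulA R A) (@cmul1l R A) (@cmul1r R A)
  (fun x y z => cmulDl x y z) (fun x y z => cmulDr y z x).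

Lemma cmul0l (x : A) : 0 ** x = 0.
Proof. exact: (@mul0r (cring A)). Qed.

Lemma cmul0r (x : A) : x ** 0 = 0.
Proof. exact: (@mulr0 (cring A)). Qed.

Lemma cmulZl (c : R[i]) (x y : A) : (c *: x) ** y = c *: (x ** y).
Proof. by have := cmul_linearl c x 0 y; rewrite cmul0l !addr0. Qed.

Lemma cmulZr (c : R[i]) (x y : A) : x ** (c *: y) = c *: (x ** y).
Proof. by have := cmul_linearr c y 0 x; rewrite cmul0r !addr0. Qed.

Lemma cmulBl (x y z : A) : (x - y) ** z = x ** z - y ** z.
Proof. exact: (@mulrBl (cring A)). Qed.

Lemma cmulBr (x y z : A) : z ** (x - y) = z ** x - z ** y.
Proof. exact: (@mulrBr (cring A)). Qed.

Lemma cstarD (x y : A) : cstar (x + y) = cstar x + cstar y.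
Proof. by have := cstar_antilinear 1 x y; rewrite rmorph1 !scale1r. Qed.

Lemma cstar0 : cstar (0 : A) = 0.
Proof. by apply: (addrI (cstar 0)); rewrite -cstarD !addr0. Qed.

Lemma cstarZ (c : R[i]) (x : A) : cstar (c *: x) = c^* *: cstar x.
Proof. by have := cstar_antilinear c x 0; rewrite cstar0 !addr0. Qed.

Lemma cstarN (x : A) : cstar (- x) = - cstar x.
Proof. by apply: (addrI (cstar x)); rewrite -cstarD !subrr cstar0. Qed.

Lemma cstarB (x y : A) : cstar (x - y) = cstar x - cstar y.
Proof. by rewrite cstarD cstarN. Qed.

Lemma cstar_sum I (r : seq I) (P : pred I) (F : I -> A) :
  cstar (\sum_(i <- r | P i) F i) = \sum_(i <- r | P i) cstar (F i).
Proof. exact: (big_morph _ cstarD cstar0). Qed.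

Lemma cstar1 : cstar (cone : A) = cone.
Proof. by rewrite -[LHS]cmul1l -{1}[cone]cstarK -cstarM cmul1l cstarK. Qed.

Lemma amulE m n p (U : 'M[A]_(m, n)) (V : 'M[A]_(n, p)) :
  amul U V = (U : 'M[cring A]_(m, n)) *m (V : 'M[cring A]_(n, p)).
Proof. by apply/matrixP => i k; rewrite !mxE. Qed.

Lemma amulA m n p q (U : 'M[A]_(m, n)) (V : 'M[A]_(n, p)) (W : 'M[A]_(p, q)) :
  amul U (amul V W) = amul (amul U V) W.
Proof. by rewrite !amulE mulmxA. Qed.

Lemma amulDl m n p (U V : 'M[A]_(m, n)) (W : 'M[A]_(n, p)) :
  amul (U + V) W = amul U W + amul V W.
Proof. by rewrite !amulE; exact: (@mulmxDl (cring A)). Qed.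

Lemma amulDr m n p (U V : 'M[A]_(m, n)) (W : 'M[A]_(p, m)) :
  amul W (U + V) = amul W U + amul W V.
Proof. by rewrite !amulE; exact: (@mulmxDr (cring A)). Qed.

Lemma amul_ampl m n p (T : 'M[R[i]]_(m, n)) (V : 'M[A]_(n, p)) i k :
  amul (amp A T) V i k = \sum_j T i j *: V j k.
Proof. by rewrite mxE; apply: eq_bigr => j _; rewrite mxE cmulZl cmul1l. Qed.

Lemma amul_ampr m n p (T : 'M[R[i]]_(n, p)) (V : 'M[A]_(m, n)) i k :
  amul V (amp A T) i k = \sum_j T j k *: V i j.
Proof. by rewrite mxE; apply: eq_bigr => j _; rewrite mxE cmulZr cmul1r. Qed.

Lemma ampM m n p (S : 'M[R[i]]_(m, n)) (T : 'M[R[i]]_(n, p)) :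
  amp A (S *m T) = amul (amp A S) (amp A T).
Proof.
apply/matrixP => i k; rewrite amul_ampl !mxE scaler_suml.
by apply: eq_bigr => j _; rewrite mxE scalerA.
Qed.

Lemma ampD m n (S T : 'M[R[i]]_(m, n)) : amp A (S + T) = amp A S + amp A T.
Proof. by apply/matrixP => i k; rewrite !mxE scalerDl. Qed.

Lemma amul1l m n (V : 'M[A]_(m, n)) : amul (amp A 1%:M) V = V.
Proof.
apply/matrixP => i k; rewrite amul_ampl (bigD1 i) //= mxE eqxx scale1r.
by rewrite big1 ?addr0 // => j ji; rewrite mxE eq_sym (negPf ji) scale0r.
Qed.

Lemma amul1r m n (V : 'M[A]_(m, n)) : amul V (amp A 1%:M) = V.
Proof.
apply/matrixP => i k; rewrite amul_ampr (bigD1 k) //= mxE eqxx scale1r.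
by rewrite big1 ?addr0 // => j ji; rewrite mxE (negPf ji) scale0r.
Qed.

Lemma amul_diagl n p (d : 'rV[R[i]]_n) (V : 'M[A]_(n, p)) i k :
  amul (amp A (diag_mx d)) V i k = d 0 i *: V i k.
Proof.
rewrite amul_ampl (bigD1 i) //= [diag_mx _ _ _]mxE eqxx mulr1n.
by rewrite big1 ?addr0 // => j ji; rewrite mxE eq_sym (negPf ji) scale0r.
Qed.

Lemma amul_diagr m n (d : 'rV[R[i]]_n) (V : 'M[A]_(m, n)) i k :
  amul V (amp A (diag_mx d)) i k = d 0 k *: V i k.
Proof.
rewrite amul_ampr (bigD1 k) //= [diag_mx _ _ _]mxE eqxx mulr1n.
by rewrite big1 ?addr0 // => j ji; rewrite mxE (negPf ji) scale0r.
Qed.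

Definition astar m n (U : 'M[A]_(m, n)) : 'M[A]_(n, m) := map_mx cstar U^T.

Lemma astarM m n p (U : 'M[A]_(m, n)) (V : 'M[A]_(n, p)) :
  astar (amul U V) = amul (astar V) (astar U).
Proof.
apply/matrixP => i k; rewrite !mxE cstar_sum; apply: eq_bigr => j _.
by rewrite !mxE cstarM.
Qed.

Lemma astar_amp m n (T : 'M[R[i]]_(m, n)) : astar (amp A T) = amp A (T^t*).
Proof. by apply/matrixP => i k; rewrite !mxE cstarZ cstar1. Qed.

End CRing.

Section StarHomMatrices.
Variables (R : realType) (A B : cstarAlgType R) (f : A -> B).
Hypothesis hf : star_hom f.

Lemma star_hom_lin (c : R[i]) x y : f (c *: x + y) = c *: f x + f y.
Proof. by have [h _ _ _] := hf; exact: h. Qed.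

Lemma star_homD x y : f (x + y) = f x + f y.
Proof. by have := star_hom_lin 1 x y; rewrite !scale1r. Qed.

Lemma star_hom0 : f 0 = 0.
Proof. by apply: (addrI (f 0)); rewrite -star_homD !addr0. Qed.

Lemma star_homZ (c : R[i]) x : f (c *: x) = c *: f x.
Proof. by have := star_hom_lin c x 0; rewrite star_hom0 !addr0. Qed.

Lemma star_homN x : f (- x) = - f x.
Proof. by rewrite -scaleN1r star_homZ scaleN1r. Qed.

Lemma star_homB x y : f (x - y) = f x - f y.
Proof. by rewrite star_homD star_homN. Qed.

Lemma star_homM x y : f (x ** y) = f x ** f y.
Proof. by have [_ h _ _] := hf; exact: h. Qed.

Lemma star_hom_star x : f (cstar x) = cstar (f x).
Proof. by have [_ _ h _] := hf; exact: h. Qed.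

Lemma star_hom1 : f cone = cone.
Proof. by have [_ _ _ h] := hf. Qed.

Lemma star_hom_sum I (r : seq I) (P : pred I) (F : I -> A) :
  f (\sum_(i <- r | P i) F i) = \sum_(i <- r | P i) f (F i).
Proof. exact: (big_morph _ star_homD star_hom0). Qed.

Lemma map_amul m n p (U : 'M[A]_(m, n)) (V : 'M[A]_(n, p)) :
  map_mx f (amul U V) = amul (map_mx f U) (map_mx f V).
Proof.
apply/matrixP => i k; rewrite !mxE star_hom_sum; apply: eq_bigr => j _.
by rewrite !mxE star_homM.
Qed.

Lemma map_amp m n (T : 'M[R[i]]_(m, n)) : map_mx f (amp A T) = amp B T.
Proof. by apply/matrixP => i k; rewrite !mxE star_homZ star_hom1. Qed.

Lemma map_astar m n (U : 'M[A]_(m, n)) :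
  map_mx f (astar U) = astar (map_mx f U).
Proof. by apply/matrixP => i k; rewrite !mxE star_hom_star. Qed.

Lemma aunitary_map n (U : 'M[A]_n) : aunitary U -> aunitary (map_mx f U).
Proof.
rewrite /aunitary /is_ainv -!/(astar _) -map_astar => -[h1 h2].
by rewrite -!map_amul h1 h2 map_amp.
Qed.

End StarHomMatrices.

(** * Complete reducibility of finite-dimensional unitary representations *)

Section CompleteReducibility.
Variable R : realType.
Local Notation C := R[i].

Lemma is_rep_matrix (G : cqg R) n (U : 'M[G]_n) :
  (forall i j, qdelta (U i j) =
    \sum_k tinl (qalg2 G) (U i k) ** tinr (qalg2 G) (U k j)) <->
  map_mx (@qdelta _ G) U =
  amul (map_mx (tinl (qalg2 G)) U) (map_mx (tinr (qalg2 G)) U).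
Proof.
split=> [h|/matrixP h i j].
  apply/matrixP => i j; rewrite mxE h mxE.
  by apply: eq_bigr => k _; rewrite !mxE.
by have := h i j; rewrite !mxE => ->; apply: eq_bigr => k _; rewrite !mxE.
Qed.

Lemma map_comm (A B : cstarAlgType R) (f : A -> B) n (P : 'M[C]_n)
    (U : 'M[A]_n) : star_hom f -> Mor U U P ->
  amul (amp B P) (map_mx f U) = amul (map_mx f U) (amp B P).
Proof.
move=> hf; rewrite /Mor /= => PU.
by rewrite -(map_amp hf) -!(map_amul hf) PU.
Qed.

(** When W is an isometry whose range projection commutes with U, this is the subrepresentation on
    the range of W. *)
Definition compress (A : cstarAlgType R) n k (W : 'M[C]_(n, k)) (U : 'M[A]_n) :
  'M[A]_k := amul (amp A (W^t*)) (amul U (amp A W)).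

Lemma map_compress (A B : cstarAlgType R) (f : A -> B) n k (W : 'M[C]_(n, k))
    (U : 'M[A]_n) : star_hom f ->
  map_mx f (compress W U) = compress W (map_mx f U).
Proof. by move=> hf; rewrite /compress !(map_amul hf) !(map_amp hf). Qed.

Lemma compressM (A : cstarAlgType R) n k (W : 'M[C]_(n, k)) (U V : 'M[A]_n) :
  isometry_mx W ->
  amul (amp A (W *m W^t*)) U = amul U (amp A (W *m W^t*)) ->
  amul (compress W U) (compress W V) = compress W (amul U V).
Proof.
move=> iW comm; rewrite /compress !amulA; congr amul.
rewrite -[amul (amul (amul _ U) (amp A W)) _]amulA -ampM.
rewrite -(amulA (amp A (W^t*)) U) -comm !amulA -ampM mulmxA iW mul1mx.
by rewrite -!amulA.
Qed.

Lemma compress_unitary_rep (G : cqg R) n k (W : 'M[C]_(n, k)) (U : 'M[G]_n) :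
  isometry_mx W -> Mor U U (W *m W^t*) -> unitary_rep U ->
  unitary_rep (compress W U).
Proof.
move=> iW comm [[_ /is_rep_matrix repU] [uU uU']].
have comm' : amul (amp G (W *m W^t*)) (astar U) =
    amul (astar U) (amp G (W *m W^t*)).
  have := congr1 (@astar _ _ _ _) comm; rewrite !astarM astar_amp ctM trmxCK.
  by move=> ->.
have stc : astar (compress W U) = compress W (astar U).
  by rewrite /compress !astarM !astar_amp trmxCK amulA.
have c1 : compress W (amp G (1%:M : 'M[C]_n)) = amp G 1%:M.
  by rewrite /compress amul1l -ampM iW.
have un : aunitary (compress W U).
  rewrite /aunitary /is_ainv -/(astar _) stc !compressM //.
  by rewrite uU uU' c1.
split=> //; split; first by exists (astar (compress W U)).
apply/is_rep_matrix.
rewrite !map_compress ?compressM ?repU //.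
- exact: map_comm (tinl_hom _) comm.
- exact: tinr_hom.
- exact: tinl_hom.
- exact: qdelta_hom.
Qed.

Lemma compress_intertwiner (A : cstarAlgType R) n k (W : 'M[C]_(n, k))
    (U : 'M[A]_n) : isometry_mx W -> Mor U U (W *m W^t*) ->
  Mor (compress W U) U W.
Proof.
move=> iW comm; rewrite /Mor /= /compress !amulA -ampM comm -amulA -ampM.
by rewrite -mulmxA iW mulmx1.
Qed.

Lemma Mor_comp (A : cstarAlgType R) n m p (U : 'M[A]_n) (V : 'M[A]_m)
    (W : 'M[A]_p) S T : Mor U V S -> Mor V W T -> Mor U W (T *m S).
Proof.
by rewrite /Mor /= => h1 h2; rewrite ampM -amulA h1 amulA h2 amulA.
Qed.

Lemma Mor_lin (A : cstarAlgType R) n m (U : 'M[A]_n) (V : 'M[A]_m) c S T :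
  Mor U V S -> Mor U V T -> Mor U V (c *: S + T).
Proof.
rewrite /Mor /= !ampD !amulDl !amulDr => h1 ->; congr (_ + _).
apply/matrixP => i k; rewrite amul_ampl amul_ampr.
have /matrixP/(_ i k) := h1; rewrite amul_ampl amul_ampr => /(congr1 ( *:%R c)).
rewrite !scaler_sumr => h; under eq_bigr do rewrite mxE -scalerA.
by rewrite h; apply: eq_bigr => j _; rewrite mxE scalerA.
Qed.

Lemma Mor_adj (A : cstarAlgType R) n m (U : 'M[A]_n) (V : 'M[A]_m) T :
  aunitary U -> aunitary V -> Mor U V T -> Mor V U (T^t*).
Proof.
rewrite /Mor /= /aunitary /is_ainv -!/(astar _) => -[u1 u2] [v1 v2] h.
have := congr1 (@astar _ _ _ _) h; rewrite !astarM astar_amp => h'.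
rewrite -[amul (amp A (T^t*)) V]amul1l -u1 -amulA; congr amul.
by rewrite amulA h' -amulA v2 amul1r.
Qed.

(** Isometric inclusion of the coordinate subspace indexed by I, which becomes a space of its own
    dimension. *)
Definition select n (I : {set 'I_n}) : 'M[C]_(n, #|I|) :=
  \matrix_(i, a) (i == enum_val a)%:R.

Lemma select_isometry n (I : {set 'I_n}) : isometry_mx (select I).
Proof.
apply/matrixP => a b; rewrite !mxE (bigD1 (enum_val a)) //= !mxE eqxx rmorph1.
rewrite mul1r big1 ?addr0 => [|i ia].
  by rewrite (inj_eq enum_val_inj).
by rewrite !mxE (negPf ia) rmorph0 mul0r.
Qed.

Lemma select_proj n (I : {set 'I_n}) :
  select I *m (select I)^t* = diag_mx (\row_i (i \in I)%:R).
Proof.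
apply/matrixP => i j; rewrite !mxE.
have [iI|iI] := boolP (i \in I).
  rewrite (bigD1 (enum_rank_in iI i)) //= !mxE enum_rankK_in // eqxx mul1r.
  rewrite rmorph_nat big1 ?addr0 => [|a ai]; first by rewrite eq_sym.
  rewrite !mxE; case: eqP => [ia|_]; last by rewrite mul0r.
  by exfalso; case/eqP: ai; apply: enum_val_inj; rewrite -ia enum_rankK_in.
rewrite mul0rn big1 // => a _; rewrite !mxE; case: eqP => [ia|_].
  by move: iI; rewrite ia enum_valP.
by rewrite mul0r.
Qed.

(** Isometric embeddings of irreducibles whose range projections add up to 1; multiplicities appear
    as repeated tags. *)
Definition is_decomp (G : ucqg R) n (U : 'M[G]_n)
    (s : seq {rho : irr G & 'M[C]_(n, irr_dim rho)}) : Prop :=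
  (forall t, t \in s -> Mor (irr_rep (tag t)) U (tagged t) /\
     isometry_mx (tagged t)) /\
  \sum_(t <- s) tagged t *m (tagged t)^t* = 1%:M.

(** T is a combination of the hermitian intertwiners T + T' and i (T - T'), where T' is its adjoint,
    so they cannot both be scalar. *)
Lemma hermitian_nonscalar (A : cstarAlgType R) n (U : 'M[A]_n) T :
  aunitary U -> Mor U U T -> (forall c : C, T <> c%:M) ->
  exists H, [/\ Mor U U H, H^t* = H & forall c : C, H <> c%:M].
Proof.
move=> uU hT nT; have hT' := Mor_adj uU uU hT.
have [[c1 e1]|n1] := pselect (exists c : C, T + T^t* = c%:M); last first.
  exists (T + T^t*); split; last by move=> c e; apply: n1; exists c.
    by have := Mor_lin 1 hT hT'; rewrite scale1r.
  by rewrite ctD trmxCK addrC.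
have [[c2 e2]|n2] :=
    pselect (exists c : C, Complex 0 1 *: (T - T^t*) = c%:M); last first.
  exists (Complex 0 1 *: (T - T^t*)); split.
  - have := Mor_lin (- Complex 0 1) hT' (Mor_lin (Complex 0 1) hT
      (Mor_lin (-1) hT hT)); rewrite scaleN1r addNr addr0.
    by rewrite scalerBr scaleNr addrC.
  - rewrite ctZ ctB trmxCK.
    have -> : (Complex 0 1 : C)^* = - Complex 0 1.
      by apply/eqP; rewrite eq_complex /= oppr0 !eqxx.
    by rewrite scaleNr -scalerN opprB.
  - by move=> c e; apply: n2; exists c.
exfalso; apply: (nT (2^-1 * (c1 - Complex 0 1 * c2))).
rewrite -scalemx1 -scalerA scalerBl -scalerA !scalemx1 -e1 -e2 scalerA.
have -> : Complex 0 1 * Complex 0 1 = -1 :> C.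
  by apply/eqP; rewrite eq_complex /=; apply/andP; split; apply/eqP; ring.
by rewrite scaleN1r opprK addrACA subrr addr0 -[T + T]mulr2n
  -[T *+ 2]scaler_nat scalerA mulVf ?scale1r // pnatr_eq0.
Qed.

(** Induction on the dimension. If only scalars intertwine, [irr_surj] applies; otherwise an
    eigenspace of a nonscalar hermitian intertwiner and its orthogonal complement are invariant and
    smaller. *)
Lemma unitary_rep_decomp (G : ucqg R) n (U : 'M[G]_n) :
  unitary_rep U -> exists s, is_decomp U s.
Proof.
elim/ltn_ind: n U => n IH U rU.
have [n0|npos] := posnP n.
  exists [::]; split=> //; rewrite big_nil; apply/matrixP => i.
  by have := ltn_ord i; rewrite [X in (_ < X)%N]n0.
have [irrU|] := pselect (forall T, Mor U U T -> exists c : C, T = c%:M).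
  have irU : irreducible_rep U.
    split=> //; apply/seteqP; split=> // T [c ->]; rewrite /Mor /=.
    apply/matrixP => i k.
    by rewrite -diag_const_mx amul_diagl amul_diagr !mxE.
  have [pi [T hT [i1 i2]]] := irr_surj rU irU.
  exists [:: Tagged (fun rho => 'M[C]_(n, irr_dim rho)) (T^t*)]; split.
    move=> t; rewrite inE => /eqP ->; split=> //=.
    by apply: Mor_adj hT; [case: rU|case: (irr_repP pi) => -[]].
  by rewrite big_seq1 /= trmxCK.
move=> /existsNP[T /not_implyP[hT nT]].
have uU : aunitary U by case: rU.
have [H [hH Hherm nH]] := hermitian_nonscalar uU hT
  (fun c e => nT (ex_intro _ c e)).
have /orthomx_spectralP : H \is normalmx by apply/normalmxP; rewrite Hherm.
set V := spectralmx H; set d := spectral_diag H => HE.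
have VV : V *m V^t* = 1%:M by apply/unitarymxP/spectral_unitarymx.
have VK : V^t* *m V = 1%:M by apply/mulmx1C.
rewrite invmx_unitary ?spectral_unitarymx // -/V in HE.
have [i0 [i1 d01]] : exists i0 i1, d 0 i0 != d 0 i1.
  apply: contrapT => nd; pose j0 := Ordinal npos.
  apply: (nH (d 0 j0)); rewrite HE.
  have -> : d = const_mx (d 0 j0).
    apply/rowP => i; rewrite mxE; apply: contrapT => /eqP ne; apply: nd.
    by exists i, j0.
  rewrite [const_mx _ 0 j0]mxE diag_const_mx -mulmxA mul_scalar_mx.
  by rewrite -scalemxAr VK scalemx1.
(* All indices of one eigenvalue are taken together: only full eigenspaces are sure to be
   invariant. *)
pose I : {set 'I_n} := [set i | d 0 i == d 0 i0]%SET.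
pose W (J : {set 'I_n}) := V^t* *m select J.
have isoW J : isometry_mx (W J).
  by rewrite /isometry_mx /W ctM trmxCK mulmxA -(mulmxA _ V) VV mulmx1 select_isometry.
(* In the eigenbasis U commutes with diag d, so (d i - d j) annihilates its entry (i, j). *)
have UV i j : d 0 i != d 0 j ->
    compress (V^t*) U i j = 0.
  move=> dij; have hd : Mor (compress (V^t*) U) (compress (V^t*) U) (diag_mx d).
    rewrite /Mor /= /compress trmxCK.
    have -> : diag_mx d = V *m H *m V^t*.
      by rewrite HE !mulmxA VV mul1mx -mulmxA VV mulmx1.
    rewrite !ampM !amulA -!ampM.
    rewrite -[X in amul (amul (amp G X) _) _]mulmxA VK mulmx1 ampM.
    rewrite -(amulA _ (amp G H)) hH !amulA.
    rewrite -[in RHS](amulA _ (amp G (V^t*))) -ampM.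
    by rewrite VK -(amulA _ (amp G 1%:M)) amul1l -!amulA.
  have /matrixP/(_ i j) := hd; rewrite amul_diagl amul_diagr.
  move/eqP; rewrite -subr_eq0 -scalerBl scaler_eq0 subr_eq0.
  by rewrite (negPf dij) => /eqP.
have comm (J : {set 'I_n}) : (forall i j, (i \in J) != (j \in J) -> d 0 i != d 0 j) ->
    Mor U U (W J *m (W J)^t*).
  move=> hJ; rewrite /W ctM trmxCK !mulmxA -(mulmxA _ (select J)) select_proj.
  set E := diag_mx _.
  have hE : amul (amp G E) (compress (V^t*) U) =
      amul (compress (V^t*) U) (amp G E).
    apply/matrixP => i j; rewrite amul_diagl amul_diagr.
    have [ij|ij] := eqVneq (i \in J) (j \in J).
      by congr (_ *: _); rewrite !mxE ij.
    by rewrite (UV i j (hJ i j ij)) !scaler0.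
  have := congr1 (fun M => amul (amp G (V^t*)) (amul M (amp G V))) hE.
  rewrite /compress trmxCK !amulA -!ampM VK amul1l.
  rewrite -(amulA _ (amp G (V^t*)) (amp G V)) -ampM VK amul1r.
  by rewrite -!amulA -!ampM !mulmxA.
have lt1 : (#|I| < n)%N.
  rewrite -[X in (_ < X)%N](card_ord n); apply: proper_card; apply/properP.
  by split; [exact: subset_predT|exists i1; rewrite // inE eq_sym].
have lt2 : (#|~: I| < n)%N.
  rewrite -[X in (_ < X)%N](card_ord n); apply: proper_card; apply/properP.
  by split; [exact: subset_predT|exists i0; rewrite // !inE eqxx].
have cI : Mor U U (W I *m (W I)^t*).
  apply: comm => i j; rewrite !inE; apply: contraNN => /eqP ->; exact: eqxx.
have cI' : Mor U U (W (~: I) *m (W (~: I))^t*).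
  apply: comm => i j; rewrite !inE; apply: contraNN => /eqP ->; exact: eqxx.
have [s1 [h1 sum1]] := IH _ lt1 _ (compress_unitary_rep (isoW I) cI rU).
have [s2 [h2 sum2]] := IH _ lt2 _ (compress_unitary_rep (isoW (~: I)) cI' rU).
pose lft J (t : {rho : irr G & 'M[C]_(#|J : {set 'I_n}|, irr_dim rho)}) :=
  Tagged (fun rho => 'M[C]_(n, irr_dim rho)) (W J *m tagged t).
have hlft J t : Mor U U (W J *m (W J)^t*) ->
    Mor (irr_rep (tag t)) (compress (W J) U) (tagged t) /\
     isometry_mx (tagged t) ->
    Mor (irr_rep (tag (lft J t))) U (tagged (lft J t)) /\
     isometry_mx (tagged (lft J t)).
  move=> cJ [m1 m2]; split.
    exact: Mor_comp m1 (compress_intertwiner (isoW J) cJ).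
  by rewrite /isometry_mx /= ctM mulmxA -(mulmxA _ ((W J)^t*)) isoW mulmx1.
exists (map (lft I) s1 ++ map (lft (~: I)) s2); split.
  move=> t; rewrite mem_cat => /orP[] /mapP[t' ts ->].
    by apply: hlft => //; exact: h1.
  by apply: hlft => //; exact: h2.
have sumlft J (s : seq {rho : irr G & 'M[C]_(#|J : {set 'I_n}|, irr_dim rho)}) :
    \sum_(t <- map (lft J) s) tagged t *m (tagged t)^t* =
    W J *m (\sum_(t <- s) tagged t *m (tagged t)^t*) *m (W J)^t*.
  rewrite big_map mulmx_sumr mulmx_suml; apply: eq_bigr => t _.
  by rewrite /= ctM !mulmxA.
rewrite big_cat /= !sumlft sum1 sum2 !mulmx1 /W !ctM trmxCK.
rewrite !mulmxA -mulmxDl -!(mulmxA (V^t*)) -mulmxDr !select_proj.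
suff -> : diag_mx (\row_i (i \in I)%:R) + diag_mx (\row_i (i \in ~: I)%:R) =
    1%:M :> 'M[C]_n by rewrite mulmx1 VK.
rewrite -raddfD /= -diag_const_mx; congr diag_mx; apply/rowP => i.
by rewrite !mxE !inE; case: eqP => _; rewrite ?addr0 ?add0r.
Qed.

End CompleteReducibility.

(** * The maps Theta and the cotransition probabilities *)

Section ThetaMap.
Variables (R : realType) (GG : ind_system R) (B : ind_limit GG).
Local Notation C := R[i].
Local Notation io := (iota_lim B).

Lemma fam_ext N (x y : dualU (GG N)) : (forall pi, x pi = y pi) -> x = y.
Proof. exact: functional_extensionality_dep. Qed.

Lemma iota0 N : io (fun _ : irr (GG N) => 0) = 0.
Proof.
apply: nrm0_eq0; rewrite /nrm iota_norm; last exact: Wstar0.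
apply/eqP; rewrite eq_le Wnorm_ge0 andbT; apply: Wnorm_le => // pi.
by rewrite opnorm0.
Qed.

Lemma nrm_iota N (x : dualU (GG N)) : Wstar x -> nrm (io x) = Wnorm x.
Proof. by move=> hx; rewrite /nrm iota_norm. Qed.

Lemma iota_inj N (x y : dualU (GG N)) : Wstar x -> Wstar y ->
  io x = io y -> x = y.
Proof.
move=> hx hy xy; pose d : dualU (GG N) := fun pi => -1 *: y pi + x pi.
have hd : Wstar d by exact: Wstar_lin.
have d0 : d = fun=> 0.
  apply: Wnorm_eq0 => //; rewrite -nrm_iota // /d (iota_linear B _ hy hx) xy.
  by rewrite scaleN1r addNr nrm0.
apply: fam_ext => pi; have := congr1 (fun f => f pi) d0; rewrite /d /=.
by rewrite scaleN1r addrC => /eqP; rewrite subr_eq0 => /eqP.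
Qed.

(* If no functional represented [x], the junk value of [functional_of] would
   give [Theta x = 0], so that [x = 0] since [iota] is isometric: but [0] is
   represented by the zero functional. *)
Lemma functional_ofP N (x : dualU (GG N)) : Wstar x ->
  linear_on (coef_alg (GG N)) (functional_of x) /\ fam_of (functional_of x) = x.
Proof.
move=> hx; rewrite /functional_of; case: xgetP => [f _ []//|none].
have Th0 : Theta x = fun=> 0.
  apply: fam_ext => pi; rewrite /Theta /fam_of /functional_of.
  case: xgetP => [f _ hf|_]; first by have := none f.
  by apply/matrixP => i j; rewrite !mxE.
have x0 : x = fun=> 0.
  apply: Wnorm_eq0 => //; rewrite -nrm_iota // -(iota_Theta B hx) Th0 iota0.
  by rewrite nrm0.
exfalso; apply: (none (fun=> 0)); split.
  by move=> c u v _ _; rewrite mulr0 addr0.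
by rewrite x0; apply: fam_ext => pi; apply/matrixP => i j; rewrite !mxE.
Qed.

Lemma unitary_rep_theta N (pi : irr (GG N.+1)) :
  unitary_rep (map_mx theta (irr_rep pi)).
Proof.
have [[[[V [v1 v2]] hr] hu] _] := irr_repP pi.
have [th [tt [htt tl tr hd]]] := theta_hom GG N.
split; last exact: aunitary_map.
split.
  exists (map_mx theta V).
  by split; rewrite -(map_amul th) ?v1 ?v2 (map_amp th).
move=> i j; rewrite mxE hd hr (star_hom_sum htt); apply: eq_bigr => k _.
by rewrite (star_homM htt) tl tr !mxE.
Qed.

(** The restriction of U_pi is decomposed into irreducibles and the functional of x applied
    entrywise. That functional is linear only on [coef_alg], so membership of all partial sums is
    carried along. *)
Lemma Theta_decomp N (pi : irr (GG N.+1)) :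
  exists s : seq {rho : irr (GG N) & 'M[C]_(irr_dim pi, irr_dim rho)},
  [/\ forall t, t \in s -> prec (tag t) pi,
      \sum_(t <- s) tagged t *m (tagged t)^t* = 1%:M
    & forall x, Wstar x -> Theta x pi =
        \sum_(t <- s) tagged t *m x (tag t) *m (tagged t)^t*].
Proof.
have ru := unitary_rep_theta pi.
have [s [hs sum1]] := unitary_rep_decomp ru.
exists s; split=> //.
  by move=> t /hs[h1 h2]; exists (tagged t).
move=> x hx; have [flin fx] := functional_ofP hx.
set f := functional_of x in flin fx.
set U := map_mx theta (irr_rep pi) in ru hs.
have co (rho : irr (GG N)) i j : coef_alg (GG N) (irr_rep rho i j).
  move=> S [[S0 Slin] hS]; apply: hS.
  by exists (irr_dim rho), (irr_rep rho), i, j; have [[? _] _] := irr_repP rho.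
have sub : lin_subspace (coef_alg (GG N)).
  split; first by move=> S [[S0 _] _].
  by move=> c u v hu hv S hS; have [[_ Sl] _] := hS; apply: Sl; [exact: hu|exact: hv].
have f0 : f 0 = 0.
  have c0 : coef_alg (GG N) 0 by case: sub.
  by have := flin (-1) 0 0 c0 c0; rewrite scaler0 addr0 mulN1r addNr.
have fsum I (r : seq I) (c : I -> C) (F : I -> GG N) :
    (forall i, coef_alg (GG N) (F i)) ->
    coef_alg (GG N) (\sum_(i <- r) c i *: F i) /\
    f (\sum_(i <- r) c i *: F i) = \sum_(i <- r) c i * f (F i).
  move=> hF; elim: r => [|i r [ih1 ih2]].
    by rewrite !big_nil f0; split=> //; case: sub.
  rewrite !big_cons flin // ih2; split=> //.
  by case: sub => _; apply.
have UE : U = \sum_(t <- s) amul (amp (GG N) (tagged t)) (amul (irr_rep (tag t))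
    (amp (GG N) ((tagged t)^t*))).
  rewrite -[LHS]amul1r -sum1.
  have ampS (r : seq {rho : irr (GG N) & 'M[C]_(irr_dim pi, irr_dim rho)}) :
      amul U (amp (GG N) (\sum_(t <- r) tagged t *m (tagged t)^t*)) =
      \sum_(t <- r) amul U (amp (GG N) (tagged t *m (tagged t)^t*)).
    elim: r => [|t r ih]; last by rewrite !big_cons ampD amulDr ih.
    rewrite !big_nil; apply/matrixP => i j; rewrite amul_ampr mxE.
    by rewrite big1 // => k _; rewrite mxE scale0r.
  rewrite ampS big_seq [RHS]big_seq; apply: eq_bigr => t /hs[ht _].
  by rewrite ampM amulA -ht amulA.
apply/matrixP => k l; rewrite /Theta /fam_of mxE.
transitivity (f (U k l)); first by rewrite /U mxE.
rewrite UE !summxE.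
have term rho (T : 'M[C]_(irr_dim pi, irr_dim rho)) :
    amul (amp (GG N) T) (amul (irr_rep rho) (amp (GG N) (T^t*))) k l =
    \sum_(p : 'I_(irr_dim rho) * 'I_(irr_dim rho))
      (T k p.1 * (T^t*) p.2 l) *: irr_rep rho p.1 p.2.
  rewrite amul_ampl -(pair_bigA _ (fun i j => (T k i * (T^t*) j l)
    *: irr_rep rho i j)) /=.
  apply: eq_bigr => i _; rewrite amul_ampr scaler_sumr; apply: eq_bigr => j _.
  by rewrite scalerA.
have fterm rho (T : 'M[C]_(irr_dim pi, irr_dim rho)) :
    coef_alg (GG N) (amul (amp (GG N) T)
      (amul (irr_rep rho) (amp (GG N) (T^t*))) k l) /\
    f (amul (amp (GG N) T) (amul (irr_rep rho) (amp (GG N) (T^t*))) k l) =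
    (T *m x rho *m T^t*) k l.
  rewrite term.
  have [h1 h2] := fsum _ (index_enum _) (fun p => T k p.1 * (T^t*) p.2 l)
    (fun p => irr_rep rho p.1 p.2) (fun p => co rho p.1 p.2).
  split=> //; rewrite h2 -fx /fam_of -mulmxA mxE.
  rewrite -(pair_bigA _ (fun i j => T k i * (T^t*) j l *
    f (irr_rep rho i j))) /=.
  apply: eq_bigr => i _; rewrite mxE mulr_sumr; apply: eq_bigr => j _.
  have -> : map_mx f (irr_rep rho) i j = f (irr_rep rho i j) by rewrite mxE.
  by rewrite -mulrA [_^t* _ _ * _]mulrC.
have := @fsum _ s (fun=> 1) (fun t => amul (amp (GG N) (tagged t))
  (amul (irr_rep (tag t)) (amp (GG N) ((tagged t)^t*))) k l)
  (fun t => (fterm _ (tagged t)).1).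
under eq_bigr do rewrite scale1r.
by case=> _ ->; apply: eq_bigr => t _; rewrite mul1r (fterm _ (tagged t)).2.
Qed.

Local Opaque Theta tau_hat Wstar Wnorm opnorm.

(** At pi the image acts blockwise along an orthogonal decomposition. Pairing with w = M v and
    Cauchy-Schwarz over the blocks bound its norm by [Wnorm x]. *)
Lemma Wstar_Theta N (x : dualU (GG N)) : Wstar x -> Wstar (Theta x).
Proof.
move=> hx; apply/WstarP; exists (Wnorm x) => pi.
have [s [_ sum1 ->//]] := Theta_decomp pi.
apply: opnorm_le => [|v]; first exact: Wnorm_ge0.
set M := \sum_(t <- s) _; set w := M *m v.
have sumsq (u : 'cV[C]_(irr_dim pi)) :
    \sum_(t <- s) l2norm ((tagged t)^t* *m u) ^+ 2 = l2norm u ^+ 2.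
  apply: complexI; rewrite -l2norm_sq rmorph_sum /=.
  have -> : u^t* *m u = u^t* *m (1%:M *m u) by rewrite mul1mx.
  rewrite -sum1 mulmx_suml mulmx_sumr summxE.
  apply: eq_bigr => t _; rewrite -l2norm_sq; congr (_ 0 0).
  by rewrite ctM trmxCK !mulmxA.
have [w0|w0] := eqVneq (l2norm w) 0.
  by rewrite w0 mulr_ge0 ?Wnorm_ge0 ?l2norm_ge0.
have wp : 0 < l2norm w by rewrite lt_neqAle eq_sym w0 l2norm_ge0.
rewrite -(ler_pM2r wp) -expr2.
have -> : l2norm w ^+ 2 = nrm ((w^t* *m w) 0 0 : C^o).
  by rewrite l2norm_sq nrm_real ger0_norm ?sqr_ge0.
rewrite {2}/w /M mulmx_suml mulmx_sumr summxE.
apply: le_trans (nrm_sum _ _ _) _.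
pose a (t : {rho : irr (GG N) & 'M[C]_(irr_dim pi, irr_dim rho)}) :=
  l2norm ((tagged t)^t* *m w).
pose b (t : {rho : irr (GG N) & 'M[C]_(irr_dim pi, irr_dim rho)}) :=
  l2norm ((tagged t)^t* *m v).
apply: (@le_trans _ _ (\sum_(t <- s) Wnorm x * (a t * b t))).
  apply: ler_sum => t _.
  have -> : w^t* *m (tagged t *m x (tag t) *m (tagged t)^t* *m v) =
      ((tagged t)^t* *m w)^t* *m (x (tag t) *m ((tagged t)^t* *m v)).
    by rewrite (ctM ((tagged t)^t*)) trmxCK !mulmxA.
  rewrite (le_trans (dot_cauchy_schwarz _ _)) // -/(a t) mulrCA.
  rewrite ler_wpM2l ?l2norm_ge0 // (le_trans (opnormP _ _)) // -/(b t).
  by rewrite ler_wpM2r ?l2norm_ge0 // opnorm_le_Wnorm.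
rewrite -mulr_sumr -mulrA ler_wpM2l ?Wnorm_ge0 //.
rewrite -ler_sqr ?nnegrE; first last.
- by rewrite mulr_ge0 ?l2norm_ge0.
- by apply: sumr_ge0 => t _; rewrite mulr_ge0 ?l2norm_ge0.
rewrite !(big_tnth _ _ s).
apply: le_trans (real_cauchy_schwarz _ _) _.
rewrite exprMn -!sumsq !(big_tnth _ _ s) mulrC //.
Qed.

(** Read off in the inductive limit: [iota_lim] respects the operations, is injective on bounded
    families and takes the same value at x and [Theta x]. The same argument gives linearity and the
    adjoint. *)
Lemma Theta_mul N (x y : dualU (GG N)) : Wstar x -> Wstar y ->
  Theta (fun pi => x pi *m y pi) = fun pi => Theta x pi *m Theta y pi.
Proof.
move=> hx hy; apply: iota_inj.
- exact/Wstar_Theta/Wstar_mul.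
- by apply: Wstar_mul; exact: Wstar_Theta.
have Tx := Wstar_Theta hx; have Ty := Wstar_Theta hy.
rewrite (iota_Theta B (Wstar_mul hx hy)) (iota_mul B hx hy) (iota_mul B Tx Ty).
by rewrite (iota_Theta B hx) (iota_Theta B hy).
Qed.

Lemma Theta_lin N c (x y : dualU (GG N)) : Wstar x -> Wstar y ->
  Theta (fun pi => c *: x pi + y pi) = fun pi => c *: Theta x pi + Theta y pi.
Proof.
move=> hx hy; apply: iota_inj.
- exact/Wstar_Theta/Wstar_lin.
- by apply: Wstar_lin; exact: Wstar_Theta.
have Tx := Wstar_Theta hx; have Ty := Wstar_Theta hy.
rewrite (iota_Theta B (Wstar_lin c hx hy)) (iota_linear B c hx hy).
by rewrite (iota_linear B c Tx Ty) (iota_Theta B hx) (iota_Theta B hy).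
Qed.

Lemma Theta_star N (x : dualU (GG N)) : Wstar x ->
  Theta (fun pi => (x pi)^t*) = fun pi => (Theta x pi)^t*.
Proof.
move=> hx; apply: iota_inj.
- exact/Wstar_Theta/Wstar_adj.
- by apply: Wstar_adj; exact: Wstar_Theta.
have Tx := Wstar_Theta hx.
rewrite (iota_Theta B (Wstar_adj hx)) (iota_star B hx) (iota_star B Tx).
by rewrite (iota_Theta B hx).
Qed.

Variables (tau : R -> B -> B).
Hypothesis htau : induced_flow tau.

Lemma tau_iota t N (x : dualU (GG N)) : Wstar x -> tau t (io x) = io (tau_hat t x).
Proof. by have [_] := htau t; apply. Qed.

Lemma eigen_tau N a (x : dualU (GG N)) : Wstar x ->
  (forall t, tau t (io x) = cis (t * a) *: io x) <-> eigen a x.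
Proof.
move=> hx.
have iZ t : cis (t * a) *: io x = io (fun pi => cis (t * a) *: x pi + 0).
  by rewrite (iota_linear B _ hx (Wstar0 (GG N))) iota0 addr0.
have hW t : Wstar (fun pi => cis (t * a) *: x pi + 0).
  exact: Wstar_lin hx (Wstar0 _).
split=> [h t pi|h t].
  have := h t; rewrite (tau_iota _ hx) iZ => /iota_inj.
  move=> /(_ (Wstar_tau_hat _ hx) (hW t)) => /(congr1 (fun f => f pi)) ->.
  by rewrite addr0.
rewrite (tau_iota _ hx) iZ; congr (io _); apply: fam_ext => pi.
by rewrite h addr0.
Qed.

Lemma eigen_Theta N a (x : dualU (GG N)) : Wstar x -> eigen a x ->
  eigen a (Theta x).
Proof.
move=> hx /(eigen_tau _ hx) e; apply/eigen_tau; first exact: Wstar_Theta.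
by rewrite (iota_Theta B hx).
Qed.

(* [chi_pi \o Theta] restricted to the block of [rho] satisfies the KMS
   condition, hence is a multiple of [chi_rho]. *)
Lemma cotransition_ex N (pi : irr (GG N.+1)) :
  exists p : seq (irr (GG N)) * (irr (GG N) -> R),
  [/\ forall rho, 0 <= p.2 rho,
      \sum_(rho <- p.1) p.2 rho = 1,
      forall rho, rho \in p.1 -> prec rho pi
    & forall x, Wstar x -> chi_irr pi (Theta x) =
        \sum_(rho <- p.1) (p.2 rho)%:C%C * chi_irr rho x].
Proof.
have [s [hprec sum1 dec]] := Theta_decomp pi.
pose s0 := undup (map tag s).
pose phi rho (z : 'M[C]_(irr_dim rho)) := chi_irr pi (Theta (blk z)).
have phi_lin rho c u v : phi rho (c *: u + v) = c * phi rho u + phi rho v.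
  rewrite /phi -chi_irr_lin -(Theta_lin c (Wstar_blk _) (Wstar_blk _)).
  by congr (chi_irr pi (Theta _)); apply: fam_ext => k; rewrite blk_lin.
have phi_kms rho i j z : (expR (freq i j))%:C%C * phi rho (z *m munit i j) =
    phi rho (munit i j *m z).
  rewrite /phi; have e1 (u v : 'M[C]_(irr_dim rho)) :
      Theta (blk (u *m v)) = fun k => Theta (blk u) k *m Theta (blk v) k.
    rewrite -(Theta_mul (Wstar_blk _) (Wstar_blk _)).
    by congr Theta; apply: fam_ext => k; rewrite blkM.
  rewrite (e1 z (munit i j)) (e1 (munit i j) z).
  apply: (@chi_irr_kms _ _ _ _ (Theta (blk z))).
  exact: (eigen_Theta (Wstar_blk _) (eigen_munit _ _)).
have phiE rho := kms_functional (phi_lin rho) (phi_kms rho).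
pose lam rho := complex.Re (phi rho 1%:M).
(* The unit of a block is a projection, hence so is its image under [Theta], where [chi_irr] is
   nonnegative. *)
have phi1 rho : phi rho 1%:M = (lam rho)%:C%C /\ 0 <= lam rho.
  have : 0 <= phi rho 1%:M.
    have W := Wstar_blk (1%:M : 'M[C]_(irr_dim rho)).
    have h1 := Theta_mul (Wstar_adj W) W.
    have h0 : (fun k => (@blk _ _ rho 1%:M k)^t* *m @blk _ _ rho 1%:M k) =
        @blk _ _ rho 1%:M.
      by apply: fam_ext => k; rewrite -blk_adj -blkM ct1 mulmx1.
    by rewrite h0 (Theta_star W) in h1; rewrite /phi h1; exact: chi_irr_ge0.
  move=> h; have e : phi rho 1%:M = (lam rho)%:C%C by rewrite RRe_real // ger0_real.
  by split=> //; rewrite -ler0c -e.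
have main x : Wstar x -> chi_irr pi (Theta x) =
    \sum_(rho <- s0) (lam rho)%:C%C * chi_irr rho x.
  move=> hx.
  have Wsum (r : seq (irr (GG N))) :
      Wstar (fun k => \sum_(rho <- r) blk (x rho) k) /\
      chi_irr pi (Theta (fun k => \sum_(rho <- r) blk (x rho) k)) =
      \sum_(rho <- r) phi rho (x rho).
    elim: r => [|rho r [ih1 ih2]].
      have -> : (fun k => \sum_(rho <- [::]) blk (x rho) k) = fun=> 0.
        by apply: fam_ext => k; rewrite big_nil.
      split; first exact: Wstar0.
      rewrite big_nil /chi_irr dec; last exact: Wstar0.
      rewrite big1 ?mulmx0 ?linear0 ?mul0r // => t _.
      by rewrite mulmx0 mul0mx.
    have -> : (fun k => \sum_(rho0 <- rho :: r) blk (x rho0) k) =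
        fun k => 1 *: blk (x rho) k + \sum_(rho0 <- r) blk (x rho0) k.
      by apply: fam_ext => k; rewrite big_cons scale1r.
    split; first exact: (Wstar_lin 1 (Wstar_blk (x rho)) ih1).
    rewrite (Theta_lin 1 (Wstar_blk (x rho)) ih1) chi_irr_lin ih2 mul1r.
    by rewrite big_cons.
  have [W0 W1] := Wsum s0.
  (* [Theta x] at pi sees only the finitely many blocks of x listed in [s0], so x may be cut off to
     them. *)
  transitivity (chi_irr pi (Theta (fun k => \sum_(rho <- s0) blk (x rho) k))).
    rewrite /chi_irr; suff -> : Theta x pi =
        Theta (fun k => \sum_(rho <- s0) blk (x rho) k) pi by [].
    rewrite (dec _ hx) (dec _ W0) [LHS]big_seq [RHS]big_seq.
    apply: eq_bigr => t ts; suff <- : x (tag t) =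
        \sum_(rho <- s0) blk (x rho) (tag t) by [].
    rewrite (bigD1_seq (tag t)) ?undup_uniq //=; last first.
      by rewrite mem_undup map_f.
    by rewrite blkE big1 ?addr0 // => rho ne; rewrite blk_neq // eq_sym.
  rewrite W1; apply: eq_bigr => rho _; rewrite phiE (phi1 rho).1 //.
exists (s0, lam); split=> //=.
- by move=> rho; have [] := phi1 rho.
(* Evaluation at the unit, which [Theta] preserves and every [chi_irr] sends to 1. *)
- apply: complexI; rewrite rmorph_sum /= rmorph1.
  have := main _ (Wstar1 (GG N)).
  have -> : Theta (fun pi : irr (GG N) => 1%:M) = fun=> 1%:M.
    apply: iota_inj; [exact/Wstar_Theta/Wstar1|exact: Wstar1|].
    by rewrite (iota_Theta B (Wstar1 (GG N))) !iota_one.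
  rewrite (chi_irr_scalar pi (fun=> 1)) => ->; apply: eq_bigr => rho _.
  by rewrite (chi_irr_scalar rho (fun=> 1)) mulr1.
- by move=> rho; rewrite mem_undup => /mapP[t ts ->]; exact: hprec.
Qed.

End ThetaMap.

(** * The flow and its eigenvectors *)

Section CStarNorm.
Variable R : realType.
Local Notation C := R[i].

Lemma nrm_cmul (A : cstarAlgType R) (x y : A) : nrm (x ** y) <= nrm x * nrm y.
Proof. by rewrite -lecR rmorphM /= -!nrmE cnormM. Qed.

Lemma nrm_starM (A : cstarAlgType R) (x : A) :
  nrm (cstar x ** x) = nrm x ^+ 2.
Proof. by apply: complexI; rewrite rmorphXn /= -!nrmE cnorm_starM. Qed.

Lemma nrm_cstar (A : cstarAlgType R) (x : A) : nrm (cstar x) = nrm x.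
Proof.
have le (y : A) : nrm y <= nrm (cstar y).
  have [->|y0] := eqVneq (nrm y) 0; first exact: nrm_ge0.
  have yp : 0 < nrm y by rewrite lt_neqAle eq_sym y0 nrm_ge0.
  by rewrite -(ler_pM2r yp) -expr2 -nrm_starM nrm_cmul.
by apply/eqP; rewrite eq_le le andbT -{2}[x]cstarK le.
Qed.

Lemma closureP (V : normedModType C) (D : set V) x :
  closure D x <-> forall e : R, 0 < e -> exists2 y, D y & nrm (x - y) < e.
Proof.
split=> [cl e e0|h U].
  have /cl[y [Dy]] : nbhs x (ball x (e%:C)%C).
    by apply: nbhsx_ballx; rewrite ltcR.
  by rewrite -ball_normE /= nrmE ltcR => yx; exists y.
move=> /nbhs_ballP[d /= /lt0C[r r0 ->] dU]; have [y Dy yx] := h _ r0.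
exists y; split=> //; apply: dU.
by rewrite -ball_normE /= nrmE ltcR.
Qed.

Lemma geometric_limit (V : completeNormedModType C) (y : nat -> V) (K q : R) :
  0 <= q -> q < 1 ->
  (forall n k, nrm (y (n + k)%N - y n) <= K * q ^+ n) ->
  exists l, forall e : R, 0 < e ->
    exists n0, forall n, (n0 <= n)%N -> nrm (y n - l) < e.
Proof.
move=> q0 q1 hy.
have small e : 0 < e -> exists n0, forall n, (n0 <= n)%N -> K * q ^+ n < e.
  move=> e0; have : `|q| < 1 by rewrite ger0_norm.
  move=> /(cvg_geometric K)/cvgrPdist_lt/(_ _ e0)[n0 _ hn]; exists n0 => n /hn.
  by rewrite sub0r normrN /geometric /=; apply: le_lt_trans; exact: ler_norm.
have : cvg (y @ \oo).
  apply/cauchy_cvgP/cauchy_exP => _ /lt0C[e e0 ->].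
  have [n0 hn] := small _ e0; exists (y n0), n0 => // n /= n0n.
  rewrite -ball_normE /= nrmE ltcR nrmB -(subnKC n0n).
  exact: le_lt_trans (hy _ _) (hn n0 (leqnn _)).
move=> /cvg_ex[l /cvgrPdist_lt cl]; exists l => e e0.
have /cl[n0 _ hn] : 0 < (e%:C)%C by rewrite ltcR.
by exists n0 => n /hn; rewrite nrmE ltcR nrmB.
Qed.

(* Fixed point of y = (h^2 + y^2) / 2, so that (1 - y)^2 = 1 - h^2. *)
Lemma hermitian_sqrt (A : cstarAlgType R) (h : A) :
  cstar h = h -> nrm h < 1 ->
  exists2 c : A, cstar c = c & h ** h + c ** c = cone.
Proof.
move=> hh h1; pose r := nrm h; have r0 : 0 <= r := nrm_ge0 _.
pose T (y : A) := (2^-1 : C) *: (h ** h + y ** y).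
pose y n := iter n T 0.
have n2 : nrm (2^-1 : C^o) = 2^-1.
  by rewrite nrmCV -[(2 : C)](rmorph_nat (real_complex R)) nrm_real ger0_norm.
have yr n : nrm (y n) <= r.
  elim: n => [|n ih]; first by rewrite nrm0.
  rewrite /= nrmZ n2 ler_pdivrMl // (le_trans (nrmD _ _)) //.
  have := nrm_cmul h h; have := nrm_cmul (y n) (y n).
  have : nrm (y n) * nrm (y n) <= r * r by rewrite ler_pM ?nrm_ge0.
  have : r * r <= 1 * r by rewrite ler_wpM2r // ltW.
  rewrite -/r; lra.
(* Since a^2 - b^2 = a (a - b) + (a - b) b, the map contracts by the factor r = |h| on the ball of
   radius r. *)
have TT (a b : A) : nrm a <= r -> nrm b <= r -> nrm (T a - T b) <= r * nrm (a - b).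
  move=> ar br; rewrite -scalerBr nrmZ n2 ler_pdivrMl //.
  have -> : h ** h + a ** a - (h ** h + b ** b) = a ** (a - b) + (a - b) ** b.
    rewrite cmulBr cmulBl opprD addrACA subrr add0r.
    by rewrite addrA subrK.
  rewrite (le_trans (nrmD _ _)) //.
  have := nrm_cmul a (a - b); have := nrm_cmul (a - b) b.
  have : nrm a * nrm (a - b) <= r * nrm (a - b) by rewrite ler_wpM2r ?nrm_ge0.
  have : nrm (a - b) * nrm b <= nrm (a - b) * r by rewrite ler_wpM2l ?nrm_ge0.
  lra.
have [l hl] : exists l, forall e : R, 0 < e ->
    exists n0, forall n, (n0 <= n)%N -> nrm (y n - l) < e.
  apply: (@geometric_limit _ _ (r + r) r) => // n k.
  elim: n => [|n ih].
    rewrite expr0 mulr1 (le_trans (nrmD _ _)) // nrmN lerD //.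
  rewrite addSn exprS mulrCA (le_trans (TT _ _ (yr _) (yr _))) //.
  by rewrite ler_wpM2l.
have lr : nrm l <= r.
  apply: nrm_le_lim => e /hl[n0 /(_ n0 (leqnn _))]; rewrite nrmB => lt.
  rewrite -[l](subrK (y n0)) (le_trans (nrmD _ _)) // addrC lerD //; exact: ltW.
have lT : l = T l.
  apply/eqP; rewrite -subr_eq0; apply/eqP/nrm0_eq0/eqP.
  rewrite eq_le nrm_ge0 andbT; apply/ler_addgt0Pr => e e0; rewrite add0r.
  have [n0 hn] := hl (e / 2) ltac:(by rewrite divr_gt0).
  have l1 := hn n0.+1 (leqnSn _); have l2 := hn n0 (leqnn _).
  rewrite (le_trans (nrm_tri (y n0.+1) _ _)) // nrmB.
  have := TT _ _ (yr n0) lr; rewrite -/(y n0.+1).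
  have : r * nrm (y n0 - l) <= 1 * nrm (y n0 - l).
    by rewrite ler_wpM2r ?nrm_ge0 // ltW.
  rewrite /= in l1 *; lra.
have yh n : cstar (y n) = y n.
  elim: n => [|n ih]; first exact: cstar0.
  rewrite /= cstarZ cstarD !cstarM hh ih; congr (_ *: _).
  by rewrite fmorphV rmorph_nat.
have lh : cstar l = l.
  apply/eqP; rewrite -subr_eq0; apply/eqP/nrm0_eq0/eqP.
  rewrite eq_le nrm_ge0 andbT; apply/ler_addgt0Pr => e e0; rewrite add0r.
  have [n0 /(_ n0 (leqnn _)) hn] := hl (e / 2) ltac:(by rewrite divr_gt0).
  rewrite (le_trans (nrm_tri (y n0) _ _)) // -{1}yh -cstarB nrm_cstar.
  by have := hn; rewrite nrmB => ?; lra.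
exists (cone - l); first by rewrite cstarB cstar1 lh.
rewrite cmulBl !cmulBr !cmul1l cmul1r.
have l2 : l + l = h ** h + l ** l.
  by rewrite {1 2}lT -scalerDl -mulr2n -[_ *+ 2]mulr_natl mulfV ?scale1r // pnatr_eq0.
have -> : h ** h = l + l - l ** l by rewrite l2 addrK.
have -> : cone - l - (l - l ** l) = cone - (l + l - l ** l).
  by rewrite -[cone - l - _]addrA -opprD addrA.
by rewrite subrKC.
Qed.

End CStarNorm.

(** * Contractivity of the flow and the algebra spanned by its eigenvectors *)

Section Flow.
Variables (R : realType) (GG : ind_system R) (B : ind_limit GG).
Local Notation C := R[i].
Local Notation io := (iota_lim B).
Local Opaque Theta tau_hat Wstar Wnorm opnorm.

Lemma iota_denseP (b : B) (e : R) : 0 < e ->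
  exists N (x : dualU (GG N)), Wstar x /\ nrm (b - io x) < e.
Proof.
move=> e0; have : closure [set z | exists N (x : dualU (GG N)),
    Wstar x /\ z = io x] b by rewrite iota_dense.
by move=> /closureP/(_ _ e0)[_ [N [x [hx ->]]] lt]; exists N, x.
Qed.

Lemma iota_lift K n (x : dualU (GG K)) : (K <= n)%N -> Wstar x ->
  exists2 y : dualU (GG n), Wstar y & io y = io x.
Proof.
move=> /subnKC <-; elim: (n - K)%N => [|m ih] hx; first by rewrite addn0; exists x.
have [y hy yx] := ih hx; rewrite addnS; exists (Theta y).
  exact: (@Wstar_Theta _ _ B).
by rewrite (iota_Theta B hy).
Qed.

Lemma iota_herm (b : B) (e : R) : cstar b = b -> 0 < e ->
  exists N (x : dualU (GG N)), [/\ Wstar x, forall pi, (x pi)^t* = x pi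
    & nrm (b - io x) < e].
Proof.
move=> bh e0; have [N [x [hx xb]]] := iota_denseP b e0.
have hs := Wstar_adj hx; have hz := Wstar0 (GG N).
pose y : dualU (GG N) := fun pi => 2^-1 *: (x pi) + 2^-1 *: (x pi)^t*.
have c2 : (2^-1 : C)^* = 2^-1 by rewrite fmorphV rmorph_nat.
have ye : io y = 2^-1 *: io x + 2^-1 *: cstar (io x).
  rewrite -(iota_star B hx) /y.
  have := iota_linear B 2^-1 hx (Wstar_lin 2^-1 hs hz).
  rewrite (iota_linear B 2^-1 hs hz) iota0 addr0 => <-; congr (io _).
  by apply: fam_ext => pi; rewrite addr0.
exists N, y; split.
- have := Wstar_lin 2^-1 hx (Wstar_lin 2^-1 hs hz).
  congr Wstar; apply: fam_ext => pi; by rewrite addr0.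
- by move=> pi; rewrite /y ctD !ctZ trmxCK c2 addrC.
have half (z : B) : z = 2^-1 *: z + 2^-1 *: z.
  by rewrite -scalerDl -mulr2n -[_ *+ 2]mulr_natl mulfV ?scale1r // pnatr_eq0.
have -> : b - io y = 2^-1 *: (b - io x) + 2^-1 *: cstar (b - io x).
  rewrite ye cstarB bh !scalerBr addrACA -half opprD //.
rewrite (le_lt_trans (nrmD _ _)) // !nrmZ nrm_cstar -mulrDl.
rewrite nrmCV -[(2 : C)](rmorph_nat (real_complex R)) nrm_real ger0_norm //.
by rewrite -mulr2n -[_ *+ 2]mulr_natl mulfV ?mul1r // pnatr_eq0.
Qed.

Lemma nrm_cmul_approx (A : cstarAlgType R) (a b : A) (e : R) :
  nrm (a - b) <= e -> nrm (a ** a - b ** b) <= e * (2 * nrm a + e).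
Proof.
move=> ab; have e0 : 0 <= e := le_trans (nrm_ge0 _) ab.
have -> : a ** a - b ** b = a ** (a - b) + (a - b) ** b.
  by rewrite cmulBr cmulBl addrA subrK.
rewrite (le_trans (nrmD _ _)) //.
have hb : nrm b <= nrm a + e.
  rewrite -[b](subrK a) (le_trans (nrmD _ _)) // addrC nrmB lerD //.
have h1 := nrm_cmul a (a - b); have h2 := nrm_cmul (a - b) b.
have h3 : nrm a * nrm (a - b) <= nrm a * e by rewrite ler_wpM2l ?nrm_ge0.
have h4 : nrm (a - b) * nrm b <= e * (nrm a + e) by rewrite ler_pM ?nrm_ge0.
lra.
Qed.

(** Instead of spectral theory in B, both elements are approximated by hermitian families at a
    common level, where [opnorm_of_sum_squares] applies in each block. *)
Lemma sum_squares_le1 (u d : B) : cstar u = u -> cstar d = d ->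
  u ** u + d ** d = cone -> nrm u <= 1.
Proof.
move=> uh dh ud.
have key e : 0 < e -> e <= 1 ->
    nrm u ^+ 2 <= 1 + e * (4 * nrm u + 2 * nrm d + 5).
  move=> e0 e1.
  have [N1 [x1 [W1 h1 l1]]] := iota_herm uh e0.
  have [N2 [x2 [W2 h2 l2]]] := iota_herm dh e0.
  pose n := maxn N1 N2.
  have lift_herm K (x : dualU (GG K)) : (K <= n)%N -> Wstar x ->
      (forall pi, (x pi)^t* = x pi) ->
      exists2 y : dualU (GG n), Wstar y & io y = io x /\
        forall pi, (y pi)^t* = y pi.
    move=> Kn hx hh; have [y hy yx] := iota_lift Kn hx; exists y => //.
    split=> // pi; suff : (fun pi => (y pi)^t*) = y by move/(congr1 (fun f => f pi)).
    apply: (iota_inj (B := B) (Wstar_adj hy) hy).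
    rewrite (iota_star B hy) yx -(iota_star B hx); congr (io _).
    exact: fam_ext.
  have [X hX [X1 Xh]] := lift_herm _ x1 (leq_maxl _ _) W1 h1.
  have [Z hZ [Z1 Zh]] := lift_herm _ x2 (leq_maxr _ _) W2 h2.
  rewrite -X1 in l1; rewrite -Z1 in l2.
  have a1 := nrm_cmul_approx (ltW l1); have a2 := nrm_cmul_approx (ltW l2).
  (* Bound for the defect 1 - X^2 - Z^2 of the approximants. *)
  pose eta := e * (2 * nrm u + e) + e * (2 * nrm d + e).
  have eta0 : 0 <= eta.
    by rewrite addr_ge0 // mulr_ge0 ?addr_ge0 ?mulr_ge0 ?nrm_ge0 // ltW.
  pose E : dualU (GG n) := fun pi => 1%:M - X pi *m X pi - Z pi *m Z pi.
  have EE : E = fun pi => -1 *: (Z pi *m Z pi) + (-1 *: (X pi *m X pi) + 1%:M).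
    by apply: fam_ext => pi; rewrite /E !scaleN1r addrC [- _ + 1%:M]addrC.
  have XX := Wstar_mul hX hX; have ZZ := Wstar_mul hZ hZ.
  have W3 := Wstar_lin (-1) XX (Wstar1 (GG n)).
  have hE : Wstar E by rewrite EE; exact: Wstar_lin.
  have iE : io E = cone - io X ** io X - io Z ** io Z.
    rewrite EE (iota_linear B _ ZZ W3) (iota_linear B _ XX (Wstar1 (GG n))).
    rewrite iota_one (iota_mul B hX hX) (iota_mul B hZ hZ) !scaleN1r.
    by rewrite addrC [- _ + cone]addrC.
  have nE : nrm (io E) <= eta.
    have -> : io E = (u ** u - io X ** io X) + (d ** d - io Z ** io Z).
      by rewrite iE -ud [RHS]addrACA !addrA.
    by rewrite (le_trans (nrmD _ _)) // lerD.
  have nX : nrm (io X) ^+ 2 <= 1 + eta.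
    have he : 0 <= 1 + eta by apply: addr_ge0.
    rewrite (nrm_iota B hX).
    suff : Wnorm X <= Num.sqrt (1 + eta).
      by rewrite -ler_sqr ?nnegrE ?Wnorm_ge0 ?sqrtr_ge0 // (sqr_sqrtr he).
    apply: Wnorm_le => [|pi]; first exact: sqrtr_ge0.
    rewrite -ler_sqr ?nnegrE ?opnorm_ge0 ?sqrtr_ge0 // (sqr_sqrtr he).
    apply: (opnorm_of_sum_squares eta0 (Xh pi) (Zh pi)).
    rewrite -/(E pi) (le_trans _ nE) // (nrm_iota B hE).
    exact: opnorm_le_Wnorm.
  have u1 : nrm u <= nrm (io X) + e.
    by rewrite -{1}[u](subrK (io X)) addrC (le_trans (nrmD _ _)) // lerD // ltW.
  have u2 : nrm (io X) <= nrm u + e.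
    rewrite -[io X](subrK u) (le_trans (nrmD _ _)) // addrC nrmB lerD // ltW //.
  have u0 := nrm_ge0 u; have d0 := nrm_ge0 d; have X0 := nrm_ge0 (io X).
  rewrite /eta in nX.
  have : nrm u ^+ 2 <= (nrm (io X) + e) ^+ 2.
    by apply: lerXn2r => //; rewrite nnegrE addr_ge0 // ltW.
  have : e * nrm (io X) <= e * (nrm u + e) by rewrite ler_wpM2l // ltW.
  have : e * e <= e * 1 by rewrite ler_wpM2l // ltW.
  nra.
have u0 := nrm_ge0 u; have d0 := nrm_ge0 d.
have : nrm u ^+ 2 <= 1.
  apply/ler_addgt0Pr => e e0.
  pose M := 4 * nrm u + 2 * nrm d + 5.
  have M0 : 0 < M by rewrite /M; lra.
  have e'0 : 0 < Num.min 1 (e / M) by rewrite lt_min ltr01 divr_gt0.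
  have e'1 : Num.min 1 (e / M) <= 1 by rewrite ge_min lexx.
  rewrite (le_trans (key _ e'0 e'1)) // lerD2l -ler_pdivlMr // -/M.
  by rewrite ge_min lexx orbT.
by rewrite expr_le1.
Qed.

(** For hermitian h with |h| < 1, choose a hermitian c with h^2 + c^2 = 1; the relation is preserved
    by f, so |f h| <= 1. Scaling and the C*-identity give the general case. *)
Lemma star_hom_contractive (f : B -> B) (b : B) : star_hom f -> nrm (f b) <= nrm b.
Proof.
move=> hf.
have herm1 (h : B) : cstar h = h -> nrm h < 1 -> nrm (f h) <= 1.
  move=> hh h1; have [c ch hc] := hermitian_sqrt hh h1.
  apply: (@sum_squares_le1 (f h) (f c)).
  - by rewrite -(star_hom_star hf) hh.
  - by rewrite -(star_hom_star hf) ch.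
  - by rewrite -!(star_homM hf) -(star_homD hf) hc (star_hom1 hf).
have herm (h : B) : cstar h = h -> nrm (f h) <= nrm h.
  move=> hh; apply/ler_addgt0Pr => e e0.
  have s0 : 0 < nrm h + e by rewrite ltr_wpDl ?nrm_ge0.
  have ns : nrm (((nrm h + e)^-1)%:C%C : C^o) = (nrm h + e)^-1.
    by rewrite nrm_real gtr0_norm ?invr_gt0.
  have := herm1 (((nrm h + e)^-1)%:C%C *: h).
  rewrite cstarZ hh (star_homZ hf) !nrmZ ns => le1.
  rewrite -[leRHS]mulr1 -ler_pdivrMl //; apply: le1.
    by congr (_ *: _); apply/eqP; rewrite eq_complex /= oppr0 !eqxx.
  by rewrite mulrC ltr_pdivrMr // mul1r ltrDl.
rewrite -ler_sqr ?nnegrE ?nrm_ge0 // -!nrm_starM -(star_hom_star hf).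
by rewrite -(star_homM hf) herm // cstarM cstarK.
Qed.

Variables (tau : R -> B -> B).
Hypothesis htau : induced_flow tau.

Lemma tau_hom t : star_hom (tau t).
Proof. by have [] := htau t. Qed.

Lemma nrm_tau t b : nrm (tau t b) <= nrm b.
Proof. exact/star_hom_contractive/tau_hom. Qed.

Lemma tau_add s t b : tau s (tau t b) = tau (s + t) b.
Proof.
apply/eqP; rewrite -subr_eq0; apply/eqP/nrm0_eq0/eqP.
rewrite eq_le nrm_ge0 andbT; apply/ler_addgt0Pr => e e0; rewrite add0r.
have e2 : 0 < e / 2 by rewrite divr_gt0.
have [N [x [hx le]]] := iota_denseP b e2.
rewrite (le_trans (nrm_tri (tau (s + t) (io x)) _ _)) //.
have -> : tau (s + t) (io x) = tau s (tau t (io x)).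
  rewrite !(tau_iota htau _ hx) (tau_iota htau _ (Wstar_tau_hat _ hx)).
  by rewrite tau_hatD.
rewrite -(star_homB (tau_hom s)) -(star_homB (tau_hom t)).
rewrite [tau s (tau t (io x))](_ : _ = tau (s + t) (io x)); last first.
  rewrite !(tau_iota htau _ hx) (tau_iota htau _ (Wstar_tau_hat _ hx)).
  by rewrite tau_hatD.
rewrite -(star_homB (tau_hom (s + t))).
have := nrm_tau s (tau t (b - io x)); have := nrm_tau t (b - io x).
by have := nrm_tau (s + t) (io x - b); rewrite [nrm (io x - b)]nrmB; lra.
Qed.

Lemma tau0 b : tau 0 b = b.
Proof.
apply/eqP; rewrite -subr_eq0; apply/eqP/nrm0_eq0/eqP.
rewrite eq_le nrm_ge0 andbT; apply/ler_addgt0Pr => e e0; rewrite add0r.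
have e2 : 0 < e / 2 by rewrite divr_gt0.
have [N [x [hx le]]] := iota_denseP b e2.
rewrite (le_trans (nrm_tri (io x) _ _)) //.
have h : tau 0 (io x) = io x by rewrite (tau_iota htau _ hx) tau_hat0.
rewrite -{1}h -(star_homB (tau_hom 0)).
by have := nrm_tau 0 (b - io x); rewrite [nrm (io x - b)]nrmB; lra.
Qed.

(** Elements with explicit entire orbits; their span is the dense algebra used to verify the KMS
    condition of constructed states. *)
Definition eigen_set : set B := [set b | exists N (x : dualU (GG N)) a,
  [/\ CG x, b = io x & eigen a x]].

Definition eigen_span : set B := lspan eigen_set.

Lemma lspan_subspace (V : normedModType C) (E : set V) : lin_subspace (lspan E).
Proof.
split; first by move=> S [[]].
move=> c x y hx hy S hS; have [[_ Sl] _] := hS.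
by apply: Sl; [exact: hx|exact: hy].
Qed.

Lemma lspan_ind (V : normedModType C) (E P : set V) :
  lin_subspace P -> E `<=` P -> lspan E `<=` P.
Proof. by move=> hP EP; apply: smallest_sub. Qed.

Lemma sub_lspan (V : normedModType C) (E : set V) : E `<=` lspan E.
Proof. exact: sub_gen_smallest. Qed.

(** A finitely supported family may lose finite support when lifted to a higher level, but its
    product with a finitely supported family of that level is finitely supported. Frequencies
    add. *)
Lemma eigen_setM a b : eigen_set a -> eigen_set b -> eigen_set (a ** b).
Proof.
move=> [K [x [p [cx -> ex]]]] [J [y [q [cy -> ey]]]].
have hx := CG_Wstar cx; have hy := CG_Wstar cy.
have [KJ|JK] := leqP K J.
  have [z hz zx] := iota_lift KJ hx.
  exists J, (fun pi => z pi *m y pi), (p + q); split; first exact: CG_mull.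
    by rewrite (iota_mul B hz hy) zx.
  apply/(eigen_tau htau); first exact: Wstar_mul.
  move=> t; rewrite (iota_mul B hz hy) (star_homM (tau_hom t)) zx.
  have /(eigen_tau htau _ hx) -> := ex; have /(eigen_tau htau _ hy) -> := ey.
  by rewrite cmulZl cmulZr scalerA mulrDr cisD.
have [z hz zy] := iota_lift (ltnW JK) hy.
exists K, (fun pi => x pi *m z pi), (p + q); split.
- by apply: sub_finite_set cx => pi /=; apply: contraNN => /eqP ->; rewrite mul0mx.
- by rewrite (iota_mul B hx hz) zy.
apply/(eigen_tau htau); first exact: Wstar_mul.
move=> t; rewrite (iota_mul B hx hz) (star_homM (tau_hom t)) zy.
have /(eigen_tau htau _ hx) -> := ex; have /(eigen_tau htau _ hy) -> := ey.
by rewrite cmulZl cmulZr scalerA mulrDr cisD.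
Qed.

Lemma eigen_set_star a : eigen_set a -> eigen_set (cstar a).
Proof.
move=> [K [x [p [cx -> ex]]]]; have hx := CG_Wstar cx.
exists K, (fun pi => (x pi)^t*), (- p); split; first exact: CG_adj.
  by rewrite (iota_star B hx).
apply/(eigen_tau htau); first exact: Wstar_adj.
move=> t; rewrite (iota_star B hx) (star_hom_star (tau_hom t)).
have /(eigen_tau htau _ hx) -> := ex.
by rewrite cstarZ -cisN mulrN.
Qed.

Lemma eigen_span_star_subalg : star_subalg eigen_span.
Proof.
have [D0 Dl] := lspan_subspace eigen_set.
split; first by [].
- have h1 a : eigen_set a -> forall b, eigen_span b -> eigen_span (a ** b).
    move=> ha; apply: (@lspan_ind _ eigen_set [set b | eigen_span (a ** b)]).
      split; first by rewrite /= cmul0r.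
      by move=> c u v /= hu hv; rewrite cmul_linearr; exact: Dl.
    by move=> b hb; apply: sub_lspan; exact: eigen_setM.
  move=> a b ha hb; move: a ha.
  apply: (@lspan_ind _ eigen_set [set a | eigen_span (a ** b)]).
    split; first by rewrite /= cmul0l.
    by move=> c u v /= hu hv; rewrite cmul_linearl; exact: Dl.
  by move=> a ha; exact: h1.
- apply: (@lspan_ind _ eigen_set [set a | eigen_span (cstar a)]).
    split; first by rewrite /= cstar0.
    by move=> c u v /= hu hv; rewrite cstar_antilinear; exact: Dl.
  by move=> a ha; apply: sub_lspan; exact: eigen_set_star.
Qed.

Lemma eigen_span_tau t b : eigen_span b -> eigen_span (tau t b).
Proof.
have [D0 Dl] := lspan_subspace eigen_set.
apply: (@lspan_ind _ eigen_set [set b | eigen_span (tau t b)]).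
  split; first by rewrite /= (star_hom0 (tau_hom t)).
  by move=> c u v /= hu hv; rewrite (star_hom_lin (tau_hom t)); exact: Dl.
move=> _ [K [x [p [cx -> ex]]]]; have hx := CG_Wstar cx.
have /(eigen_tau htau _ hx) h := ex; rewrite /= h.
have := Dl (cis (t * p)) (io x) 0; rewrite addr0; apply=> //.
by apply: sub_lspan; exists K, x, p.
Qed.

Lemma star_subalg_closure (A : cstarAlgType R) (D : set A) :
  star_subalg D -> cstar_subalg (closure D).
Proof.
move=> [[D0 Dl] Dm Ds]; split; last exact: closed_closure.
split.
- split; first exact: subset_closure.
  move=> c x y /closureP hx /closureP hy; apply/closureP => e e0.
  have c0 : 0 < 2 * (nrm (c : C^o) + 1).
    by rewrite mulr_gt0 // ltr_wpDl ?nrm_ge0.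
  have [x' Dx' lx] := hx (e / (2 * (nrm (c : C^o) + 1))) ltac:(by rewrite divr_gt0).
  have [y' Dy' ly] := hy (e / 2) ltac:(by rewrite divr_gt0).
  exists (c *: x' + y'); first exact: Dl.
  rewrite opprD addrACA -scalerBr (le_lt_trans (nrmD _ _)) // nrmZ.
  rewrite [ltRHS](_ : _ = e / 2 + e / 2); last by field.
  rewrite ler_ltD //.
  have : nrm (c : C^o) * nrm (x - x') <= (nrm (c : C^o) + 1) * nrm (x - x').
    by rewrite ler_wpM2r ?nrm_ge0 // lerDl.
  move: lx; rewrite invfM mulrA ltr_pdivlMr ?ltr_wpDl ?nrm_ge0 // mulrC.
  by move=> /ltW; lra.
- move=> x y /closureP hx /closureP hy; apply/closureP => e e0.
  pose M := nrm x + nrm y + 1.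
  have M0 : 0 < M by rewrite /M ltr_wpDl ?addr_ge0 ?nrm_ge0.
  pose d := Num.min 1 (e / (2 * M)).
  have d0 : 0 < d by rewrite lt_min ltr01 divr_gt0 // mulr_gt0.
  have d1 : d <= 1 by rewrite ge_min lexx.
  have d2 : 2 * M * d <= e.
    by rewrite mulrC -ler_pdivlMr ?mulr_gt0 // ge_min lexx orbT.
  have [x' Dx' lx] := hx _ d0; have [y' Dy' ly] := hy _ d0.
  exists (x' ** y'); first exact: Dm.
  have -> : x ** y - x' ** y' = (x - x') ** y + x' ** (y - y').
    by rewrite cmulBl cmulBr addrA subrK.
  have h1 := nrm_cmul (x - x') y; have h2 := nrm_cmul x' (y - y').
  have x'n : nrm x' <= nrm x + 1.
    rewrite -[x'](subrK x) (le_trans (nrmD _ _)) // addrC nrmB lerD2l.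
    by rewrite (le_trans (ltW lx)).
  have h3 : nrm (x - x') * nrm y <= d * nrm y by rewrite ler_wpM2r ?nrm_ge0 // ltW.
  have h4 : nrm x' * nrm (y - y') <= (nrm x + 1) * d.
    by rewrite ler_pM ?nrm_ge0 // ltW.
  rewrite (le_lt_trans (nrmD _ _)) //.
  have : 0 < M * d by rewrite mulr_gt0.
  rewrite /M in d2 *; nra.
- move=> x /closureP hx; apply/closureP => e /hx[y Dy lt].
  by exists (cstar y); [exact: Ds|rewrite -cstarB nrm_cstar].
Qed.

Lemma frakA_cstar_subalg : cstar_subalg (frakA B).
Proof.
split; last first.
  by apply: closed_bigI => S [[]].
split.
- split; first by move=> S [[[[]]]].
  move=> c x y hx hy S hS; have [[[[_ Sl] _ _] _] _] := hS.
  by apply: Sl; [exact: hx|exact: hy].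
- move=> x y hx hy S hS; have [[[_ Sm _] _] _] := hS.
  by apply: Sm; [exact: hx|exact: hy].
- move=> x hx S hS; have [[[_ _ Ss] _] _] := hS.
  by apply: Ss; exact: hx.
Qed.

Lemma frakA_Cstar N (x : dualU (GG N)) : Cstar x -> frakA B (io x).
Proof. by move=> hx; apply: sub_gen_smallest; exists N => //; exists x. Qed.

Lemma iota_sum N (s : seq (irr (GG N))) (F : irr (GG N) -> dualU (GG N)) :
  (forall rho, Wstar (F rho)) ->
  Wstar (fun pi => \sum_(rho <- s) F rho pi) /\
  io (fun pi => \sum_(rho <- s) F rho pi) = \sum_(rho <- s) io (F rho).
Proof.
move=> hF; elim: s => [|rho s [ih1 ih2]].
  rewrite big_nil (_ : (fun pi => _) = fun=> 0); last first.
    by apply: fam_ext => pi; rewrite big_nil.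
  by split; [exact: Wstar0|exact: iota0].
have e : (fun pi => \sum_(r <- rho :: s) F r pi) =
    fun pi => 1 *: F rho pi + \sum_(r <- s) F r pi.
  by apply: fam_ext => pi; rewrite big_cons scale1r.
rewrite e big_cons (iota_linear B 1 (hF rho) ih1) ih2 scale1r.
split; last by [].
exact: (Wstar_lin 1 (hF rho) ih1).
Qed.

Lemma eigen_span_blk N (rho : irr (GG N)) z : eigen_span (io (blk (z : 'M[C]_(irr_dim rho)))).
Proof.
have [D0 Dl] := lspan_subspace eigen_set.
have Dadd u v : eigen_span u -> eigen_span v -> eigen_span (u + v).
  by move=> hu hv; have := Dl 1 u v hu hv; rewrite scale1r.
have ioblk0 : io (blk (0 : 'M[C]_(irr_dim rho))) = 0.
  rewrite -[RHS](iota0 B N); congr (io _); apply: fam_ext => pi.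
  have [->|ne] := eqVneq pi rho; [by rewrite blkE|by rewrite blk_neq].
have blkD c (u v : 'M[C]_(irr_dim rho)) :
    io (blk (c *: u + v)) = c *: io (blk u) + io (blk v).
  rewrite -(iota_linear B c (Wstar_blk _) (Wstar_blk _)); congr (io _).
  by apply: fam_ext => pi; rewrite blk_lin.
have sumD (I : finType) (c : I -> C) (F : I -> 'M[C]_(irr_dim rho)) :
    (forall i, eigen_span (io (blk (F i)))) ->
    eigen_span (io (blk (\sum_i c i *: F i))).
  move=> hF; elim/big_rec : _ => [|i y _ hy]; first by rewrite ioblk0.
  by rewrite blkD; exact: (Dl _ _ _ (hF i) hy).
have sum1 (I : finType) (F : I -> 'M[C]_(irr_dim rho)) :
    (forall i, eigen_span (io (blk (F i)))) -> eigen_span (io (blk (\sum_i F i))).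
  by move=> hF; have := sumD I (fun=> 1) F hF; under eq_bigr do rewrite scale1r.
rewrite [z]munit_decomp; apply: sum1 => i; apply: sumD => j; apply: sub_lspan.
by exists N, (blk (munit i j)), (freq i j); split; [exact: CG_blk| |exact: eigen_munit].
Qed.

Lemma eigen_span_CG N (x : dualU (GG N)) : CG x -> eigen_span (io x).
Proof.
move=> /CG_decomp[s [_ ->]].
have [_ ->] := iota_sum s (fun rho => Wstar_blk (x rho)).
have [D0 Dl] := lspan_subspace eigen_set.
elim/big_rec : _ => [//|rho y _ hy].
by have := Dl 1 _ _ (eigen_span_blk (x rho)) hy; rewrite scale1r.
Qed.

Lemma eigen_span_frakA : eigen_span `<=` frakA B.
Proof.
have [[Sl _ _] _] := frakA_cstar_subalg.
apply: lspan_ind => // _ [N [x [a [cx -> _]]]].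
exact: (frakA_Cstar (CG_Cstar cx)).
Qed.

(** The closure is a C*-subalgebra and contains every generator, since matrix units span the
    finitely supported families. *)
Lemma frakA_closure : frakA B `<=` closure eigen_span.
Proof.
apply: smallest_sub; first exact/star_subalg_closure/eigen_span_star_subalg.
move=> _ [N _ [x [Wx hx] <-]]; apply/closureP => e e0.
have [y cy ly] := hx _ e0; exists (io y); first exact: eigen_span_CG.
have Wy := CG_Wstar cy.
have -> : io x - io y = io (fun pi => x pi - y pi).
  rewrite -[io x - io y]addrC -scaleN1r -(iota_linear B _ Wy Wx).
  by congr (io _); apply: fam_ext => pi; rewrite scaleN1r addrC.
have W : Wstar (fun pi => x pi - y pi).
  have := Wstar_lin (-1) Wy Wx; congr Wstar; apply: fam_ext => pi.
  by rewrite scaleN1r addrC.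
by rewrite (nrm_iota B W).
Qed.

Lemma frakA_tau t b : frakA B b -> frakA B (tau t b).
Proof.
have [_ clS] := frakA_cstar_subalg.
move=> /frakA_closure/closureP hb; apply: clS; apply/closureP => e /hb[d Dd lt].
exists (tau t d); first exact: (eigen_span_frakA (eigen_span_tau t Dd)).
by rewrite -(star_homB (tau_hom t)) (le_lt_trans (nrm_tau _ _)).
Qed.

End Flow.

(** * KMS states *)

Section TrivialLevel.
Variables (R : realType) (G : ucqg R).
Local Notation C := R[i].

Lemma amp_inj (A : cstarAlgType R) m n (S T : 'M[C]_(m, n)) :
  amp A S = amp A T -> S = T.
Proof.
move=> /matrixP ST; apply/matrixP => i j; have := ST i j; rewrite !mxE.
move/eqP; rewrite -subr_eq0 -scalerBl scaler_eq0 (negPf (@cone_neq0 _ A)) orbF.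
by rewrite subr_eq0 => /eqP.
Qed.

Hypothesis triv : trivial_cqg G.

(** With scalar coefficients the representation identity says that the matrix is idempotent, and it
    is invertible. *)
Lemma trivial_irr_rep (pi : irr G) : irr_rep pi = amp G 1%:M.
Proof.
have [[[[V [v1 _]] hrep] _] _] := irr_repP pi.
have scal n (W : 'M[G]_n) : exists w : 'M[C]_n, W = amp G w.
  pose w := \matrix_(i, j) projT1 (cid (triv (W i j))).
  by exists w; apply/matrixP => i j; rewrite !mxE; case: cid.
have [u uE] := scal _ (irr_rep pi); have [v vE] := scal _ V.
have uv : u *m v = 1%:M by apply: (@amp_inj G); rewrite ampM -uE -vE.
have uu : u = u *m u.
  apply: (@amp_inj (qalg2 G)).
  move/is_rep_matrix: hrep; rewrite uE (map_amp (@qdelta_hom _ G)).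
  rewrite (map_amp (@tinl_hom _ _ _ (qalg2 G))).
  by rewrite (map_amp (@tinr_hom _ _ _ (qalg2 G))) ampM.
rewrite uE; congr amp.
by rewrite -[u]mulmx1 -uv mulmxA -uu uv.
Qed.

Lemma trivial_irr_dim (pi : irr G) : irr_dim pi = 1%N.
Proof.
have [_ [d0 /seteqP[hM _]]] := irr_repP pi.
case E : (irr_dim pi) => [|[|n]] //; first by move: d0; rewrite E.
have i1 : (1 < irr_dim pi)%N by rewrite E.
pose i0 := Ordinal d0; pose j0 := Ordinal i1.
have [] := hM (delta_mx i0 i0).
  by rewrite /Mor /= trivial_irr_rep amul1l amul1r.
move=> c /matrixP h; have := h i0 i0; have := h j0 j0.
by rewrite !mxE !eqxx /= mulr1n => <- /eqP; rewrite mulr1n oner_eq0.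
Qed.

Lemma trivial_irr_eq (pi rho : irr G) : pi = rho.
Proof.
have one (k : irr G) (i j : 'I_(irr_dim k)) : i = j.
  by apply/val_inj; case: i j => i + [j +] /=; rewrite trivial_irr_dim;
    case: i => // _; case: j.
have iso (k l : irr G) :
    isometry_mx (const_mx 1 : 'M[C]_(irr_dim k, irr_dim l)).
  apply/matrixP => i j; rewrite !mxE (one l i j) eqxx.
  rewrite (eq_bigr (fun=> 1)) => [|m _]; last by rewrite !mxE rmorph1 mulr1.
  by rewrite sumr_const card_ord trivial_irr_dim.
apply: irr_inj; exists (const_mx 1).
  by rewrite /Mor /= !trivial_irr_rep amul1l amul1r.
split; first exact: iso.
have -> : (const_mx 1 : 'M[C]_(irr_dim rho, irr_dim pi))^t* = const_mx 1.
  by apply/matrixP => i j; rewrite !mxE rmorph1.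
exact: iso.
Qed.

(** At level 0 even the unit is finitely supported; this is what makes [frakA] unital. *)
Lemma trivial_CG (x : dualU G) : CG x.
Proof.
have [[pi _]|n0] := pselect (exists pi : irr G, True).
  apply: (@sub_finite_set _ _ [set pi]); last exact: finite_set1.
  by move=> rho _; exact: trivial_irr_eq.
apply: (@sub_finite_set _ _ set0); last exact: finite_set0.
by move=> rho _; apply: n0; exists rho.
Qed.

End TrivialLevel.

(** * Invariance and KMS identities of a quantized character *)

Section KMSStates.
Variables (R : realType) (GG : ind_system R) (B : ind_limit GG).
Variables (tau : R -> B -> B).
Hypothesis htau : induced_flow tau.
Hypothesis triv0 : trivial_cqg (GG 0%N).
Local Notation C := R[i].
Local Notation io := (iota_lim B).
Local Notation S := (frakA B).
Local Opaque Theta tau_hat Wstar Wnorm opnorm.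

Lemma frakA_lin c x y : S x -> S y -> S (c *: x + y).
Proof. by have [[[_ h] _ _] _] := frakA_cstar_subalg B; exact: h. Qed.

Lemma frakA0 : S 0.
Proof. by have [[[h _] _ _] _] := frakA_cstar_subalg B. Qed.

Lemma frakAM x y : S x -> S y -> S (x ** y).
Proof. by have [[_ h _] _] := frakA_cstar_subalg B; exact: h. Qed.

Lemma frakA_closed : closed S.
Proof. by have [_] := frakA_cstar_subalg B. Qed.

Lemma frakAZ c x : S x -> S (c *: x).
Proof. by move=> hx; rewrite -[_ *: _]addr0; apply: frakA_lin => //; exact: frakA0. Qed.

Lemma frakAD x y : S x -> S y -> S (x + y).
Proof. by move=> hx hy; rewrite -[x]scale1r; exact: frakA_lin. Qed.

Lemma frakAB x y : S x -> S y -> S (x - y).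
Proof. by move=> hx hy; rewrite addrC -scaleN1r; exact: frakA_lin. Qed.

Lemma frakA_CG N (x : dualU (GG N)) : CG x -> S (io x).
Proof. by move=> cx; exact: (frakA_Cstar (CG_Cstar cx)). Qed.

Lemma frakA1 : S cone.
Proof. by rewrite -(iota_one B 0%N); apply: frakA_CG; exact: (trivial_CG triv0). Qed.

(** Difference quotients lie in the closed subspace, hence so does the derivative; it is required
    because functionals are linear and bounded only on [frakA]. *)
Lemma frakA_of_vdiff (f : C -> B) z L : (forall z, S (f z)) ->
  (forall e : R, 0 < e -> exists2 d : R, 0 < d & forall h : C^o, nrm h < d ->
    nrm (f (z + h) - f z - h *: L) <= e * nrm h) -> S L.
Proof.
move=> Sf hL; apply: frakA_closed; apply/closureP => e e0.
have [d d0 hd] := hL (e / 2) ltac:(by rewrite divr_gt0).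
pose h : C^o := (d / 2)%:C%C.
have d20 : 0 < d / 2 by rewrite divr_gt0.
have hn : nrm h = d / 2 by rewrite nrm_real gtr0_norm.
have h0 : h != 0 by rewrite eq_complex /= negb_and gt_eqF.
exists (h^-1 *: (f (z + h) - f z)); first by apply: frakAZ; apply: frakAB; exact: Sf.
have : nrm h < d by rewrite hn ltr_pdivrMr // ltr_pMr // ltr1n.
move=> /hd; rewrite -nrmN opprB.
have -> : h *: L - (f (z + h) - f z) = h *: (L - h^-1 *: (f (z + h) - f z)).
  by rewrite scalerBr scalerA mulfV // scale1r.
rewrite nrmZ mulrC hn ler_pM2r // => le1.
by rewrite (le_lt_trans le1) // ltr_pdivrMr // ltr_pMr // ltr1n.
Qed.

Lemma vdiff_functional (L : B -> C) (K : R) (f : C -> B) z :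
  linear_on S L -> (forall b, S b -> nrm (L b : C^o) <= K * nrm b) ->
  (forall z, S (f z)) -> vdiff f z -> vdiff (fun z => L (f z) : C^o) z.
Proof.
move=> Llin LK Sf [M hM]; have SM := frakA_of_vdiff Sf hM.
exists (L M) => e e0.
have K0 : 0 < `|K| + 1 by rewrite ltr_wpDl.
have [d d0 hd] := hM (e / (`|K| + 1)) ltac:(by rewrite divr_gt0).
exists d => // h /hd le1.
have -> : L (f (z + h)) - L (f z) - h *: (L M : C^o) =
    L (- h *: M + (-1 *: f z + f (z + h))).
  rewrite !Llin //; last exact: frakA_lin.
  have aux (a b c k : C) : a - b - k * c = - k * c + (-1 * b + a) by ring.
  exact: aux.
have e1 : - h *: M + (-1 *: f z + f (z + h)) = f (z + h) - f z - h *: M.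
  by rewrite scaleNr scaleN1r addrC [- f z + _]addrC.
rewrite (le_trans (LK _ _)); [|by apply: frakA_lin => //; exact: frakA_lin|] => //.
rewrite e1 (le_trans (ler_wpM2r (nrm_ge0 _) (_ : K <= `|K| + 1))) //.
  by rewrite (le_trans (ler_norm _)) // lerDl.
by rewrite (le_trans (ler_wpM2l (ltW K0) le1)) // mulrA mulrCA mulfV ?mulr1 // lt0r_neq0.
Qed.

Lemma norm_on_bound (T : set B) (phi : B -> C) : lin_subspace T ->
  linear_on T phi -> norm_on T phi = 1 ->
  forall b, T b -> nrm (phi b : C^o) <= nrm b.
Proof.
move=> [T0 Tl] plin p1 b Tb.
have ps c x : T x -> phi (c *: x) = c * phi x.
  move=> Tx; have := plin c x 0 Tx T0; rewrite addr0 => ->.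
  have := plin (-1) 0 0 T0 T0; rewrite scaler0 addr0 mulN1r addNr => ->.
  by rewrite addr0.
(* [sup] is 0 when there is no supremum, so norm 1 implies that the set is bounded. *)
have hs : has_sup [set complex.Re `|phi x| | x in T `&` [set x | `|x| <= 1]].
  apply: contrapT => /sup_out s0; move: p1; rewrite /norm_on s0 => /esym/eqP.
  by rewrite oner_eq0.
have unit x : T x -> nrm x <= 1 -> nrm (phi x : C^o) <= 1.
  move=> Tx x1; rewrite -p1; apply: sup_upper_bound => //.
  by exists x => //; split => //=; rewrite nrmE lecR.
have [b0|b0] := eqVneq (nrm b) 0.
  by rewrite (nrm0_eq0 b0) -[0]/(0 : B) -(scale0r b) ps // mul0r nrm0 nrm_ge0.
have bp : 0 < nrm b by rewrite lt_neqAle eq_sym b0 nrm_ge0.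
have n1 : nrm ((nrm b)^-1%:C%C : C^o) = (nrm b)^-1.
  by rewrite nrm_real gtr0_norm ?invr_gt0.
have := unit ((nrm b)^-1%:C%C *: b).
rewrite nrmZ n1 mulVf // ps // nrmCM n1 => /(_ _ (lexx _)) h.
rewrite -[leRHS]mulr1 -ler_pdivrMl //; apply: h.
by have := Tl ((nrm b)^-1%:C%C) b 0 Tb T0; rewrite addr0.
Qed.

Variables (chi : B -> C).
Hypothesis hchi : Ch B tau chi.

Lemma chi_lin : linear_on S chi.
Proof. by have [[]] := hchi. Qed.

Lemma chi0 : chi 0 = 0.
Proof.
have := chi_lin (-1) frakA0 frakA0.
by rewrite scaler0 addr0 mulN1r addNr.
Qed.

Lemma chiZ c x : S x -> chi (c *: x) = c * chi x.
Proof. by move=> hx; rewrite -[c *: x]addr0 chi_lin ?chi0 ?addr0 //; exact: frakA0. Qed.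

Lemma chiD x y : S x -> S y -> chi (x + y) = chi x + chi y.
Proof. by move=> hx hy; have := chi_lin 1 hx hy; rewrite scale1r mul1r. Qed.

Lemma chiB x y : S x -> S y -> chi (x - y) = chi x - chi y.
Proof. by move=> hx hy; rewrite addrC -scaleN1r chi_lin // mulN1r addrC. Qed.

Lemma chi_pos x : S x -> 0 <= chi (cstar x ** x).
Proof. by have [[_ h _] _ _] := hchi; exact: h. Qed.

Lemma chi_le x : S x -> nrm (chi x : C^o) <= nrm x.
Proof.
have [[hl _ h1] _ _] := hchi; have [[hS _ _] _] := frakA_cstar_subalg B.
by move=> hx; exact: (norm_on_bound hS hl h1).
Qed.

Lemma chi_sum I (s : seq I) (F : I -> B) : (forall i, S (F i)) ->
  S (\sum_(i <- s) F i) /\ chi (\sum_(i <- s) F i) = \sum_(i <- s) chi (F i).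
Proof.
move=> hF; elim: s => [|i s [ih1 ih2]].
  by rewrite !big_nil chi0; split=> //; exact: frakA0.
by rewrite !big_cons chiD // ih2; split=> //; exact: frakAD.
Qed.

Lemma chi_mul_bound u b : S u -> S b -> nrm (chi (u ** b) : C^o) <= nrm u * nrm b.
Proof. by move=> hu hb; rewrite (le_trans (chi_le (frakAM hu hb))) // nrm_cmul. Qed.

Lemma chi_mul_lin u : S u -> linear_on S (fun b => chi (u ** b)).
Proof.
by move=> hu c x y hx hy; rewrite cmul_linearr chi_lin //; exact: frakAM.
Qed.

Lemma chi_tau_lin t : linear_on S (fun b => chi (tau t b)).
Proof.
move=> c x y hx hy; rewrite (star_hom_lin (tau_hom htau t)) chi_lin //.
  exact: frakA_tau.
exact: frakA_tau.
Qed.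

Lemma chi_tau_bound t b : S b -> nrm (chi (tau t b) : C^o) <= 1 * nrm b.
Proof.
move=> hb; rewrite mul1r (le_trans (chi_le (frakA_tau htau t hb))) //.
exact: nrm_tau.
Qed.

Lemma frakA_limit (D : set B) (L M : B -> C) (K : R) : S `<=` closure D ->
  D `<=` S -> linear_on S L -> linear_on S M ->
  (forall b, S b -> nrm (L b : C^o) <= K * nrm b) ->
  (forall b, S b -> nrm (M b : C^o) <= K * nrm b) ->
  (forall d, D d -> L d = M d) -> forall b, S b -> L b = M b.
Proof.
move=> SD DS Ll Ml LK MK LM b Sb.
apply/eqP; rewrite -subr_eq0; apply/eqP/(@nrm0_eq0 _ C^o)/eqP.
rewrite eq_le nrm_ge0 andbT; apply/ler_addgt0Pr => e e0; rewrite add0r.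
have K0 : 0 < `|K| + 1 by rewrite ltr_wpDl.
have /closureP/(_ (e / (2 * (`|K| + 1)))) := SD _ Sb.
case; first by rewrite divr_gt0 // mulr_gt0.
move=> d Dd lt; have Sd := DS _ Dd.
have e1 (N : B -> C) : linear_on S N -> N b = N (b - d) + N d.
  move=> Nl; have -> : N (b - d) = N (-1 *: d + b) by rewrite scaleN1r addrC.
  by rewrite Nl // mulN1r addrC addKr || (rewrite Nl // ; ring).
have -> : L b - M b = L (b - d) - M (b - d).
  by rewrite (e1 L Ll) (e1 M Ml) (LM d Dd) opprD addrACA subrr addr0.
have Sbd : S (b - d) by exact: frakAB.
rewrite (le_trans (nrmD _ _)) // nrmN.
have := LK _ Sbd; have := MK _ Sbd.
have : K * nrm (b - d) <= (`|K| + 1) * nrm (b - d).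
  by rewrite ler_wpM2r ?nrm_ge0 // (le_trans (ler_norm _)) // lerDl.
have : (`|K| + 1) * nrm (b - d) <= e / 2.
  move: (ltW lt); rewrite invfM mulrA ler_pdivlMr // mulrC; exact.
set n1 := nrm (L _ : C^o); set n2 := nrm (M _ : C^o); lra.
Qed.

(** Density extends the condition in x to all of [frakA], in particular to x = 1, which D may fail
    to contain; y stays in D, where entire orbits exist. *)
Lemma chi_kms_data : exists D : set B,
  [/\ D `<=` S, S `<=` closure D, (forall t y, D y -> D (tau t y))
    & forall y, D y -> exists2 f, entire_orbit S tau y f &
          forall x, S x -> chi (x ** f (Complex 0 (-1))) = chi (y ** x)].
Proof.
have [_ [D [_ DS SD Dt hD]] _] := hchi; exists D; split=> // y Dy.
have [f [f1 Sf f3] hf] := hD y Dy; exists f => //.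
have Sy := DS _ Dy.
apply: (@frakA_limit D (fun x => chi (x ** f (Complex 0 (-1))))
  (fun x => chi (y ** x)) (nrm (f (Complex 0 (-1))) + nrm y)) => //.
- move=> c u v hu hv; rewrite cmul_linearl chi_lin //; exact: frakAM.
- exact: chi_mul_lin.
- move=> b hb; rewrite (le_trans (chi_mul_bound hb (Sf _))) // mulrC.
  by rewrite ler_wpM2r ?nrm_ge0 // lerDl nrm_ge0.
- move=> b hb; rewrite (le_trans (chi_mul_bound Sy hb)) //.
  by rewrite ler_wpM2r ?nrm_ge0 // lerDr nrm_ge0.
Qed.

Lemma entire_orbit_vdiff y f : entire_orbit S tau y f -> forall z, vdiff f z.
Proof. by move=> [_ _ h] z; exact: derivable_vdiff (h z). Qed.

(* Taking y = 1 in the KMS condition makes z |-> chi(tau_z b) periodic of period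
   i; being entire and bounded on a strip it is constant by Liouville. *)
Lemma chi_invariant t b : S b -> chi (tau t b) = chi b.
Proof.
have [D [DS SD Dt hD]] := chi_kms_data.
move: b; apply: (@frakA_limit D (fun b => chi (tau t b)) chi 1) => //.
- exact: chi_tau_lin.
- exact: chi_lin.
- exact: chi_tau_bound.
- by move=> b hb; rewrite mul1r chi_le.
move=> y Dy; have [f of' hf] := hD y Dy; have [f1 Sf f3] := of'.
have df := entire_orbit_vdiff of'.
have chi_b b : S b -> nrm (chi b : C^o) <= 1 * nrm b by rewrite mul1r; exact: chi_le.
pose g (z : C) : C^o := chi (f z).
have dg : entire g.
  by move=> z; exact: (vdiff_functional chi_lin chi_b Sf (df z)).
(* Both sides are entire in z and agree on the real line by the group law of the flow. *)
have shift_f (s : R) z : g (z + s%:C%C) = chi (tau s (f z)).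
  apply/eqP; rewrite -subr_eq0; apply/eqP.
  move: z; apply: entire_zero => [z|r].
    apply: vdiffB; first exact: entire_shift.
    exact: (vdiff_functional (chi_tau_lin s) (chi_tau_bound s) Sf (df z)).
  by rewrite /g -rmorphD !f1 (tau_add htau) [s + r]addrC subrr.
have shift_y (s : R) : g (s%:C%C + Complex 0 (-1)) = g s%:C%C.
  have [fs ofs hfs] := hD _ (Dt s _ Dy); have [fs1 Sfs _] := ofs.
  have dfs := entire_orbit_vdiff ofs.
  have same z : (chi (fs z) : C^o) = g (z + s%:C%C).
    apply/eqP; rewrite -subr_eq0; apply/eqP.
    move: z; apply: entire_zero => [z|r].
      apply: vdiffB; last exact: entire_shift.
      exact: (vdiff_functional chi_lin chi_b Sfs (dfs z)).
    by rewrite /g -rmorphD fs1 f1 (tau_add htau) subrr.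
  rewrite addrC -same; have := hfs _ frakA1; rewrite cmul1l cmul1r => ->.
  by rewrite /g f1.
have period z : g (z + Complex 0 (-1)) = g z.
  apply/eqP; rewrite -subr_eq0; apply/eqP; move: z; apply: entire_zero => [z|r].
    by apply: vdiffB; [exact: entire_shift|exact: dg].
  by rewrite shift_y subrr.
have periodn n z : g (z + Complex 0 (- n%:R)) = g z.
  elim: n z => [|n ih] z; first by rewrite oppr0 addr0.
  have -> : z + Complex 0 (- n.+1%:R) =
      (z + Complex 0 (-1)) + Complex 0 (- n%:R) :> C.
    rewrite -addrA; congr (_ + _).
    by apply/eqP; rewrite eq_complex /= addr0 eqxx -natr1 opprD addrC eqxx.
  by rewrite ih period.
have m10 : -1 <= 0 :> R by rewrite lerN10.
have [K hK] := vdiff_bounded_imag m10 df.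
(* Horizontal translation is the flow, which is contractive, so a bound on the segment from -i to 0
   serves the whole strip. *)
have bd_strip (s u : R) : -1 <= u <= 0 -> nrm (g (Complex s u)) <= K.
  move=> hu; have -> : Complex s u = Complex 0 u + s%:C%C :> C.
    by apply/eqP; rewrite eq_complex /= add0r addr0 !eqxx.
  rewrite shift_f (le_trans (chi_tau_bound s (Sf _))) // mul1r; exact: hK.
have bd z : nrm (g z) <= K.
  case: z => s u; have [u0|u0] := leP 0 u.
    (* Lowering the imaginary part u by its integer part plus 1 moves it into [-1, 0). *)
    have /andP[h1 h2] := truncn_itv u0.
    rewrite -(periodn (Num.truncn u).+1).
    have -> : Complex s u + Complex 0 (- (Num.truncn u).+1%:R) =
        Complex s (u - (Num.truncn u).+1%:R) :> C.
      by apply/eqP; rewrite eq_complex /= addr0 !eqxx.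
    apply: bd_strip; move: h1 h2; rewrite -natr1; lra.
  have nu0 : 0 <= - u by rewrite oppr_ge0 ltW.
  have /andP[h1 h2] := truncn_itv nu0.
  rewrite -(periodn (Num.truncn (- u)) (Complex s u)) in h1 h2 *.
  have e1 : Complex s u = Complex s (u + (Num.truncn (- u))%:R) +
      Complex 0 (- (Num.truncn (- u))%:R) :> C.
    by apply/eqP; rewrite eq_complex /= addr0 addrK !eqxx.
  rewrite periodn e1 periodn.
  apply: bd_strip; move: h1 h2; rewrite -natr1; lra.
have := liouville dg bd t 0; rewrite /g !f1 (tau0 htau).
by [].
Qed.

(* Both sides of the identity extend to entire functions of the flow parameter
   of y which agree on the real line; evaluate them at -i. *)
Lemma kms_eigen a b y : S b -> (forall t, tau t b = cis (t * a) *: b) -> S y ->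
  (expR (- a))%:C%C * chi (b ** y) = chi (y ** b).
Proof.
move=> Sb eb; have [D [DS SD Dt hD]] := chi_kms_data.
move: y; apply: (@frakA_limit D (fun y => (expR (- a))%:C%C * chi (b ** y))
  (fun y => chi (y ** b)) (expR (- a) * nrm b + nrm b)) => //.
- by move=> c u v hu hv; rewrite (chi_mul_lin Sb) //; ring.
- by move=> c u v hu hv; rewrite cmul_linearl chi_lin //; exact: frakAM.
- move=> y hy; rewrite nrmCM nrm_real ger0_norm ?expR_ge0 //.
  rewrite (le_trans (ler_wpM2l (expR_ge0 _) (chi_mul_bound Sb hy))) //.
  by rewrite mulrA ler_wpM2r ?nrm_ge0 // lerDl nrm_ge0.
- move=> y hy; rewrite (le_trans (chi_mul_bound hy Sb)) // mulrC.
  by rewrite ler_wpM2r ?nrm_ge0 // lerDr mulr_ge0 ?nrm_ge0 ?expR_ge0.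
move=> y Dy; have Sy := DS _ Dy.
have [f of' hf] := hD y Dy; have [f1 Sf f3] := of'.
have df := entire_orbit_vdiff of'.
pose c : C^o := chi (b ** y).
pose h (z : C) : C^o := chi (b ** f z) - cexp (Complex 0 (- a) * z) * c.
have h0 : h (Complex 0 (-1)) = 0.
  apply: entire_zero => [z|t].
    apply: vdiffB.
      apply: (vdiff_functional (L := fun v => chi (b ** v)) (K := nrm b) (chi_mul_lin Sb)) => //.
      by move=> v hv; exact: chi_mul_bound.
    apply: vdiffM; [exact: vdiff_cexp_lin|exact: vdiff_cst].
  have Sty : S (tau t y) by exact: frakA_tau.
  (* By invariance the flow moves from y to b, where it is multiplication by e^(-ita). *)
  rewrite /h f1 -(chi_invariant (- t) (frakAM Sb Sty)).
  rewrite (star_homM (tau_hom htau _)) eb (tau_add htau) addNr (tau0 htau).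
  rewrite cmulZl (chiZ _ (frakAM Sb Sy)).
  have -> : Complex 0 (- a) * t%:C%C = Complex 0 (- t * a) :> C.
    by apply/eqP; rewrite eq_complex /=; apply/andP; split; apply/eqP; ring.
  by rewrite cexp_imag -/c subrr.
have := h0; rewrite /h hf //.
have -> : Complex 0 (- a) * Complex 0 (-1) = (- a)%:C%C :> C.
  by apply/eqP; rewrite eq_complex /=; apply/andP; split; apply/eqP; ring.
by rewrite cexp_real => /eqP; rewrite subr_eq0 => /eqP <-.
Qed.

Definition weight N (rho : irr (GG N)) : R :=
  complex.Re (chi (io (@blk _ _ rho 1%:M))).

Lemma chi_iota_blk N (rho : irr (GG N)) z :
  chi (io (@blk _ _ rho z)) = chi (io (@blk _ _ rho 1%:M)) *
    (\tr (irr_F rho *m z) / dim_q rho).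
Proof.
have Sblk u : S (io (@blk _ _ rho u)) by apply: frakA_CG; exact: CG_blk.
have blkMio u v : io (@blk _ _ rho (u *m v)) = io (blk u) ** io (blk v).
  rewrite -(iota_mul B (Wstar_blk _) (Wstar_blk _)); congr (io _).
  by apply: fam_ext => pi; rewrite blkM.
move: z; apply: (kms_functional (phi := fun z => chi (io (blk z)))).
  move=> c u v; rewrite -chi_lin //.
  rewrite -(iota_linear B c (Wstar_blk _) (Wstar_blk _)); congr (chi (io _)).
  by apply: fam_ext => pi; rewrite blk_lin.
move=> i j z; rewrite (blkMio z (munit i j)) (blkMio (munit i j) z).
have e1 := (eigen_tau htau (freq i j) (Wstar_blk (munit i j))).2
  (eigen_munit i j).
rewrite -(kms_eigen (Sblk _) e1 (Sblk z)) mulrA -rmorphM -expRD subrr expR0.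
by rewrite mul1r.
Qed.

Lemma chi_iota_proj N (x : dualU (GG N)) : Wstar x -> S (io x) ->
  (fun pi => (x pi)^t* *m x pi) = x -> 0 <= chi (io x).
Proof.
move=> hx Sx e; rewrite -{1}e (iota_mul B (Wstar_adj hx) hx) (iota_star B hx).
exact: chi_pos.
Qed.

Lemma weightE N (rho : irr (GG N)) :
  chi (io (@blk _ _ rho 1%:M)) = (weight rho)%:C%C /\ 0 <= weight rho.
Proof.
have : 0 <= chi (io (@blk _ _ rho 1%:M)).
  apply: chi_iota_proj; [exact: Wstar_blk|by apply: frakA_CG; exact: CG_blk|].
  by apply: fam_ext => pi; rewrite -blk_adj -blkM ct1 mulmx1.
move=> h; have e : chi (io (@blk _ _ rho 1%:M)) = (weight rho)%:C%C.
  by rewrite RRe_real // ger0_real.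
by split=> //; rewrite -ler0c -e.
Qed.

End KMSStates.

(** * Coherent families of means *)

Section Mean.
Variables (R : realType) (X : choiceType).
Implicit Types (f g h : X -> R) (E : (X -> R) -> R).

Definition bdd h := exists c : R, forall x, `|h x| <= c.

(** Expectation for a probability measure on a discrete set, as a positive normalized functional.
    The last clause excludes mass escaping to infinity. *)
Definition mean E :=
  [/\ forall c f g, bdd f -> bdd g ->
        E (fun x => c * f x + g x) = c * E f + E g,
      forall f, bdd f -> (forall x, 0 <= f x) -> 0 <= E f,
      E (fun=> 1) = 1
    & forall e : R, 0 < e -> exists s : seq X, E (fun x => (x \notin s)%:R) <= e].

Lemma bdd_cst c : bdd (fun=> c).
Proof. by exists `|c|. Qed.

Lemma bdd_lin c f g : bdd f -> bdd g -> bdd (fun x => c * f x + g x).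
Proof.
move=> [a ha] [b hb]; exists (`|c| * a + b) => x.
by rewrite (le_trans (ler_normD _ _)) // normrM lerD // ler_wpM2l.
Qed.

Lemma bddM f g : bdd f -> bdd g -> bdd (fun x => f x * g x).
Proof.
by move=> [a ha] [b hb]; exists (a * b) => x; rewrite normrM ler_pM.
Qed.

Lemma bddD f g : bdd f -> bdd g -> bdd (fun x => f x + g x).
Proof.
move=> [a ha] [b hb]; exists (a + b) => x.
by rewrite (le_trans (ler_normD _ _)) // lerD.
Qed.

Lemma bddZ c f : bdd f -> bdd (fun x => c * f x).
Proof. by move=> hf; apply: bddM hf; exact: bdd_cst. Qed.

Lemma bddB f g : bdd f -> bdd g -> bdd (fun x => f x - g x).
Proof.
move=> [a ha] [b hb]; exists (a + b) => x.
by rewrite (le_trans (ler_normB _ _)) // lerD.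
Qed.

Lemma bdd_bool (p : pred X) : bdd (fun x => (p x)%:R).
Proof. by exists 1 => x; case: (p x); rewrite ?normr1 ?normr0. Qed.

Lemma bdd_sum I (s : seq I) (F : I -> X -> R) :
  (forall i, bdd (F i)) -> bdd (fun x => \sum_(i <- s) F i x).
Proof.
move=> hF; elim: s => [|i s ih].
  by exists 0 => x; rewrite big_nil normr0.
have := bddD (hF i) ih; congr bdd; apply/funext => x; by rewrite big_cons.
Qed.

Variable E : (X -> R) -> R.
Hypothesis hE : mean E.

Lemma mean_lin c f g : bdd f -> bdd g ->
  E (fun x => c * f x + g x) = c * E f + E g.
Proof. by have [h _ _ _] := hE; exact: h. Qed.

Lemma mean_ge0 f : bdd f -> (forall x, 0 <= f x) -> 0 <= E f.
Proof. by have [_ h _ _] := hE; exact: h. Qed.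

Lemma mean0 : E (fun=> 0) = 0.
Proof.
have := mean_lin 1 (bdd_cst 0) (bdd_cst 0).
have -> : (fun x : X => 1 * 0 + 0) = (fun=> 0) :> (X -> R).
  by apply/funext => x; rewrite mulr0 addr0.
lra.
Qed.

Lemma meanZ c f : bdd f -> E (fun x => c * f x) = c * E f.
Proof.
move=> hf; have := mean_lin c hf (bdd_cst 0); rewrite mean0 addr0 => <-.
by congr E; apply/funext => x; rewrite addr0.
Qed.

Lemma meanD f g : bdd f -> bdd g -> E (fun x => f x + g x) = E f + E g.
Proof.
move=> hf hg; have := mean_lin 1 hf hg; rewrite mul1r => <-.
by congr E; apply/funext => x; rewrite mul1r.
Qed.

Lemma meanB f g : bdd f -> bdd g -> E (fun x => f x - g x) = E f - E g.
Proof.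
move=> hf hg; have := mean_lin (-1) hg hf; rewrite mulN1r addrC => <-.
by congr E; apply/funext => x; rewrite mulN1r addrC.
Qed.

Lemma mean_cst c : E (fun=> c) = c.
Proof.
have [_ _ h _] := hE; have := meanZ c (bdd_cst 1); rewrite h mulr1 => {2}<-.
by congr E; apply/funext => x; rewrite mulr1.
Qed.

Lemma mean_le f g : bdd f -> bdd g -> (forall x, f x <= g x) -> E f <= E g.
Proof.
move=> hf hg fg; rewrite -subr_ge0 -meanB //; apply: mean_ge0.
  exact: bddB.
by move=> x; rewrite subr_ge0.
Qed.

Lemma mean_abs c f : (forall x, `|f x| <= c) -> `|E f| <= c.
Proof.
move=> hf; have bf : bdd f by exists c.
rewrite ler_norml -[- c]mean_cst -{2}[c]mean_cst.
by rewrite !mean_le //; [exact: bdd_cst| | exact: bdd_cst|] => x;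
  have := hf x; rewrite ler_norml => /andP[].
Qed.

Lemma mean_sum I (s : seq I) (F : I -> X -> R) : (forall i, bdd (F i)) ->
  E (fun x => \sum_(i <- s) F i x) = \sum_(i <- s) E (F i).
Proof.
move=> hF; elim: s => [|i s ih].
  rewrite big_nil -[RHS]mean0; congr E; apply/funext => x; exact: big_nil.
rewrite big_cons -ih -meanD //; last exact: bdd_sum.
congr E; apply/funext => x; exact: big_cons.
Qed.

End Mean.

(** * Expectations built from point weights *)

Section MeanOfWeights.
Variables (R : realType) (X : choiceType) (P : X -> R).
Hypothesis P0 : forall x, 0 <= P x.
Hypothesis P1 : forall s, uniq s -> \sum_(x <- s) P x <= 1.
Hypothesis Pt : forall e : R, 0 < e -> exists2 s, uniq s & 1 - e <= \sum_(x <- s) P x.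

(** The part of t outside s has at most the mass missing from s, and h is at most c there. *)
Lemma weighted_sum_approx (s t : seq X) (h : X -> R) c : uniq s -> uniq t ->
  0 <= c -> (forall x, 0 <= h x) -> (forall x, h x <= c) ->
  \sum_(x <- t) P x * h x <=
  \sum_(x <- s) P x * h x + c * (1 - \sum_(x <- s) P x).
Proof.
move=> us ut c0 h0 hc.
have uu : uniq (s ++ [seq x <- t | x \notin s]).
  rewrite cat_uniq us filter_uniq // andbT; apply/hasPn => x.
  by rewrite mem_filter => /andP[].
have := P1 uu; rewrite big_cat /= => h1.
have c1 : \sum_(x <- [seq x <- t | x \notin s]) P x * h x <=
    c * \sum_(x <- [seq x <- t | x \notin s]) P x.
  by rewrite mulr_sumr; apply: ler_sum => x _; rewrite mulrC ler_wpM2r.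
have c2 : \sum_(x <- [seq x <- t | x \in s]) P x * h x <= \sum_(x <- s) P x * h x.
  have -> : \sum_(x <- [seq x <- t | x \in s]) P x * h x =
      \sum_(x <- [seq x <- s | x \in t]) P x * h x.
    apply: perm_big; apply: uniq_perm; rewrite ?filter_uniq // => x.
    by rewrite !mem_filter andbC.
  rewrite big_filter [leRHS](bigID (mem t)) /= lerDl.
  by apply: sumr_ge0 => x _; rewrite mulr_ge0.
have -> : \sum_(x <- t) P x * h x =
    \sum_(x <- [seq x <- t | x \in s]) P x * h x +
    \sum_(x <- [seq x <- t | x \notin s]) P x * h x.
  by rewrite (bigID (mem s)) /= [in RHS]big_filter [X in _ = _ + X]big_filter.
rewrite (le_trans (lerD c2 c1)) // lerD2l ler_wpM2l //; lra.
Qed.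

(** Describes the full weighted sum through finite ones, with an error proportional to the missing
    mass; linearity then amounts to adding constants. *)
Definition mean_value (h : X -> R) (v : R) := exists c : R, forall s, uniq s ->
  `|v - \sum_(x <- s) P x * h x| <= c * (1 - \sum_(x <- s) P x).

Lemma mean_value_uniq h v w : mean_value h v -> mean_value h w -> v = w.
Proof.
move=> [a ha] [b hb]; apply/eqP; rewrite -subr_eq0 -normr_le0.
apply/ler_addgt0Pr => e e0; rewrite add0r.
have ab : 0 < `|a| + `|b| + 1 by rewrite ltr_wpDl // addr_ge0.
have [s us hs] := Pt (divr_gt0 e0 ab).
have := ha s us; have := hb s us; have := P1 us; move: hs.
set p := \sum_(x <- s) P x; set q := \sum_(x <- s) _ => hp p1 h2 h1.
have h3 : (`|a| + `|b| + 1) * (1 - p) <= e.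
  by rewrite mulrC -ler_pdivlMr //; lra.
have h4 : a * (1 - p) <= `|a| * (1 - p).
  by rewrite ler_wpM2r ?ler_norm // subr_ge0.
have h5 : b * (1 - p) <= `|b| * (1 - p).
  by rewrite ler_wpM2r ?ler_norm // subr_ge0.
have -> : v - w = (v - q) - (w - q) by ring.
rewrite (le_trans (ler_normB _ _)) //; move: h3; rewrite 2!mulrDl; lra.
Qed.

Lemma mean_value_ex h : bdd h -> exists v, mean_value h v.
Proof.
move=> [c hc].
(* On an empty X the bound c may be negative, hence the separate case. *)
have [x0|n0] := pselect (exists x : X, True); last first.
  exists 0, 0 => -[|x s] _; last by case: n0; exists x.
  by rewrite !big_nil subrr normr0 mul0r.
have c0 : 0 <= c by case: x0 => x _; exact: le_trans (hc x).
(* The shift makes the summands nonnegative, with h + c between 0 and 2 c; removing c from the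
   supremum leaves an error c (1 - p) on both sides, p being the mass of s. *)
pose A := [set \sum_(x <- t) P x * (h x + c) | t in [set t | uniq t]].
have hA s : uniq s -> ubound A
    (\sum_(x <- s) P x * (h x + c) + (2 * c) * (1 - \sum_(x <- s) P x)).
  move=> us _ [t ut <-]; apply: weighted_sum_approx => // [|x|x].
  - by rewrite mulr_ge0.
  - by have := hc x; rewrite ler_norml; lra.
  - by have := hc x; rewrite ler_norml; lra.
have A0 : A !=set0 by exists 0, [::] => //; rewrite big_nil.
exists (sup A - c), c => s us.
have h1 : sup A <= _ := ge_sup A0 (hA s us).
have h2 : \sum_(x <- s) P x * (h x + c) <= sup A.
  by apply: sup_upper_bound; [split => //; eexists; exact: (hA s us)|exists s].
move: h1 h2.
have -> : \sum_(x <- s) P x * (h x + c) =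
    \sum_(x <- s) P x * h x + c * \sum_(x <- s) P x.
  by rewrite mulr_sumr -big_split; apply: eq_bigr => x _; rewrite mulrDr [c * _]mulrC.
set p := \sum_(x <- s) P x; set q := \sum_(x <- s) _ => h1 h2.
by rewrite ler_norml; apply/andP; split; lra.
Qed.

Lemma mean_value_ind s : uniq s ->
  mean_value (fun x => (x \in s)%:R) (\sum_(x <- s) P x).
Proof.
move=> us; exists 1 => t ut; rewrite mul1r.
have ind (u : seq X) (f : X -> R) :
    \sum_(x <- u) f x * (x \in s)%:R = \sum_(x <- [seq x <- u | x \in s]) f x.
  rewrite big_filter [RHS]big_mkcond; apply: eq_bigr => x _.
  by case: ifP; rewrite ?mulr1 ?mulr0.
have -> : \sum_(x <- s) P x = \sum_(x <- [seq x <- t | x \in s]) P x +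
    \sum_(x <- [seq x <- s | x \notin t]) P x.
  rewrite (bigID (mem t)) /= -big_filter -[X in _ + X = _]big_filter.
  congr (_ + _); apply: perm_big; apply: uniq_perm; rewrite ?filter_uniq // => x.
  by rewrite !mem_filter andbC.
rewrite ind addrAC subrr add0r ger0_norm ?sumr_ge0 //.
have uu : uniq (t ++ [seq x <- s | x \notin t]).
  rewrite cat_uniq ut filter_uniq // andbT; apply/hasPn => x.
  by rewrite mem_filter => /andP[].
by have := P1 uu; rewrite big_cat /=; lra.
Qed.

Lemma mean_of_weights : exists E, mean E /\
  forall x, E (fun y => (y == x)%:R) = P x.
Proof.
pose E h := xget 0 [set v | mean_value h v].
have EP h : bdd h -> mean_value h (E h).
  by move=> /mean_value_ex[v hv]; apply: (@xgetPex _ _ [set v | mean_value h v]); exists v.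
have EE h v : mean_value h v -> E h = v.
  move=> hv; apply: (mean_value_uniq _ hv).
  by apply: (@xgetPex _ _ [set v | mean_value h v]); exists v.
have Es s : uniq s -> E (fun x => (x \in s)%:R) = \sum_(x <- s) P x.
  by move=> us; apply/EE/mean_value_ind.
have El c f g : bdd f -> bdd g -> E (fun x => c * f x + g x) = c * E f + E g.
  move=> /EP[a ha] /EP[b hb]; apply: EE; exists (`|c| * a + b) => s us.
  have -> : \sum_(x <- s) P x * (c * f x + g x) =
      c * \sum_(x <- s) P x * f x + \sum_(x <- s) P x * g x.
    rewrite mulr_sumr -big_split; apply: eq_bigr => x _ /=; ring.
  set u := \sum_(x <- s) P x * f x; set v := \sum_(x <- s) P x * g x.
  have -> : c * E f + E g - (c * u + v) = c * (E f - u) + (E g - v) by ring.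
  rewrite (le_trans (ler_normD _ _)) // normrM mulrDl -mulrA lerD //.
    by rewrite ler_wpM2l // ha.
  exact: hb.
have E1 : E (fun=> 1) = 1.
  apply: EE; exists 1 => s us; rewrite mul1r.
  have -> : \sum_(x <- s) P x * 1 = \sum_(x <- s) P x.
    by apply: eq_bigr => x _; rewrite mulr1.
  by rewrite ger0_norm // subr_ge0 P1.
exists E; split; [split => //|] => [f bf f0|e e0|x].
- have [c hc] := EP _ bf; apply/ler_addgt0Pr => e e0.
  have c0 : 0 < `|c| + 1 by rewrite ltr_wpDl.
  have [s us hs] := Pt (divr_gt0 e0 c0).
  have := hc s us; have : 0 <= \sum_(x <- s) P x * f x.
    by apply: sumr_ge0 => x _; rewrite mulr_ge0.
  have := P1 us; move: hs.
  set p := \sum_(x <- s) P x; set q := \sum_(x <- s) _ => h1 h2 h3.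
  have : (`|c| + 1) * (1 - p) <= e by rewrite mulrC -ler_pdivlMr //; lra.
  have : c * (1 - p) <= `|c| * (1 - p).
    by rewrite ler_wpM2r ?ler_norm // subr_ge0.
  by rewrite mulrDl ler_norml; lra.
- have [s us hs] := Pt e0; exists s.
  have -> : (fun x => (x \notin s)%:R) = (fun x => -1 * (x \in s)%:R + 1) :> (X -> R).
    by apply/funext => x; case: (x \in s); rewrite /= ?mulr1 ?mulr0 ?addNr ?add0r.
  by rewrite El ?E1 ?(Es _ us); [lra|exact: (bdd_bool R (mem s))|exact: bdd_cst].
have := Es [:: x] isT; rewrite big_seq1 => <-.
by congr E; apply/funext => y; rewrite inE.
Qed.

End MeanOfWeights.

(** * Transport along cotransitions and perturbation of coherent means *)

Section CoherentMeans.
Variables (R : realType) (X : nat -> choiceType).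
Variables (cs : forall n, X n.+1 -> seq (X n)) (cw : forall n, X n.+1 -> X n -> R).
Hypothesis cw0 : forall n (x : X n.+1) y, 0 <= cw x y.
Hypothesis cw1 : forall n (x : X n.+1), \sum_(y <- cs x) cw x y = 1.

Definition cotrans n (h : X n -> R) (x : X n.+1) : R :=
  \sum_(y <- cs x) cw x y * h y.

Lemma cotrans_lin n c (f g : X n -> R) x :
  cotrans (fun y => c * f y + g y) x = c * cotrans f x + cotrans g x.
Proof.
rewrite /cotrans mulr_sumr -big_split; apply: eq_bigr => y _ /=; ring.
Qed.

Lemma cotrans_cst n c (x : X n.+1) : cotrans (fun=> c) x = c.
Proof. by rewrite /cotrans -mulr_suml cw1 mul1r. Qed.

Lemma cotransD n (f g : X n -> R) x : cotrans (fun y => f y + g y) x = cotrans f x + cotrans g x.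
Proof.
by rewrite /cotrans -big_split; apply: eq_bigr => y _; rewrite mulrDr.
Qed.

Lemma cotransB n (f g : X n -> R) x : cotrans (fun y => f y - g y) x = cotrans f x - cotrans g x.
Proof.
by rewrite /cotrans -sumrB; apply: eq_bigr => y _; rewrite mulrBr.
Qed.

Lemma cotrans_le n (f g : X n -> R) x : (forall y, f y <= g y) -> cotrans f x <= cotrans g x.
Proof. by move=> fg; apply: ler_sum => y _; rewrite ler_wpM2l. Qed.

Lemma cotrans_ge0 n (f : X n -> R) x : (forall y, 0 <= f y) -> 0 <= cotrans f x.
Proof. by move=> f0; rewrite -(cotrans_cst 0 x); exact: cotrans_le. Qed.

Lemma cotrans_abs n (f : X n -> R) c x : (forall y, `|f y| <= c) -> `|cotrans f x| <= c.
Proof.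
move=> hf; rewrite ler_norml -[- c](cotrans_cst _ x) -{2}[c](cotrans_cst _ x).
by rewrite !cotrans_le // => y; have := hf y; rewrite ler_norml => /andP[].
Qed.

Lemma bdd_cotrans n (f : X n -> R) : bdd f -> bdd (cotrans f).
Proof. by move=> [c hc]; exists c => x; exact: cotrans_abs. Qed.

(** Jensen's inequality, from averaging (f - m)^2 >= 0 with m the average of f. *)
Lemma cotrans_sqr n (f : X n -> R) x : cotrans f x ^+ 2 <= cotrans (fun y => f y ^+ 2) x.
Proof.
set m := cotrans f x.
have : 0 <= cotrans (fun y => -2 * m * f y + (f y ^+ 2 + m ^+ 2)) x.
  apply: cotrans_ge0 => y; have -> : -2 * m * f y + (f y ^+ 2 + m ^+ 2) = (f y - m) ^+ 2 by ring.
  exact: sqr_ge0.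
rewrite cotrans_lin cotransD cotrans_cst -/m => h.
rewrite -subr_ge0; apply: le_trans h _; rewrite le_eqVlt; apply/orP; left.
by apply/eqP; ring.
Qed.

Definition coherent (E : forall n, (X n -> R) -> R) :=
  (forall n, mean (E n)) /\ forall n h, bdd h -> E n.+1 (cotrans h) = E n h.

(** Extension by zero to the other levels makes [trans] total in n, free of proofs of k <= n. *)
Definition ext k (f : X k -> R) n : X n -> R :=
  if k =P n is ReflectT e then ecast m (X m -> R) e f else fun=> 0.
Arguments ext {k} f n x.

Lemma extE k (f : X k -> R) : ext f k = f.
Proof. by rewrite /ext; case: eqP => // e; rewrite eq_axiomK. Qed.

Lemma ext_neq k (f : X k -> R) n x : n != k -> ext f n x = 0.
Proof. by rewrite /ext => ne; case: eqP => // e; case/eqP: ne. Qed.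

(* [trans f n] transports f from level k up to level n; it vanishes for n < k. *)
Fixpoint trans k (f : X k -> R) n : X n -> R :=
  if n is n'.+1 return X n -> R then fun x => cotrans (@trans k f n') x + ext f n'.+1 x
  else ext f 0.
Arguments trans {k} f n x.

Lemma trans_lt k (f : X k -> R) n x : (n < k)%N -> trans f n x = 0.
Proof.
elim: n x => [|n ih] x nk; first by rewrite /= ext_neq // ltn_eqF.
rewrite /= ext_neq ?ltn_eqF // addr0 -[RHS](cotrans_cst 0 x); congr (cotrans _ x).
by apply/funext => y; apply: ih; exact: ltnW.
Qed.

Lemma trans_id k (f : X k -> R) : trans f k = f.
Proof.
case: k f => [|k] f; apply/funext => x; rewrite /= extE //.
have -> : trans f k = fun=> 0 by apply/funext => y; exact: trans_lt.
by rewrite cotrans_cst add0r.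
Qed.

Lemma transS k (f : X k -> R) n : (k <= n)%N -> trans f n.+1 = cotrans (trans f n).
Proof.
by move=> kn; apply/funext => x; rewrite /= ext_neq ?addr0 // gtn_eqF.
Qed.

Lemma trans_cotrans k (f : X k -> R) n : (k < n)%N -> trans (cotrans f) n = trans f n.
Proof.
elim: n => // n ih; rewrite ltnS leq_eqVlt => /predU1P[<-|kn].
  by rewrite trans_id transS // trans_id.
by rewrite transS ?ih // transS // ltnW.
Qed.

Lemma ext_lin k c (f g : X k -> R) n x :
  ext (fun y => c * f y + g y) n x = c * ext f n x + ext g n x.
Proof.
have [e|ne] := eqVneq n k; last by rewrite !ext_neq // mulr0 addr0.
by case: k / e f g => f g; rewrite !extE.
Qed.

Lemma trans_lin k c (f g : X k -> R) n x :
  trans (fun y => c * f y + g y) n x = c * trans f n x + trans g n x.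
Proof.
elim: n x => [|n ih] x /=; first exact: ext_lin.
have -> : trans (fun y => c * f y + g y) n = fun y => c * trans f n y + trans g n y.
  by apply/funext => y; exact: ih.
rewrite cotrans_lin ext_lin; ring.
Qed.

Lemma trans_ind (Q : forall n, (X n -> R) -> Prop) k (f : X k -> R) :
  Q k f -> (forall n h, Q n h -> Q n.+1 (cotrans h)) ->
  forall n, (k <= n)%N -> Q n (trans f n).
Proof.
move=> Qf Qd; elim=> [|n ih]; first by rewrite leqn0 => /eqP k0; subst k; rewrite trans_id.
rewrite leq_eqVlt => /predU1P[e|]; first by subst k; rewrite trans_id.
by rewrite ltnS => kn; rewrite transS //; exact/Qd/ih.
Qed.

Lemma trans_abs k (f : X k -> R) c n x : 0 <= c -> (forall y, `|f y| <= c) ->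
  `|trans f n x| <= c.
Proof.
move=> c0 hf; have [kn|nk] := leqP k n; last by rewrite trans_lt // normr0.
apply: (trans_ind (Q := fun n h => forall x, `|h x| <= c)) x => // m h hh x.
exact: cotrans_abs.
Qed.

Lemma trans_ge0 k (f : X k -> R) n x : (forall y, 0 <= f y) -> 0 <= trans f n x.
Proof.
move=> hf; have [kn|nk] := leqP k n; last by rewrite trans_lt.
apply: (trans_ind (Q := fun n h => forall x, 0 <= h x)) x => // m h hh x.
exact: cotrans_ge0.
Qed.

Lemma bdd_trans k (f : X k -> R) n : bdd f -> bdd (trans f n).
Proof.
move=> [c hc]; exists `|c| => x; apply: trans_abs => // y.
exact: le_trans (ler_norm _).
Qed.

Lemma trans_cst k (c : R) n : (k <= n)%N -> trans (fun _ : X k => c) n = fun=> c.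
Proof.
apply: (trans_ind (Q := fun n h => h = fun=> c)) => // m _ ->.
by apply/funext => x; rewrite cotrans_cst.
Qed.

Lemma trans_sqr k (f : X k -> R) n x : (k <= n)%N ->
  trans f n x ^+ 2 <= trans (fun y => f y ^+ 2) n x.
Proof.
move=> kn; elim: n kn x => [|n ih].
  by rewrite leqn0 => /eqP k0; subst k; rewrite !trans_id.
rewrite leq_eqVlt => /predU1P[e|]; first by subst k; rewrite !trans_id.
rewrite ltnS => kn x; rewrite !transS //; apply: le_trans (cotrans_sqr _ _) _.
by apply: cotrans_le => y; exact: ih.
Qed.

Section CoherentFamily.
Variable E : forall n, (X n -> R) -> R.
Hypothesis hE : coherent E.

Let mE n : mean (@E n). Proof. by have [h _] := hE. Qed.

Lemma coherent_trans k (f : X k -> R) n : bdd f -> (k <= n)%N ->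
  E (trans f n) = E f.
Proof.
move=> bf kn.
have [//] : bdd (trans f n) /\ E (trans f n) = E f.
apply: (trans_ind (Q := fun n h => bdd h /\ E h = E f)) => // m h [bh <-].
by split; [exact: bdd_cotrans|have [_ ->] := hE].
Qed.

(** A reverse martingale for the law of a random path. The relation is asked only eventually,
    because a transported function jumps from 0 to f at its initial level. *)
Definition martingale (U : forall n, X n -> R) :=
  (forall n, bdd (U n)) /\ \forall n \near \oo, U n.+1 = cotrans (U n).

Lemma martingale_trans k (f : X k -> R) : bdd f -> martingale (trans f).
Proof.
move=> bf; split=> [n|]; first exact: bdd_trans.
by exists k => // n /= kn; exact: transS.
Qed.

Lemma martingale_lin c U V : martingale U -> martingale V ->
  martingale (fun n x => c * U n x + V n x).
Proof.
move=> [bU hU] [bV hV]; split=> [n|]; first exact: bdd_lin.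
near=> n; apply/funext => x; rewrite cotrans_lin.
have -> : U n.+1 = cotrans (U n) by near: n.
by have -> : V n.+1 = cotrans (V n) by near: n.
Unshelve. all: by end_near. Qed.

(** Jensen's inequality for the cotransitions followed by coherence makes the sequence eventually
    nonincreasing, and it is nonnegative. *)
Lemma martingale_sqr_cvg U : martingale U ->
  cvgn (fun n => E (fun x => U n x ^+ 2)).
Proof.
move=> [bU [k _ hU]]; have bU2 n : bdd (fun x => U n x ^+ 2).
  exact: bddM (bU n) (bU n).
suff /cvg_ex[l hl] : cvgn (fun n => E (fun x => U (n + k)%N x ^+ 2)).
  by apply/cvg_ex; exists l; rewrite -(cvg_shiftn k).
apply: nonincreasing_is_cvgn.
  apply/nonincreasing_seqP => n /=.
  set m := (n + k)%N; have hm := hU m (leq_addl _ _).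
  change (E (fun x => U m.+1 x ^+ 2) <= E (fun x => U m x ^+ 2)).
  rewrite hm -(proj2 hE _ _ (bU2 _)).
  apply: (mean_le (mE _)) => [||x]; last exact: cotrans_sqr.
    exact: (bddM (bdd_cotrans (bU _)) (bdd_cotrans (bU _))).
  exact: bdd_cotrans.
exists 0 => _ [n _ <-]; apply: (mean_ge0 (mE _)) => // x; exact: sqr_ge0.
Qed.

(* Polarization of the nonincreasing sequences E_n(U_n^2). *)
Lemma martingale_mul_cvg U V : martingale U -> martingale V ->
  cvgn (fun n => E (fun x => U n x * V n x)).
Proof.
move=> hU hV; have bU n := proj1 hU n; have bV n := proj1 hV n.
have -> : (fun n => E (fun x => U n x * V n x)) = fun n =>
    2^-1 * (E (fun x => (1 * U n x + V n x) ^+ 2) - E (fun x => U n x ^+ 2)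
      - E (fun x => V n x ^+ 2)).
  apply/funext => n.
  have bU2 : bdd (fun x => U n x ^+ 2) by exact: bddM.
  have bV2 : bdd (fun x => V n x ^+ 2) by exact: bddM.
  have bUV : bdd (fun x => U n x * V n x) by exact: bddM.
  have -> : (fun x => (1 * U n x + V n x) ^+ 2) =
      fun x => 2 * (U n x * V n x) + (U n x ^+ 2 + V n x ^+ 2).
    by apply/funext => x; ring.
  rewrite (mean_lin (mE n)) ?(meanD (mE n)) //; last exact: bddD.
  lra.
apply: is_cvgMr; apply: is_cvgB; last exact: martingale_sqr_cvg.
apply: is_cvgB; last exact: martingale_sqr_cvg.
exact: (martingale_sqr_cvg (martingale_lin 1 hU hV)).
Qed.

Section Perturbation.
Variable U : forall n, X n -> R.
Arguments U : clear implicits.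
Hypothesis hU : martingale U.
Hypothesis U1 : forall n x, `|U n x| <= 1.
Hypothesis EU0 : \forall n \near \oo, E (U n) = 0.

Definition correlation k (h : X k -> R) : R :=
  limn (fun n => E (fun x => U n x * trans h n x)).

Definition perturb s k (h : X k -> R) : R := E h + s * correlation h.

Lemma correlation_cvg k (h : X k -> R) : bdd h ->
  (fun n => E (fun x => U n x * trans h n x)) @ \oo --> correlation h.
Proof. by move=> bh; apply: (martingale_mul_cvg hU (martingale_trans bh)). Qed.

(** The perturbed value is the limit of E ((1 + s U_n) h_n), with a density between 0 and 2. The
    lower bound gives positivity, the upper one tightness. *)
Lemma perturb_bounds s k (h : X k -> R) : `|s| <= 1 -> bdd h ->
  (forall x, 0 <= h x) -> 0 <= perturb s h <= 2 * E h.
Proof.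
move=> s1 bh h0.
have cv : (fun n => E h + s * E (fun x => U n x * trans h n x)) @ \oo -->
    perturb s h.
  by apply: cvgD; [exact: cvg_cst|apply: cvgMr; exact: correlation_cvg].
have bH n : bdd (trans h n) by exact: bdd_trans.
have H0 n x : 0 <= trans h n x by exact: trans_ge0.
have sU n x : `|s * U n x| <= 1.
  by rewrite normrM -[1]mulr1 ler_pM.
have ne : \forall n \near \oo, E h + s * E (fun x => U n x * trans h n x) =
    E (fun x => (1 + s * U n x) * trans h n x).
  exists k => // n /= kn; rewrite -(coherent_trans bh kn).
  rewrite -(meanZ (mE n)); last exact: bddM (proj1 hU n) (bH n).
  rewrite -(meanD (mE n)) //; last first.
    exact: bddZ (bddM (proj1 hU n) (bH n)).
  by congr E; apply/funext => x; rewrite mulrDl mul1r mulrA.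
have bK n : bdd (fun x => (1 + s * U n x) * trans h n x).
  by apply: bddM (bH n); apply: bddD; [exact: bdd_cst|exact: bddZ (proj1 hU n)].
have K n x : 0 <= 1 + s * U n x <= 2.
  by have := sU n x; rewrite ler_norml; lra.
apply/andP; split.
  apply: (cvgr_to_ge cv); near=> n.
  have -> : E h + s * E (fun x => U n x * trans h n x) =
    E (fun x => (1 + s * U n x) * trans h n x) by near: n.
  by apply: (mean_ge0 (mE n)) => // x; rewrite mulr_ge0 //; case/andP: (K n x).
apply: (cvgr_to_le cv); near=> n.
have -> : E h + s * E (fun x => U n x * trans h n x) =
  E (fun x => (1 + s * U n x) * trans h n x) by near: n.
have kn : (k <= n)%N by near: n; exists k.
rewrite -(coherent_trans bh kn) -(meanZ (mE n)) //.
apply: (mean_le (mE n)) => // [|x]; first exact: bddZ.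
by rewrite ler_wpM2r //; case/andP: (K n x).
Unshelve. all: by end_near. Qed.

Lemma coherent_perturb s : `|s| <= 1 -> coherent (perturb s).
Proof.
move=> s1; split=> [k|k h bh].
  split.
  - move=> c f g bf bg; rewrite /perturb (mean_lin (mE k)) //.
    have -> : correlation (fun x => c * f x + g x) =
        c * correlation f + correlation g.
      apply: cvg_lim => //.
      have -> : (fun n => E (fun x => U n x * trans (fun y => c * f y + g y) n x)) =
          fun n => c * E (fun x => U n x * trans f n x) +
                   E (fun x => U n x * trans g n x).
        apply/funext => n; have bUn := proj1 hU n.
        have bf' := bddM bUn (bdd_trans n bf).
        have bg' := bddM bUn (bdd_trans n bg).
        rewrite -(mean_lin (mE n)) //; congr E; apply/funext => x.
        by rewrite trans_lin; ring.
      by apply: cvgD; [apply: cvgMr|]; exact: correlation_cvg.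
    by ring.
  - by move=> f bf f0; case/andP: (perturb_bounds s1 bf f0).
  - rewrite /perturb (mean_cst (mE k)).
    (* The correlation with 1 is the limit of E (U_n), which is eventually 0. *)
    suff -> : correlation (fun _ : X k => 1) = 0 by rewrite mulr0 addr0.
    apply: cvg_lim => //; apply: cvg_near_cst.
    case: EU0 => m _ hm; exists (maxn k m) => // n /=.
    rewrite geq_max => /andP[kn mn]; rewrite -(hm n mn).
    by congr E; apply/funext => x; rewrite trans_cst // mulr1.
  - move=> e e0; have [_ _ _ ht] := mE k.
    have e2 : 0 < e / 2 by rewrite divr_gt0.
    have [t ht2] := ht _ e2; exists t.
    have bt : bdd (fun x : X k => (x \notin t)%:R : R) by exact: (bdd_bool R [pred x | x \notin t]).
    have /andP[_ h2] := perturb_bounds s1 bt (fun x => ler0n _ _).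
    by rewrite (le_trans h2) //; lra.
(* Above level k the transports of h and of [cotrans h] coincide, so both correlations are the same
   limit. *)
rewrite /perturb (proj2 hE _ _ bh); congr (_ + s * _).
apply: cvg_lim => //; apply: (cvg_trans _ (correlation_cvg bh)).
apply: near_eq_cvg; exists k.+1 => // n /= kn.
by rewrite trans_cotrans.
Qed.

End Perturbation.

(** Midpoints and point masses are what extremality of a state gives directly: coefficient 1/2,
    evaluated at the units of blocks. *)
Definition extremal_mean := forall E1 E2, coherent E1 -> coherent E2 ->
  (forall n (h : X n -> R), bdd h -> E h = (E1 n h + E2 n h) / 2) ->
  forall n x, E1 n (fun y => (y == x)%:R) = E (fun y : X n => (y == x)%:R).

Lemma bdd_ind n (x : X n) : bdd (fun y => (y == x)%:R : R).
Proof. exact: (bdd_bool R (pred1 x)). Qed.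

(* A correlation of the fluctuation M_n - p with a level function would
   split E into two coherent families E + c and E - c. *)
Lemma extremal_fluctuation k (x : X k) : extremal_mean ->
  let p := E (fun y => (y == x)%:R) in
  (fun n => E (fun z => (trans (fun y => (y == x)%:R) n z - p) ^+ 2)) @ \oo --> 0.
Proof.
move=> ext p; set f := fun y => (y == x)%:R.
have bf : bdd f by exact: bdd_ind.
have f01 y : 0 <= f y <= 1 by rewrite /f; case: (_ == _); rewrite /= ?lexx ?ler01.
have p01 : 0 <= p <= 1.
  apply/andP; split.
    by apply: (mean_ge0 (mE k)) => // y; case/andP: (f01 y).
  rewrite -(mean_cst (mE k) 1); apply: (mean_le (mE k)) => //.
    exact: bdd_cst.
  by move=> y; case/andP: (f01 y).
pose U n (z : X n) := trans f n z - p.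
have M01 n z : 0 <= trans f n z <= 1.
  rewrite trans_ge0 /=; last by move=> y; case/andP: (f01 y).
  rewrite (le_trans (ler_norm _)) //; apply: trans_abs => // y.
  by rewrite ger0_norm; case/andP: (f01 y).
have bU n : bdd (U n) by apply: bddB; [exact: bdd_trans|exact: bdd_cst].
have hU : martingale U.
  split=> //; exists k => // n /= kn; apply/funext => z.
  by rewrite /U transS // cotransB cotrans_cst.
have U1 n z : `|U n z| <= 1.
  by have := M01 n z; move: p01; rewrite /U ler_norml; lra.
have EU n : (k <= n)%N -> E (U n) = 0.
  move=> kn; rewrite /U (meanB (mE n)) ?(mean_cst (mE n)) //.
  - by rewrite (coherent_trans bf kn) subrr.
  - exact: bdd_trans.
  - exact: bdd_cst.
have EU0 : \forall n \near \oo, E (U n) = 0 by exists k.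
have n1 : `|1 : R| <= 1 by rewrite normr1.
have n2 : `|- 1 : R| <= 1 by rewrite normrN normr1.
have := ext _ _ (coherent_perturb hU U1 EU0 n1) (coherent_perturb hU U1 EU0 n2).
have half n (h : X n -> R) : bdd h -> E h = (perturb U 1 h + perturb U (- 1) h) / 2.
  by move=> _; rewrite /perturb; lra.
move=> /(_ half k x); rewrite -/f /perturb => c0.
have {}c0 : correlation U f = 0 by lra.
have := correlation_cvg hU bf; rewrite c0; apply: cvg_trans.
apply: near_eq_cvg; exists k => // n /= kn.
have bM := bdd_trans n bf.
(* As E (U_n) = 0, the mean of U_n^2 is that of U_n f_n, whose limit is the vanishing
   correlation. *)
have -> : (fun z => (trans f n z - p) ^+ 2) =
    fun z => - p * U n z + U n z * trans f n z.
  by apply/funext => z; rewrite /U; ring.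
rewrite (mean_lin (mE n)) //; last exact: bddM.
by rewrite EU // mulr0 add0r.
Qed.

End CoherentFamily.
End CoherentMeans.
Arguments ext {R X k} f n x.
Arguments trans {R X} cs cw {k} f n x.

(** * A path realizing almost sure limits *)

Section Koenig.
Variables (X : nat -> choiceType).

(** If each point of s dropped out at some stage, none would survive the largest of these finitely
    many stages. *)
Lemma decreasing_finite_limit (T : choiceType) (Q : nat -> T -> Prop) (s : seq T) :
  (forall m x, Q m.+1 x -> Q m x) -> (forall x, Q 0%N x -> x \in s) ->
  (forall m, exists x, Q m x) -> exists x, forall m, Q m x.
Proof.
move=> QS Qs Qe; apply: contrapT => no.
have out x : exists m, ~ Q m x.
  by apply: contrapT => h; apply: no; exists x => m; apply: contrapT => nq; apply: h; exists m.
pose f x := projT1 (cid (out x)).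
have fP x : ~ Q (f x) x by rewrite /f; case: cid.
have Qle m n x : (m <= n)%N -> Q n x -> Q m x.
  move=> /subnK <-; elim: (n - m)%N => // k ih; rewrite addSn => /QS; exact: ih.
have [x hx] := Qe (\max_(x <- s) f x)%N.
have xs : x \in s by apply/Qs/(Qle _ _ _ _ hx).
by apply: (fP x); apply: Qle hx; rewrite (big_rem x) //= leq_maxl.
Qed.

Variables (good : forall n, X n -> Prop) (edge : forall n, X n.+1 -> X n -> Prop).
Hypothesis good_fin : forall n, exists s : seq (X n), forall x : X n, good x -> x \in s.
Hypothesis good_ex : forall n, exists x : X n, good x.
Hypothesis good_pred : forall n (x : X n.+1), good x -> exists2 y, good y & edge x y.

(** Good points have good predecessors, but the path is built upward; so one keeps to points from
    which arbitrarily long good chains ascend. *)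
Fixpoint ascends m n (x : X n) : Prop :=
  if m is m'.+1 then good x /\ exists2 y, edge y x & @ascends m' n.+1 y else good x.

Let ascends_good m n (x : X n) : ascends m x -> good x.
Proof. by case: m => [|m] //= []. Qed.

Let ascendsS m n (x : X n) : ascends m.+1 x -> ascends m x.
Proof.
elim: m n x => [|m ih] n x; first by case.
by move=> [gx [y yx hy]]; split=> //; exists y => //; exact: ih.
Qed.

Let ascends_ex m n : exists x : X n, ascends m x.
Proof.
elim: m n => [|m ih] n; first exact: good_ex.
have [y hy] := ih n.+1; have [x gx yx] := good_pred (ascends_good hy).
by exists x; split=> //; exists y.
Qed.

(** A point with ascending chains of every length has a successor of the same kind: the candidates
    are among finitely many good points and shrink as the length grows. *)
Lemma koenig_path : exists pi : forall n, X n,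
  forall n, good (pi n) /\ edge (pi n.+1) (pi n).
Proof.
pose long n (x : X n) := forall m, ascends m x.
have start : exists x : X 0%N, long _ x.
  have [s hs] := good_fin 0; apply: (@decreasing_finite_limit _ (fun m (x : X 0%N) => ascends m x) s) => [m x|//|//]; exact: ascendsS.
have next n (p : {x : X n | long _ x}) :
    exists y : X n.+1, long _ y /\ edge y (sval p).
  case: p => x hx /=; have [s hs] := good_fin n.+1.
  have [||m|y hy] := @decreasing_finite_limit _
      (fun m (y : X n.+1) => edge y x /\ ascends m y) s.
  - by move=> m y [? /ascendsS].
  - by move=> y [_]; exact: hs.
  - by have [_ [y ? ?]] := hx m.+1; exists y.
  by exists y; split=> [m|]; [have [] := hy m|have [] := hy 0%N].
pose step n p : {x : X n.+1 | long _ x} :=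
  let: exist y hy := cid (next n p) in exist _ y (proj1 hy).
pose walk := fix walk n : {x : X n | long _ x} :=
  if n is n'.+1 then step n' (walk n') else cid start.
exists (fun n => sval (walk n)) => n; split.
  by case: (walk n) => x hx; exact: (hx 0%N).
by rewrite /= /step; case: cid => y [].
Qed.

End Koenig.

(** * A path with small potentials and convergent transports *)

Section GoodPath.
Variables (R : realType) (X : nat -> choiceType).
Variables (cs : forall n, X n.+1 -> seq (X n)) (cw : forall n, X n.+1 -> X n -> R).
Hypothesis cw0 : forall n (x : X n.+1) y, 0 <= cw x y.
Hypothesis cw1 : forall n (x : X n.+1), \sum_(y <- cs x) cw x y = 1.
Variable E : forall n, (X n -> R) -> R.
Hypothesis hE : coherent cs cw E.
Local Notation cotrans := (cotrans cs cw).
Local Notation trans := (trans cs cw).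

Let mE n : mean (@E n). Proof. by have [h _] := hE. Qed.

(* V_n = sum_(i <= n) U_i has mean < 1, and cotrans V_n <= V_(n+1) gives every
   point with V_(n+1) < 1 a predecessor with V_n < 1. *)
Lemma good_path (U : nat -> forall n, X n -> R) :
  (forall i n x, 0 <= U i n x) -> (forall i n, bdd (U i n)) ->
  (forall i n x, cotrans (U i n) x <= U i n.+1 x) ->
  (forall i n, E (U i n) <= 2^-1 ^+ i.+1) ->
  (forall n, exists s : seq (X n), forall x, U n n x < 1 -> x \in s) ->
  exists pi : forall n, X n, (forall n, pi n \in cs (pi n.+1)) /\
    forall i n, (i <= n)%N -> U i n (pi n) < 1.
Proof.
move=> U0 bU dU EU finU.
pose V n x := \sum_(i < n.+1) U i n x.
have UV i n x : (i <= n)%N -> U i n x <= V n x.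
  move=> lin; have i1 : (i < n.+1)%N by [].
  by rewrite /V (bigD1 (Ordinal i1)) //= lerDl sumr_ge0.
have [||n x|pi hpi] := @koenig_path X (fun n x => V n x < 1) (fun n x y => y \in cs x).
- move=> n; have [s hs] := finU n; exists s => x; move/(le_lt_trans (UV _ _ _ (leqnn n))).
  exact: hs.
- move=> n; apply: contrapT => no.
  have V1 x : 1 <= V n x by rewrite leNgt; apply/negP => h; apply: no; exists x.
  have bV : bdd (V n) by apply: bdd_sum => i; exact: bU.
  have : 1 <= E (V n).
    by rewrite -[leLHS](mean_cst (mE n)); apply: (mean_le (mE n)) => //; exact: bdd_cst.
  rewrite (mean_sum (mE n)) //; apply/negP; rewrite -ltNge.
  apply: (@le_lt_trans _ _ (\sum_(i < n.+1) 2^-1 ^+ i.+1)); first exact: ler_sum.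
  have -> : \sum_(i < n.+1) 2^-1 ^+ i.+1 = 1 - 2^-1 ^+ n.+1 :> R.
    elim: n.+1 => [|m ih]; first by rewrite big_ord0 expr0 subrr.
    by rewrite big_ord_recr ih /= [_ ^+ m.+1]exprS; lra.
  by rewrite ltrBlDr ltrDl exprn_gt0.
- move=> h; apply: contrapT => no.
  have : 1 <= V n.+1 x; last by rewrite leNgt h.
  apply: (@le_trans _ _ (cotrans (V n) x)).
    rewrite -(cw1 x) /cotrans big_seq [leRHS]big_seq; apply: ler_sum => y ys.
    rewrite ler_peMr //; rewrite leNgt; apply/negP => hy.
    by apply: no; exists y.
  rewrite /V big_ord_recr /= -[leLHS]addr0 lerD //.
  have -> : cotrans (fun y => \sum_(i < n.+1) U i n y) x = \sum_(i < n.+1) cotrans (U i n) x.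
    rewrite /cotrans exchange_big /=; apply: eq_bigr => y _; by rewrite mulr_sumr.
  exact: ler_sum.
exists pi; split=> [n|i n lin]; first by have [] := hpi n.
by have [h _] := hpi n; exact: le_lt_trans (UV _ _ _ lin) h.
Qed.

Lemma trans_trans k (f : X k -> R) m n : (k <= m)%N -> (m <= n)%N ->
  trans (trans f m) n = trans f n.
Proof.
move=> km /subnKC <-; elim: (n - m)%N => [|d ih]; first by rewrite addn0 trans_id.
by rewrite addnS !transS ?leq_addr ?(leq_trans km) ?leq_addr // ih.
Qed.

Lemma trans_fluctuation k (f : X k -> R) p m n x : (k <= m)%N -> (m <= n)%N ->
  (trans f n x - p) ^+ 2 <= trans (fun y => (trans f m y - p) ^+ 2) n x.
Proof.
move=> km mn.
have -> : trans f n x - p = trans (fun y => trans f m y - p) n x.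
  have -> : (fun y => trans f m y - p) = fun y => 1 * trans f m y + - p.
    by apply/funext => y; rewrite mul1r.
  by rewrite (trans_lin cs cw) trans_trans // trans_cst // mul1r.
exact: trans_sqr.
Qed.

Hypothesis countX : forall n, countable [set: X n].
Hypothesis fluct : forall k (x : X k),
  (fun n => E (fun z => (trans (fun y => (y == x)%:R) n z -
     E (fun y => (y == x)%:R)) ^+ 2)) @ \oo --> 0.

(** The pair (x, l) stands for the demand that the squared fluctuation of the transported indicator
    of x be less than 1 / (l + 1). *)
Let tests := ({k : nat & X k} * nat)%type.

Let decode_ex : exists d : nat -> option tests, forall t, exists i, d i = Some t.
Proof.
have cX n : {f : X n -> nat | injective f}.
  have /pcard_injP/cid[f fI] := countX n.
  by exists f => x y; apply: fI; rewrite inE.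
pose g (t : tests) := pickle (tag t.1, sval (cX (tag t.1)) (tagged t.1), t.2).
have gI : injective g.
  move=> [[k x] l] [[k' x'] l'] /(pcan_inj pickleK) [] /= e; subst k'.
  by move=> /(svalP (cX k)) -> ->.
(* Integers that code no test are decoded to [None] and later contribute the zero potential. *)
exists (fun i => xget None [set o | exists t, o = Some t /\ g t = i]) => t.
exists (g t); case: xgetP; first by move=> o _ [u [-> /gI ->]].
by move=> /(_ (Some t)); case; exists t.
Qed.

Let observable (t : tests) n : X n -> R := trans (fun y => (y == tagged t.1)%:R) n.
Arguments observable : clear implicits.
Let weight_of (t : tests) : R := E (fun y => (y == tagged t.1)%:R).
Let deviation (t : tests) n (z : X n) : R :=
  t.2.+1%:R * (observable t n z - weight_of t) ^+ 2.
Arguments deviation : clear implicits.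

Let stage_ex (t : tests) (e : R) : 0 < e ->
  exists2 m, (tag t.1 <= m)%N & E (deviation t m) <= e.
Proof.
move=> e0; have e1 : 0 < e / t.2.+1%:R by rewrite divr_gt0.
have /cvgrPdist_lt/(_ _ e1)[m _ hm] := fluct (tagged t.1).
exists (maxn (tag t.1) m); first exact: leq_maxl.
have := hm (maxn (tag t.1) m) (leq_maxr _ _); rewrite distrC subr0 => h.
rewrite /deviation (meanZ (mE _)).
  rewrite mulrC -ler_pdivlMr //; exact: le_trans (ler_norm _) (ltW h).
have b1 : bdd (fun z : X (maxn (tag t.1) m) => observable t _ z - weight_of t).
  by apply: bddB; [apply: bdd_trans => //; exact: bdd_ind|exact: bdd_cst].
exact: (bddM b1 b1).
Qed.

(* Each test (x, l) is performed once, at a stage where it fails with small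
   probability; by Jensen a bound on the transported squared deviation controls
   the fluctuation at every later level. *)
Lemma regular_path : exists pi : forall n, X n,
  (forall n, pi n \in cs (pi n.+1)) /\
  forall k (x : X k), (fun n => trans (fun y => (y == x)%:R) n (pi n)) @ \oo -->
    E (fun y => (y == x)%:R).
Proof.
have [d hd] := decode_ex.
(* The test and the tightness potential of index i get 2^-(i+2) each, which fits the 2^-(i+1) of
   [good_path]. *)
have h2 i : 0 < 2^-1 ^+ i.+2 :> R by rewrite exprn_gt0.
pose stage (t : tests) i := s2val (cid2 (stage_ex t (h2 i))).
have stage1 t i : (tag t.1 <= stage t i)%N by rewrite /stage; case: cid2.
have stage2 t i : E (deviation t (stage t i)) <= 2^-1 ^+ i.+2.
  by rewrite /stage; case: cid2.
have tight i : {s : seq (X i) | E (fun x => (x \notin s)%:R) <= 2^-1 ^+ i.+2}.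
  by apply/cid; have [_ _ _] := mE i; apply.
pose V i : forall n, X n -> R :=
  if d i is Some t then trans (deviation t (stage t i)) else fun _ _ => 0.
pose W i : forall n, X n -> R := trans (fun x => (x \notin sval (tight i))%:R).
have dev0 t m z : 0 <= deviation t m z by rewrite mulr_ge0 ?sqr_ge0.
have bdev t m : bdd (deviation t m).
  apply: bddZ; have b1 : bdd (fun z : X m => observable t _ z - weight_of t).
    by apply: bddB; [apply: bdd_trans => //; exact: bdd_ind|exact: bdd_cst].
  exact: (bddM b1 b1).
have V0 i n x : 0 <= V i n x.
  by rewrite /V; case: (d i) => [t|//]; exact: trans_ge0.
have W0 i n x : 0 <= W i n x by apply: trans_ge0.
have bV i n : bdd (V i n).
  by rewrite /V; case: (d i) => [t|]; [exact: bdd_trans|exact: bdd_cst].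
have bW i n : bdd (W i n).
  by apply: bdd_trans => //; exact: (bdd_bool R [pred x | x \notin sval (tight i)]).
have bind n (s : seq (X n)) : bdd (fun x => (x \notin s)%:R : R).
  exact: (bdd_bool R [pred x | x \notin s]).
(* Only an inequality: at level k the transport jumps from 0 to f. *)
have step k (f : X k -> R) n x : (forall y, 0 <= f y) ->
    cotrans (trans f n) x <= trans f n.+1 x.
  move=> f0; rewrite /= lerDl /ext; case: eqP => // e.
  by move: x; case: (n.+1) / e.
have Etrans k (f : X k -> R) n e : 0 <= e -> bdd f -> E f <= e -> E (trans f n) <= e.
  move=> e0 bf Ef; have [kn|nk] := leqP k n; first by rewrite (coherent_trans cw0 cw1 hE bf kn).
  have -> : trans f n = fun=> 0 by apply/funext => x; exact: trans_lt.
  by rewrite (mean_cst (mE n)).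
have [|i n|i n x|i n|n|pi [pi1 pi2]] := @good_path (fun i n x => V i n x + W i n x).
- by move=> i n x; rewrite addr_ge0.
- exact: bddD.
- rewrite cotransD lerD ?step // /V; case: (d i) => [t|]; first exact: step.
  by rewrite cotrans_cst.
- rewrite (meanD (mE n)) //.
  have -> : 2^-1 ^+ i.+1 = 2^-1 ^+ i.+2 + 2^-1 ^+ i.+2 :> R.
    by rewrite [_ ^+ i.+2]exprS; lra.
  apply: lerD; last exact: (Etrans _ _ _ _ (ltW (h2 i)) (bind _ _) (svalP (tight i))).
  rewrite /V; case: (d i) => [t|]; first exact: (Etrans _ _ _ _ (ltW (h2 i)) (bdev _ _) (stage2 _ _)).
  by rewrite (mean_cst (mE n)) ltW.
(* At level n the n-th potential is at least 1 off the n-th finite set. *)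
- exists (sval (tight n)) => x; apply: contraLR => xs.
  have -> : W n n x = 1 by rewrite /W (trans_id cw1) xs.
  by rewrite -leNgt lerDr.
exists pi; split=> // k x; apply/cvgrPdist_lt => e e0.
have [l hl] : exists l : nat, l.+1%:R^-1 < e ^+ 2.
  exists (Num.truncn (e ^+ 2)^-1); rewrite invf_plt ?posrE ?exprn_gt0 //.
  have /truncn_itv/andP[_] : 0 <= (e ^+ 2)^-1 by rewrite invr_ge0 sqr_ge0.
  by [].
have [i di] := hd (existT _ k x, l).
pose t : tests := (existT _ k x, l).
exists (maxn i (stage t i)) => // n /=; rewrite geq_max => /andP[lin sn].
have : V i n (pi n) < 1 by apply: le_lt_trans (pi2 i n lin); rewrite lerDl.
rewrite /V di -/t => lt1; have kn := leq_trans (stage1 t i) sn.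
have := trans_fluctuation (fun y => (y == x)%:R) (weight_of t) (pi n) (stage1 t i) sn.
set a := _ ^+ 2 => h.
have {}lt1 : l.+1%:R * trans (fun y => (observable t (stage t i) y - weight_of t) ^+ 2) n (pi n) < 1.
  apply: le_lt_trans lt1; rewrite /deviation.
  have -> : (fun z => t.2.+1%:R * (observable t (stage t i) z - weight_of t) ^+ 2) =
    fun z => l.+1%:R * (observable t (stage t i) z - weight_of t) ^+ 2 + 0.
    by apply/funext => z; rewrite addr0.
  by rewrite (trans_lin cs cw) trans_cst // addr0.
have ae : a < e ^+ 2.
  apply: lt_trans hl; rewrite -[_^-1]mul1r ltr_pdivlMr // mulrC.
  by apply: le_lt_trans lt1; rewrite ler_wpM2l.
rewrite distrC ltNge; apply/negP => le2.
have : e * e <= `|trans (fun y => (y == x)%:R) n (pi n) - weight_of t| *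
    `|trans (fun y => (y == x)%:R) n (pi n) - weight_of t|.
  by rewrite ler_pM // ltW.
by rewrite -normrM -!expr2 ger0_norm ?sqr_ge0 // -/a leNgt ae.
Qed.

End GoodPath.

(** * The state of a mean *)

Section LevelState.
Variables (R : realType) (G : ucqg R).
Local Notation C := R[i].
Variable E : (irr G -> R) -> R.
Hypothesis mE : mean E.

(** The mixture of the states [chi_irr pi] with respect to E; real and imaginary parts are taken
    apart because E acts on real functions. *)
Definition level_state (x : dualU G) : C :=
  Complex (E (fun pi => complex.Re (chi_irr pi x)))
          (E (fun pi => complex.Im (chi_irr pi x))).

Lemma bdd_chi_irr (x : dualU G) : Wstar x ->
  bdd (fun pi => complex.Re (chi_irr pi x)) /\
  bdd (fun pi => complex.Im (chi_irr pi x)).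
Proof.
move=> hx; split; exists (Wnorm x) => pi.
  apply: le_trans (Re_le_nrm _) _.
  exact: le_trans (chi_irr_le _ _) (opnorm_le_Wnorm _ hx).
apply: le_trans (Im_le_nrm _) _.
exact: le_trans (chi_irr_le _ _) (opnorm_le_Wnorm _ hx).
Qed.

Lemma level_state_lin c (x y : dualU G) : Wstar x -> Wstar y ->
  level_state (fun pi => c *: x pi + y pi) = c * level_state x + level_state y.
Proof.
move=> /bdd_chi_irr[bx1 bx2] /bdd_chi_irr[by1 by2]; rewrite /level_state.
case: c => a b.
have -> : (fun pi => complex.Re (chi_irr pi (fun p => Complex a b *: x p + y p))) =
    fun pi => a * complex.Re (chi_irr pi x) +
      (- b * complex.Im (chi_irr pi x) + complex.Re (chi_irr pi y)).
  apply/funext => pi; rewrite chi_irr_lin.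
  by case: (chi_irr pi x) (chi_irr pi y) => u v [u' v'] /=; ring.
have -> : (fun pi => complex.Im (chi_irr pi (fun p => Complex a b *: x p + y p))) =
    fun pi => a * complex.Im (chi_irr pi x) +
      (b * complex.Re (chi_irr pi x) + complex.Im (chi_irr pi y)).
  apply/funext => pi; rewrite chi_irr_lin.
  by case: (chi_irr pi x) (chi_irr pi y) => u v [u' v'] /=; ring.
rewrite !(mean_lin mE) //; try exact: bdd_lin.
by apply/eqP; rewrite eq_complex /=; apply/andP; split; apply/eqP; ring.
Qed.

Lemma level_stateZ c (x : dualU G) : Wstar x ->
  level_state (fun pi => c *: x pi) = c * level_state x.
Proof.
move=> hx; have := level_state_lin c hx (@Wstar0 _ G).
have -> : (fun pi => c *: x pi + 0) = (fun pi => c *: x pi).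
  by apply: functional_extensionality_dep => pi; rewrite addr0.
move=> ->; have := level_state_lin 0 hx (@Wstar0 _ G).
have := level_state_lin (-1) (@Wstar0 _ G) (@Wstar0 _ G).
have -> : (fun pi : irr G => -1 *: 0 + 0 : 'M[C]_(irr_dim pi)) = fun=> 0.
  by apply: functional_extensionality_dep => pi; rewrite scaler0 addr0.
by rewrite mulN1r addNr => e _; rewrite e addr0.
Qed.

(** Multiplying x by the conjugate of its value z makes the value real, equal to |z|^2, so the bound
    for real functions applies without losing a factor 2. *)
Lemma level_state_le (x : dualU G) : Wstar x ->
  nrm (level_state x : C^o) <= Wnorm x.
Proof.
move=> hx; set z := level_state x.
have [z0|z0] := eqVneq (nrm (z : C^o)) 0; first by rewrite z0 Wnorm_ge0.
have zp : 0 < nrm (z : C^o) by rewrite lt_neqAle eq_sym z0 nrm_ge0.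
have hz : complex.Re (level_state (fun pi => z^* *: x pi)) = nrm (z : C^o) ^+ 2.
  rewrite level_stateZ // -/z sqr_nrm; case: (z) => a b /=; ring.
have hb : `|complex.Re (level_state (fun pi => z^* *: x pi))| <=
    nrm (z : C^o) * Wnorm x.
  apply: (mean_abs mE) => pi; apply: le_trans (Re_le_nrm _) _.
  have -> : chi_irr pi (fun pi => z^* *: x pi) = z^* * chi_irr pi x.
    by rewrite /chi_irr -scalemxAr linearZ /= mulrA.
  have zc : nrm (z^* : C^o) = nrm (z : C^o).
    by apply: (@pexpIrn _ 2); rewrite ?nnegrE ?nrm_ge0 // !sqr_nrm; case: (z) => a b /=; ring.
  rewrite nrmCM zc ler_wpM2l ?nrm_ge0 //.
  exact: le_trans (chi_irr_le _ _) (opnorm_le_Wnorm _ hx).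
move: hb; rewrite hz ger0_norm ?sqr_ge0 // expr2 ler_pM2l //.
Qed.

Lemma level_state_ge0 (x : dualU G) : Wstar x ->
  0 <= level_state (fun pi => (x pi)^t* *m x pi).
Proof.
move=> hx; have [b1 _] := bdd_chi_irr (Wstar_mul (Wstar_adj hx) hx).
have p pi := chi_irr_ge0 pi x.
rewrite /level_state.
have -> : (fun pi => complex.Im (chi_irr pi (fun rho => (x rho)^t* *m x rho))) = fun=> 0.
  by apply/funext => pi; have := p pi; rewrite lecE /= => /andP[/eqP ->].
rewrite (mean0 mE) lecE /= eqxx /=; apply: (mean_ge0 mE) => // pi.
by have := p pi; rewrite lecE /= => /andP[].
Qed.

Lemma level_state_scalar (h : irr G -> R) :
  level_state (fun pi => (h pi)%:C%C%:M) = (E h)%:C%C.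
Proof.
rewrite /level_state.
have e pi : chi_irr pi (fun pi => (h pi)%:C%C%:M) = (h pi)%:C%C by rewrite chi_irr_scalar.
have -> : (fun pi => complex.Re (chi_irr pi (fun pi => (h pi)%:C%C%:M))) = h.
  by apply/funext => pi; rewrite e.
have -> : (fun pi => complex.Im (chi_irr pi (fun pi => (h pi)%:C%C%:M))) = fun=> 0.
  by apply/funext => pi; rewrite e.
by rewrite (mean0 mE).
Qed.

Lemma level_state_kms a (x y : dualU G) : Wstar x -> Wstar y -> eigen a y ->
  (expR a)%:C%C * level_state (fun rho => x rho *m y rho) =
  level_state (fun rho => y rho *m x rho).
Proof.
move=> hx hy ey; rewrite -level_stateZ; last exact: Wstar_mul.
have e pi : chi_irr pi (fun p => (expR a)%:C%C *: (x p *m y p)) =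
    chi_irr pi (fun rho => y rho *m x rho).
  by rewrite -(chi_irr_kms x pi ey) [LHS]/chi_irr -scalemxAr linearZ /= -mulrA.
rewrite /level_state.
by congr (Complex (E _) (E _)); apply/funext => pi; rewrite e.
Qed.

Lemma chi_irr_blk (pi rho : irr G) z : chi_irr pi (@blk _ _ rho z) =
  (\tr (irr_F rho *m z) / dim_q rho) * (pi == rho)%:R.
Proof.
rewrite /chi_irr; have [->|ne] := eqVneq pi rho; first by rewrite blkE mulr1.
by rewrite blk_neq // mulmx0 linear0 mul0r mulr0.
Qed.

Lemma level_state_blk rho z : level_state (@blk _ _ rho z) =
  (E (fun pi => (pi == rho)%:R))%:C%C * (\tr (irr_F rho *m z) / dim_q rho).
Proof.
set w := _ / _; rewrite /level_state.
have b : bdd (fun pi => (pi == rho)%:R : R) by exact: (bdd_bool R (pred1 rho)).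
have e pi : chi_irr pi (@blk _ _ rho z) = w * ((pi == rho)%:R : R)%:C%C.
  by rewrite chi_irr_blk; case: (pi == rho).
have -> : (fun pi => complex.Re (chi_irr pi (@blk _ _ rho z))) =
    fun pi => complex.Re w * (pi == rho)%:R.
  by apply/funext => pi; rewrite e; case: (w) => u v /=; rewrite mulr0 subr0.
have -> : (fun pi => complex.Im (chi_irr pi (@blk _ _ rho z))) =
    fun pi => complex.Im w * (pi == rho)%:R.
  by apply/funext => pi; rewrite e; case: (w) => u v /=; rewrite mulr0 add0r.
rewrite !(meanZ mE) //; case: (w) => u v.
by apply/eqP; rewrite eq_complex /=; apply/andP; split; apply/eqP; ring.
Qed.

End LevelState.

(** * Lipschitz extension and approximation lemmas *)

Section Extension.
Variables (R : realType).
Local Notation C := R[i].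

(** McShane's extension of a 1-Lipschitz function by an infimal convolution, which defines the
    values on a completion without choosing approximating sequences. *)
Lemma mcshane (V : normedModType C) (I : Type) (D : set I) (p : I -> V) (f : I -> R) :
  D !=set0 -> (forall i j, D i -> D j -> `|f i - f j| <= nrm (p i - p j)) ->
  exists F : V -> R, forall b i, D i -> `|F b - f i| <= nrm (b - p i).
Proof.
move=> [i0 Di0] lip; exists (fun b => inf [set f i + nrm (b - p i) | i in D]) => b i Di.
have lb j : D j -> lbound [set f i + nrm (b - p i) | i in D] (f j - nrm (b - p j)).
  move=> Dj _ [k Dk <-]; have := lip j k Dj Dk; rewrite ler_norml.
  have := nrm_tri b (p j) (p k); rewrite (nrmB (p j) b); lra.
have h1 : inf [set f i + nrm (b - p i) | i in D] <= f i + nrm (b - p i).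
  by apply: ge_inf; [exists (f i - nrm (b - p i)); exact: lb|exists i].
have h2 : f i - nrm (b - p i) <= inf [set f i + nrm (b - p i) | i in D].
  by apply: lb_le_inf; [exists (f i0 + nrm (b - p i0)), i0|exact: lb].
by rewrite ler_norml; apply/andP; split; lra.
Qed.

Lemma null_of_small (V : normedModType C) (v : V) (K : R) :
  (forall e : R, 0 < e -> nrm v <= K * e) -> v = 0.
Proof.
move=> h; apply/nrm0_eq0/eqP; rewrite eq_le nrm_ge0 andbT.
apply/ler_addgt0Pr => e e0; rewrite add0r.
have K0 : 0 < `|K| + 1 by rewrite ltr_wpDl.
have e1 : 0 < e / (`|K| + 1) by rewrite divr_gt0.
rewrite (le_trans (h _ e1)) // mulrCA ger_pMr // ler_pdivrMr // mul1r.
by rewrite (le_trans (ler_norm _)) // lerDl.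
Qed.

Lemma ge0_of_approx (z : C) : (forall e : R, 0 < e ->
  exists2 w : C, 0 <= w & nrm (z - w : C^o) <= e) -> 0 <= z.
Proof.
move=> h; have h' e : 0 < e -> `|complex.Im z| <= e /\ - e <= complex.Re z.
  move=> /h[w w0 le]; move: w0; rewrite lecE /= => /andP[/eqP w1 w2].
  have := le_trans (Re_le_nrm _) le; have := le_trans (Im_le_nrm _) le.
  move: w1 w2; case: (z) (w) => a b [a' b'] /= -> a0.
  by rewrite oppr0 addr0 ler_norml => h1; rewrite ler_norml => h2; split; lra.
have i0 : complex.Im z = 0.
  apply/eqP; rewrite -normr_le0; apply/ler_addgt0Pr => e /h'[].
  by rewrite add0r.
rewrite lecE /= i0 eqxx /=; apply/ler_addgt0Pr => e /h'[_]; lra.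
Qed.

Lemma vdiff_scale (V : normedModType C) (g : C -> C^o) (v : V) z :
  vdiff g z -> vdiff (fun x => g x *: v) z.
Proof.
move=> [L hL]; exists (L *: v) => e e0.
have K0 : 0 < nrm v + 1 by rewrite ltr_wpDl ?nrm_ge0.
have [d d0 hd] := hL (e / (nrm v + 1)) ltac:(by rewrite divr_gt0).
exists d => // h /hd le.
have -> : g (z + h) *: v - g z *: v - h *: (L *: v) =
    (g (z + h) - g z - h *: L) *: v.
  by rewrite scalerA -!scalerBl.
rewrite nrmZ (le_trans (ler_wpM2r (nrm_ge0 _) le)) //.
by rewrite mulrAC ler_wpM2r ?nrm_ge0 // mulrAC ler_pdivrMr // ler_pM2l // lerDl.
Qed.

Lemma vdiff_scalel (V : normedModType C) (f : C -> V) c z :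
  vdiff f z -> vdiff (fun x => c *: f x) z.
Proof.
move=> /vdiff_derivable df; apply: derivable_vdiff; exact: derivableZ.
Qed.

Lemma norm_onE (A : cstarAlgType R) (T : set A) (phi : A -> C) :
  (forall b, T b -> nrm (phi b : C^o) <= nrm b) ->
  (forall e : R, 0 < e -> exists b, [/\ T b, nrm b <= 1 & 1 - e <= nrm (phi b : C^o)]) ->
  norm_on T phi = 1.
Proof.
move=> h1 h2; set N := [set complex.Re `|phi x| | x in T `&` [set x | `|x| <= 1]].
have ub : ubound N 1.
  move=> _ [x [Tx x1] <-]; apply: le_trans (h1 _ Tx) _.
  by move: x1; rewrite /= nrmE lecR.
have N0 : N !=set0.
  by have [b [Tb b1 _]] := h2 1 ltr01; exists (nrm (phi b : C^o)), b => //; split => //=; rewrite nrmE lecR.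
apply/eqP; rewrite eq_le ge_sup //=.
apply/ler_addgt0Pr => e /h2[b [Tb b1 hb]]; rewrite -lerBlDr.
apply: le_trans hb _; apply: sup_upper_bound; first by split=> //; exists 1.
by exists b => //; split => //=; rewrite nrmE lecR.
Qed.

End Extension.

(** * Quantized characters from coherent means *)

Section StateOfMeans.
Variables (R : realType) (GG : ind_system R) (B : ind_limit GG).
Variables (tau : R -> B -> B).
Hypothesis htau : induced_flow tau.
Local Notation C := R[i].
Local Notation io := (iota_lim B).
Local Notation S := (frakA B).
Local Notation X := (fun N => irr (GG N)).
Variables (cs : forall n, X n.+1 -> seq (X n)) (cw : forall n, X n.+1 -> X n -> R).
Hypothesis cw0 : forall n (x : X n.+1) y, 0 <= cw x y.
Hypothesis cw1 : forall n (x : X n.+1), \sum_(y <- cs x) cw x y = 1.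
Hypothesis chi_irr_Theta : forall N (pi : irr (GG N.+1)) (x : dualU (GG N)), Wstar x ->
  chi_irr pi (Theta x) = \sum_(rho <- cs pi) (cw pi rho)%:C%C * chi_irr rho x.
Variable E : forall n, (irr (GG n) -> R) -> R.
Arguments E : clear implicits.
Hypothesis hE : coherent (X := X) cs cw E.
Local Opaque Theta tau_hat Wstar Wnorm opnorm.

Let mE n : mean (E n). Proof. by have [h _] := hE. Qed.

Lemma cotrans_Re N (pi : irr (GG N.+1)) (x : dualU (GG N)) : Wstar x ->
  complex.Re (chi_irr pi (Theta x)) =
    cotrans (X := X) cs cw (fun rho => complex.Re (chi_irr rho x)) pi /\
  complex.Im (chi_irr pi (Theta x)) =
    cotrans (X := X) cs cw (fun rho => complex.Im (chi_irr rho x)) pi.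
Proof.
move=> hx; rewrite (chi_irr_Theta _ hx) /cotrans; split.
  elim: (cs pi) => [|rho s ih]; first by rewrite !big_nil.
  rewrite !big_cons -ih; case: (chi_irr rho x) => a b.
  by case: (\sum_(_ <- s) _) => u v /=; rewrite mul0r subr0.
elim: (cs pi) => [|rho s ih]; first by rewrite !big_nil.
rewrite !big_cons -ih; case: (chi_irr rho x) => a b.
by case: (\sum_(_ <- s) _) => u v /=; rewrite mul0r addr0.
Qed.

Lemma level_state_Theta N (x : dualU (GG N)) : Wstar x ->
  level_state (E N.+1) (Theta x) = level_state (E N) x.
Proof.
move=> hx; have [b1 b2] := bdd_chi_irr hx.
rewrite /level_state -(proj2 hE _ _ b1) -(proj2 hE _ _ b2).
have -> : (fun pi => complex.Re (chi_irr pi (Theta x))) =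
    cotrans (X := X) cs cw (fun rho => complex.Re (chi_irr rho x)).
  by apply/funext => pi; have [] := cotrans_Re pi hx.
have -> // : (fun pi => complex.Im (chi_irr pi (Theta x))) =
    cotrans (X := X) cs cw (fun rho => complex.Im (chi_irr rho x)).
by apply/funext => pi; have [] := cotrans_Re pi hx.
Qed.

Lemma level_state_lift K n (x : dualU (GG K)) : (K <= n)%N -> Wstar x ->
  exists y : dualU (GG n), [/\ Wstar y, io y = io x &
    level_state (E n) y = level_state (E K) x].
Proof.
move=> /subnKC <-; elim: (n - K)%N => [|m ih] hx; first by rewrite addn0; exists x.
have [y [hy yx e]] := ih hx; rewrite addnS; exists (Theta y); split.
- exact: (@Wstar_Theta _ _ B).
- by rewrite (iota_Theta B hy).
- by rewrite (level_state_Theta hy).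
Qed.

(** Both families are lifted to a common level, which changes neither their level states nor their
    images in B. *)
Lemma level_state_lip K N (x : dualU (GG K)) (y : dualU (GG N)) :
  Wstar x -> Wstar y ->
  nrm (level_state (E K) x - level_state (E N) y : C^o) <= nrm (io x - io y).
Proof.
move=> hx hy.
have [x' [hx' <- <-]] := level_state_lift (leq_maxl K N) hx.
have [y' [hy' <- <-]] := level_state_lift (leq_maxr K N) hy.
set n := maxn K N in x' hx' y' hy' *.
have e : level_state (E n) x' - level_state (E n) y' =
    level_state (E n) (fun pi => -1 *: y' pi + x' pi).
  by rewrite (level_state_lin (mE n) _ hy' hx') mulN1r addrC.
have e2 : io x' - io y' = io (fun pi => -1 *: y' pi + x' pi).
  by rewrite (iota_linear B (-1) hy' hx') scaleN1r addrC.
have hw := Wstar_lin (-1) hy' hx'.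
rewrite e e2 (nrm_iota B hw); exact: (level_state_le (mE n) hw).
Qed.

(** The factor 2 comes from extending real and imaginary parts separately. This estimate determines
    psi, and linearity, positivity and norm 1 are all derived from it by density. *)
Lemma state_of_mean_ex : exists psi : B -> C, forall b N (x : dualU (GG N)),
  Wstar x -> nrm (psi b - level_state (E N) x : C^o) <= 2 * nrm (b - io x).
Proof.
pose I := {N : nat & dualU (GG N)}.
pose D : set I := [set i | Wstar (tagged i)].
pose p (i : I) : B := io (tagged i).
pose ls (i : I) := level_state (E (tag i)) (tagged i).
have D0 : D !=set0 by exists (existT _ 0%N (fun=> 0)); exact: Wstar0.
have [F1 hF1] : exists F : B -> R, forall b i, D i ->
    `|F b - complex.Re (ls i)| <= nrm (b - p i).
  apply: mcshane D0 _ => i j Di Dj.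
  apply: le_trans (level_state_lip Di Dj); rewrite -raddfB; exact: Re_le_nrm.
have [F2 hF2] : exists F : B -> R, forall b i, D i ->
    `|F b - complex.Im (ls i)| <= nrm (b - p i).
  apply: mcshane D0 _ => i j Di Dj.
  apply: le_trans (level_state_lip Di Dj); rewrite -raddfB; exact: Im_le_nrm.
exists (fun b => Complex (F1 b) (F2 b)) => b N x hx.
have := hF1 b (existT _ N x) hx; have := hF2 b (existT _ N x) hx.
rewrite /ls /p /=; set z := level_state _ _ => h2 h1.
have -> : Complex (F1 b) (F2 b) - z = Complex (F1 b - complex.Re z) (F2 b - complex.Im z).
  by case: (z).
rewrite (le_trans (nrm_Complex _ _)) //; lra.
Qed.

Variable psi : B -> C.
Hypothesis psiP : forall b N (x : dualU (GG N)),
  Wstar x -> nrm (psi b - level_state (E N) x : C^o) <= 2 * nrm (b - io x).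

Lemma psi_iota N (x : dualU (GG N)) : Wstar x -> psi (io x) = level_state (E N) x.
Proof.
move=> hx; apply/eqP; rewrite -subr_eq0; apply/eqP/(@nrm0_eq0 _ C^o)/eqP.
rewrite eq_le nrm_ge0 andbT; apply: le_trans (psiP _ hx) _.
by rewrite subrr nrm0 mulr0.
Qed.

Lemma common_approx (a b : B) (e : R) : 0 < e ->
  exists n (x y : dualU (GG n)), [/\ Wstar x, Wstar y,
    nrm (a - io x) < e & nrm (b - io y) < e].
Proof.
move=> e0; have [K [x [hx xa]]] := iota_denseP a e0.
have [N [y [hy yb]]] := iota_denseP b e0.
have [x' hx' ex] := iota_lift B (leq_maxl K N) hx.
have [y' hy' ey] := iota_lift B (leq_maxr K N) hy.
by exists (maxn K N), x', y'; rewrite ex ey.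
Qed.

Lemma psi_lin c a b : psi (c *: a + b) = c * psi a + psi b.
Proof.
apply/eqP; rewrite -subr_eq0; apply/eqP.
apply: (@null_of_small _ C^o _ (4 * nrm (c : C^o) + 4)) => e e0.
have [n [x [y [hx hy xa yb]]]] := common_approx a b e0.
have hw := Wstar_lin c hx hy.
have -> : psi (c *: a + b) - (c * psi a + psi b) =
    (psi (c *: a + b) - level_state (E n) (fun pi => c *: x pi + y pi)) -
    (c * (psi a - level_state (E n) x) + (psi b - level_state (E n) y)).
  rewrite (level_state_lin (mE n) _ hx hy); ring.
rewrite (le_trans (nrmD _ _)) // nrmN.
have h1 := psiP (c *: a + b) hw.
have h2 : nrm (c *: a + b - io (fun pi => c *: x pi + y pi)) <= nrm (c : C^o) * e + e.
  rewrite (iota_linear B c hx hy) opprD addrACA -scalerBr.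
  rewrite (le_trans (nrmD _ _)) // nrmZ lerD //; last exact: ltW.
  by rewrite ler_wpM2l ?nrm_ge0 // ltW.
have h3 : nrm (c * (psi a - level_state (E n) x) + (psi b - level_state (E n) y) : C^o)
    <= nrm (c : C^o) * (2 * e) + 2 * e.
  rewrite (le_trans (nrmD _ _)) // nrmCM lerD //.
    rewrite ler_wpM2l ?nrm_ge0 // (le_trans (psiP a hx)) // ler_pM2l // ltW //.
  by rewrite (le_trans (psiP b hy)) // ler_pM2l // ltW.
have -> : (4 * nrm (c : C^o) + 4) * e = 2 * (nrm (c : C^o) * e + e) +
    (nrm (c : C^o) * (2 * e) + 2 * e) by ring.
rewrite lerD //; apply: le_trans h1 _; by rewrite ler_pM2l.
Qed.

Lemma psi_le b : nrm (psi b : C^o) <= nrm b.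
Proof.
apply/ler_addgt0Pr => e e0; have e3 : 0 < e / 3 by rewrite divr_gt0.
have [N [x [hx xb]]] := iota_denseP b e3.
have h1 := psiP b hx; have h2 := level_state_le (mE N) hx.
have h3 : nrm (io x) <= nrm b + nrm (b - io x).
  by have := nrm_tri b (io x) 0; rewrite !subr0 nrmB; lra.
have h4 : nrm (psi b : C^o) <= nrm (psi b - level_state (E N) x : C^o) +
    nrm (level_state (E N) x : C^o).
  by have := @nrm_tri _ C^o (level_state (E N) x) (psi b) 0; rewrite !subr0.
by move: h3 h2; rewrite (nrm_iota B hx); lra.
Qed.

Lemma psiB a b : psi (a - b) = psi a - psi b.
Proof. by rewrite addrC -scaleN1r psi_lin mulN1r addrC. Qed.

Lemma psi_ge0 b : 0 <= psi (cstar b ** b).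
Proof.
(* An approximant x within 1 of b has norm at most |b| + 1, and b^* b differs from x^* x by at most
   |b - x| (|b| + |x|). *)
apply: ge0_of_approx => e e0; pose K := 2 * nrm b + 1.
have K0 : 0 < K by rewrite /K ltr_wpDl // mulr_ge0 ?nrm_ge0.
have d0 : 0 < Num.min 1 (e / K) by rewrite lt_min ltr01 divr_gt0.
have [N [x [hx xb]]] := iota_denseP b d0.
move: xb; rewrite lt_min => /andP[xb1 xb2].
exists (psi (cstar (io x) ** io x)).
  rewrite -(iota_star B hx) -(iota_mul B (Wstar_adj hx) hx).
  rewrite (psi_iota (Wstar_mul (Wstar_adj hx) hx)).
  exact: level_state_ge0.
rewrite -psiB (le_trans (psi_le _)) //.
have -> : cstar b ** b - cstar (io x) ** io x =
    cstar b ** (b - io x) + cstar (b - io x) ** io x.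
  by rewrite cmulBr cstarB cmulBl addrA subrK.
rewrite (le_trans (nrmD _ _)) // (le_trans (lerD (nrm_cmul _ _) (nrm_cmul _ _))) //.
rewrite !nrm_cstar.
have xb : nrm (io x) <= nrm b + 1.
  by have := nrm_tri b (io x) 0; rewrite !subr0 nrmB; lra.
have h : nrm (b - io x) * K <= e by rewrite -ler_pdivlMr // ltW.
apply: le_trans h; rewrite mulrC -mulrDr ler_wpM2l ?nrm_ge0 // /K; lra.
Qed.

Lemma psi_eigen_kms N (y : dualU (GG N)) a x : Wstar y -> eigen a y ->
  eigen_span (B := B) x -> (expR a)%:C%C * psi (x ** io y) = psi (io y ** x).
Proof.
move=> hy ey; move: x; apply: lspan_ind.
  split; first by rewrite /= cmul0l cmul0r -[0]subr0 psiB subrr mulr0.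
  move=> c u v /= hu hv; rewrite cmul_linearl cmul_linearr !psi_lin mulrDr hv.
  by rewrite mulrCA hu.
move=> _ [K [x [b [cx -> _]]]] /=; have hx := CG_Wstar cx.
have [x' hx' <-] := iota_lift B (leq_maxl K N) hx.
have [y' hy' eyy] := iota_lift B (leq_maxr K N) hy.
have ey' : eigen a y'.
  by apply/(eigen_tau htau a hy') => t; rewrite eyy; apply: (eigen_tau htau a hy).2.
rewrite -eyy -(iota_mul B hx' hy') -(iota_mul B hy' hx').
rewrite (psi_iota (Wstar_mul hx' hy')) (psi_iota (Wstar_mul hy' hx')).
exact: (level_state_kms _ hx' hy' ey').
Qed.

(** On an eigenvector y of frequency a the orbit extends to e^(iaz) y, with value e^a y at -i; sums
    of such orbits serve all of [eigen_span]. *)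
Lemma psi_KMS : KMS S tau (-1) psi.
Proof.
exists (eigen_span (B := B)); split.
- exact: (eigen_span_star_subalg htau).
- exact: eigen_span_frakA.
- exact: (frakA_closure htau).
- by move=> t y; exact: (eigen_span_tau htau).
apply: lspan_ind; first split.
- exists (fun=> 0) => [|x _]; last by rewrite cmul0l cmul0r.
  split=> [t|_|z]; first by rewrite (star_hom0 (tau_hom htau t)).
    exact: frakA0.
  exact: (vdiff_derivable (vdiff_cst _ _)).
- move=> c u v [f of1 hf] [g og1 hg]; have [f1 f2 f3] := of1; have [g1 g2 g3] := og1.
  exists (fun z => c *: f z + g z) => [|x hx]; last first.
    by rewrite cmul_linearl cmul_linearr !psi_lin hf ?hg.
  split=> [t|z|z]; first by rewrite (star_hom_lin (tau_hom htau t)) f1 g1.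
    exact: frakA_lin.
  apply: vdiff_derivable; apply: vdiffD.
    exact: (vdiff_scalel c (derivable_vdiff (f3 z))).
  exact: (derivable_vdiff (g3 z)).
move=> _ [N [y [a [cy -> ey]]]]; have hy := CG_Wstar cy.
exists (fun z => cexp (Complex 0 a * z) *: io y) => [|x hx].
  split=> [t|z|z].
  - rewrite ((eigen_tau htau a hy).2 ey t).
    have -> : Complex 0 a * t%:C%C = Complex 0 (t * a) :> C.
      by apply/eqP; rewrite eq_complex /=; apply/andP; split; apply/eqP; ring.
    by rewrite cexp_imag.
  - by apply: frakAZ; exact: (frakA_CG cy).
  - exact: (vdiff_derivable (vdiff_scale _ (vdiff_cexp_lin _ _))).
have -> : Complex 0 a * Complex 0 (-1) = a%:C%C :> C.
  by apply/eqP; rewrite eq_complex /=; apply/andP; split; apply/eqP; ring.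
have psi0 : psi 0 = 0 by have := psiB 0 0; rewrite !subrr.
by rewrite cexp_real -(psi_eigen_kms hy ey hx) cmulZr -[_ *: _]addr0 psi_lin psi0 addr0.
Qed.

(** By tightness, the projection onto finitely many blocks of almost full mass nearly attains the
    norm. *)
Lemma psi_Cstar_norm N (e : R) : 0 < e -> exists b,
  [/\ Cstar_in B N b, nrm b <= 1 & 1 - e <= nrm (psi b : C^o)].
Proof.
move=> e0; have [_ _ _ ht] := mE N; have [s hs] := ht e e0.
pose h (rho : irr (GG N)) : R := (rho \in s)%:R.
pose x : dualU (GG N) := fun rho => (h rho)%:C%C%:M.
have cx : CG x.
  apply: (@sub_finite_set _ _ [set` s]); last by apply/finite_seqP; exists s.
  move=> rho /=; apply: contraNT => rs.
  by rewrite /x /h (negPf rs); apply/eqP/matrixP => i j; rewrite !mxE mul0rn.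
have hx := CG_Wstar cx.
exists (io x); split; first by exists x => //; exact: CG_Cstar.
  rewrite (nrm_iota B hx); apply: Wnorm_le => // rho; rewrite /x /h.
  case: (rho \in s); first by exact: opnorm1.
  have -> : (false%:R : R)%:C%C%:M = 0 :> 'M[C]_(irr_dim rho) by apply/matrixP => i j; rewrite !mxE mul0rn.
  by rewrite opnorm0.
rewrite (psi_iota hx) (level_state_scalar (mE N)) nrm_real.
apply: le_trans (ler_norm _).
have : E N h + E N (fun rho => (rho \notin s)%:R) = 1.
  rewrite -(meanD (mE N)); first last.
  - exact: (bdd_bool R [pred rho | rho \notin s]).
  - exact: (bdd_bool R (mem s)).
  rewrite -[RHS](mean_cst (mE N)); congr (E N _); apply/funext => rho.
  by rewrite /h; case: (rho \in s); rewrite /= ?addr0 ?add0r.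
lra.
Qed.

Lemma psi_Ch : Ch B tau psi.
Proof.
have nS N : norm_on (Cstar_in B N) psi = 1.
  by apply: norm_onE => [b _|e e0]; [exact: psi_le|exact: psi_Cstar_norm].
split=> //; last exact: psi_KMS.
split=> [c x y _ _|x _|]; first exact: psi_lin.
  exact: psi_ge0.
apply: norm_onE => [b _|e e0]; first exact: psi_le.
have [b [[x hx <-] b1 hb]] := psi_Cstar_norm 0 e0.
by exists (io x); split=> //; exact: frakA_Cstar.
Qed.

End StateOfMeans.

Section Agreement.
Variables (R : realType) (GG : ind_system R) (B : ind_limit GG).
Variables (tau : R -> B -> B).
Hypothesis htau : induced_flow tau.
Local Notation C := R[i].
Local Notation io := (iota_lim B).
Local Notation S := (frakA B).

Lemma frakA_functional_eq (L M : B -> C) (K : R) :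
  linear_on S L -> linear_on S M ->
  (forall b, S b -> nrm (L b : C^o) <= K * nrm b) ->
  (forall b, S b -> nrm (M b : C^o) <= K * nrm b) ->
  (forall N (rho : irr (GG N)) z, L (io (@blk _ _ rho z)) = M (io (blk z))) ->
  forall b, S b -> L b = M b.
Proof.
move=> Ll Ml LK MK LM; apply: (frakA_limit (D := eigen_span (B := B)) _ _ Ll Ml LK MK).
- exact: (frakA_closure htau).
- exact: eigen_span_frakA.
have lin0 (F : B -> C) : linear_on S F -> F 0 = 0.
  move=> Fl; have := Fl (-1) 0 0 (@frakA0 _ _ B) (@frakA0 _ _ B).
  by rewrite scaler0 addr0 mulN1r addNr.
move=> d; suff : eigen_span (B := B) `<=` [set d | S d /\ L d = M d] by move=> h /h[].
apply: lspan_ind.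
  split; first by split; [exact: frakA0|rewrite (lin0 _ Ll) (lin0 _ Ml)].
  move=> c x y [Sx ex] [Sy ey]; split; first exact: frakA_lin.
  by rewrite Ll // Ml // ex ey.
move=> _ [N [x [a [cx -> _]]]]; split; first exact: (frakA_CG cx).
have [s [_ ->]] := CG_decomp cx.
have [_ ->] := iota_sum B s (fun rho => Wstar_blk (x rho)).
have Sb rho : S (io (blk (x rho))) by apply: frakA_CG; exact: CG_blk.
suff : S (\sum_(rho <- s) io (blk (x rho))) /\
  L (\sum_(rho <- s) io (blk (x rho))) = M (\sum_(rho <- s) io (blk (x rho))) by case.
elim: s => [|rho s [ih1 ih2]].
  by rewrite !big_nil !lin0 //; split=> //; exact: frakA0.
rewrite !big_cons; split; first exact: frakAD.
by rewrite -[io _]scale1r Ll // Ml // LM ih2.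
Qed.

End Agreement.

(** * Means from quantized characters *)

Section MeanAgreement.
Variables (R : realType) (X : choiceType).
Implicit Types E : (X -> R) -> R.

Lemma linear_mean_sum E (s : seq X) (c : X -> R) :
  (forall c f g, bdd f -> bdd g -> E (fun x => c * f x + g x) = c * E f + E g) ->
  E (fun x => \sum_(y <- s) c y * (x == y)%:R) =
    \sum_(y <- s) c y * E (fun x => (x == y)%:R).
Proof.
move=> El; elim: s => [|y s ih].
  rewrite big_nil; have := El (-1) _ _ (bdd_cst X 0) (bdd_cst X 0).
  have -> : (fun _ : X => -1 * 0 + 0) = fun=> 0 :> R by apply/funext => x; rewrite mulr0 addr0.
  have -> : (fun x => \sum_(y <- [::]) c y * (x == y)%:R) = fun _ : X => 0 :> R.
    by apply/funext => x; rewrite big_nil.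
  lra.
rewrite big_cons -ih -El; first by congr E; apply/funext => x; rewrite big_cons.
  exact: (bdd_bool R (pred1 y)).
by apply: bdd_sum => z; apply: bddZ; exact: (bdd_bool R (pred1 z)).
Qed.

Lemma sum_pred1 (s : seq X) (c : X -> R) x : uniq s ->
  \sum_(y <- s) c y * (x == y)%:R = c x * (x \in s)%:R.
Proof.
elim: s => [|y s ih] /=; first by rewrite big_nil mulr0.
move=> /andP[ys us]; rewrite big_cons ih // inE.
have [->|ne] := eqVneq x y; last by rewrite mulr0 add0r.
by rewrite (negPf ys) mulr0 addr0.
Qed.

Variables E1 E2 : (X -> R) -> R.
Hypothesis mE1 : mean E1.
Hypothesis E2_lin : forall c f g, bdd f -> bdd g ->
  E2 (fun x => c * f x + g x) = c * E2 f + E2 g.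
Hypothesis E2_ge0 : forall f, bdd f -> (forall x, 0 <= f x) -> 0 <= E2 f.
Hypothesis E2_1 : E2 (fun=> 1) = 1.
Hypothesis E12 : forall x, E1 (fun y => (y == x)%:R) = E2 (fun y => (y == x)%:R).

(** Tightness of E2 is not assumed: the two functionals agree on finitely supported functions and on
    1, hence on complements of finite sets, so E2 inherits tightness from E1. *)
Lemma mean_agree f : bdd f -> E1 f = E2 f.
Proof.
have [E1_lin E1_ge0 E1_1 E1_t] := mE1.
have fin s c : uniq s ->
    E1 (fun x => c x * (x \in s)%:R) = E2 (fun x => c x * (x \in s)%:R).
  move=> us.
  have -> : (fun x => c x * (x \in s)%:R) = fun x => \sum_(y <- s) c y * (x == y)%:R.
    by apply/funext => x; rewrite sum_pred1.
  rewrite !linear_mean_sum //; apply: eq_bigr => y _; by rewrite E12.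
have compl s : uniq s -> E2 (fun x => (x \notin s)%:R) = E1 (fun x => (x \notin s)%:R).
  move=> us; have := fin s (fun=> 1) us.
  have b1 : bdd (fun x => 1 * (x \in s)%:R : R).
    by apply: bddZ; exact: (bdd_bool R (mem s)).
  have -> : (fun x => (x \notin s)%:R) = fun x => -1 * (1 * (x \in s)%:R) + 1 :> R.
    by apply/funext => x; case: (x \in s); rewrite /= ?mulr1 ?mulr0 ?addNr ?add0r.
  rewrite E1_lin ?E2_lin //; try exact: bdd_cst.
  by rewrite E1_1 E2_1 => ->.
have mE2 : mean E2.
  split=> // e e0; have [s hs] := E1_t e e0; exists (undup s).
  rewrite compl ?undup_uniq //.
  by have -> : (fun x => (x \notin undup s)%:R) = fun x => (x \notin s)%:R :> R
    by apply/funext => x; rewrite mem_undup.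
move=> [c hc]; have bf : bdd f by exists c.
apply/eqP; rewrite -subr_eq0 -normr_le0; apply/ler_addgt0Pr => e e0; rewrite add0r.
have c0 : 0 < 2 * (`|c| + 1) by rewrite mulr_gt0 // ltr_wpDl.
have [s hs] := E1_t _ (divr_gt0 e0 c0).
pose u := undup s; have us : uniq u := undup_uniq s.
pose g x : R := f x * (x \in u)%:R; pose h x : R := f x * (x \notin u)%:R.
have bu : bdd (fun x => (x \in u)%:R : R) by exact: (bdd_bool R (mem u)).
have bnu : bdd (fun x => (x \notin u)%:R : R) by exact: (bdd_bool R [pred x | x \notin u]).
have bg : bdd g by exact: bddM.
have bh : bdd h by exact: bddM.
have fE : f = fun x => g x + h x.
  by apply/funext => x; rewrite /g /h; case: (x \in u); rewrite /= ?mulr1 ?mulr0 ?addr0 ?add0r.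
have small E : mean E -> E (fun x => (x \notin u)%:R) <= e / (2 * (`|c| + 1)) ->
    `|E h| <= e / 2.
  move=> mE le; have c1 : 0 < `|c| + 1 by rewrite ltr_wpDl.
  have hle x : `|h x| <= (`|c| + 1) * (x \notin u)%:R.
    rewrite normrM [`|_%:R|]ger0_norm // ler_wpM2r //.
    by rewrite (le_trans (hc x)) // (le_trans (ler_norm _)) // lerDl.
  have bnd : E (fun x => (`|c| + 1) * (x \notin u)%:R) <= e / 2.
    rewrite (meanZ mE) // -ler_pdivlMl //; apply: le_trans le _.
    rewrite le_eqVlt; apply/orP; left; apply/eqP; field; exact: lt0r_neq0.
  rewrite ler_norml; apply/andP; split; last first.
    apply: le_trans bnd; apply: (mean_le mE) => // [|x]; first exact: bddZ.
    by have := hle x; rewrite ler_norml => /andP[].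
  rewrite lerNl; apply: le_trans bnd.
  have -> : - E h = E (fun x => -1 * h x) by rewrite (meanZ mE) // mulN1r.
  apply: (mean_le mE) => // [||x]; [exact: bddZ|exact: bddZ|].
  by have := hle x; rewrite ler_norml mulN1r; lra.
have hu : E1 (fun x => (x \notin u)%:R) <= e / (2 * (`|c| + 1)).
  by have -> : (fun x => (x \notin u)%:R) = fun x => (x \notin s)%:R :> R
    by apply/funext => x; rewrite mem_undup.
have s1 := small _ mE1 hu; have s2 : `|E2 h| <= e / 2 by apply: small => //; rewrite compl.
rewrite fE (meanD mE1) // (meanD mE2) // (fin u f us) -/g.
have -> : E2 g + E1 h - (E2 g + E2 h) = E1 h - E2 h by ring.
by rewrite (le_trans (ler_normB _ _)) //; lra.
Qed.

End MeanAgreement.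

Section MeansOfState.
Variables (R : realType) (GG : ind_system R) (B : ind_limit GG).
Variables (tau : R -> B -> B).
Hypothesis htau : induced_flow tau.
Hypothesis triv0 : trivial_cqg (GG 0%N).
Local Notation C := R[i].
Local Notation io := (iota_lim B).
Local Notation S := (frakA B).
Local Notation X := (fun N => irr (GG N)).
Variable chi : B -> C.
Hypothesis hchi : Ch B tau chi.
Local Notation weight := (weight (B := B) chi).
Local Opaque Theta tau_hat Wstar Wnorm opnorm.

Definition cutoff (G : ucqg R) (s : seq (irr G)) (x : dualU G) : dualU G :=
  fun pi => \sum_(rho <- s) blk (x rho) pi.

Lemma cutoffE (G : ucqg R) (s : seq (irr G)) (x : dualU G) pi : uniq s ->
  cutoff s x pi = if pi \in s then x pi else 0.
Proof.
rewrite /cutoff; elim: s => [|rho s ih] /=; first by rewrite big_nil.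
move=> /andP[rs us]; rewrite big_cons ih // inE.
have [e|ne] := eqVneq pi rho; last by rewrite blk_neq // add0r.
by subst pi; rewrite blkE (negPf rs) addr0.
Qed.

Lemma chi_cutoff N (s : seq (irr (GG N))) (x : dualU (GG N)) :
  [/\ Wstar (cutoff s x), S (io (cutoff s x)) &
    chi (io (cutoff s x)) = \sum_(rho <- s) (weight rho)%:C%C * chi_irr rho x].
Proof.
have [h1 h2] := iota_sum B s (fun rho => Wstar_blk (x rho)).
have Sb rho : S (io (blk (x rho))) by apply: frakA_CG; exact: CG_blk.
have [h3 h4] := chi_sum hchi s (fun rho => Sb rho).
split; first exact: h1.
  by rewrite /cutoff h2.
rewrite /cutoff h2 h4; apply: eq_bigr => rho _.
by rewrite (chi_iota_blk htau triv0 hchi) (proj1 (weightE hchi rho)).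
Qed.

Lemma chi_irr1 (G : ucqg R) (rho : irr G) : chi_irr rho (fun pi => 1%:M) = 1.
Proof. by rewrite (chi_irr_scalar rho (fun=> 1)). Qed.

Lemma chi_cutoff1 N (s : seq (irr (GG N))) :
  chi (io (cutoff s (fun=> 1%:M))) = (\sum_(rho <- s) weight rho)%:C%C.
Proof.
have [_ _ ->] := chi_cutoff s (fun=> 1%:M); rewrite rmorph_sum /=.
by apply: eq_bigr => rho _; rewrite chi_irr1 mulr1.
Qed.

Lemma chi_cone_le1 : exists2 c : R, chi cone = c%:C%C & c <= 1.
Proof.
have := chi_pos hchi (frakA1 triv0); rewrite (cstar1) cmul1l => h.
have e : chi cone = (complex.Re (chi cone))%:C%C by rewrite RRe_real // ger0_real.
exists (complex.Re (chi cone)) => //.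
apply: le_trans (ler_norm _) _; apply: le_trans (Re_le_nrm _) _.
apply: le_trans (chi_le hchi (frakA1 triv0)) _.
rewrite -(iota_one B 0%N) (nrm_iota B (@Wstar1 _ _)); apply: Wnorm_le => // pi.
exact: opnorm1.
Qed.

(* For a projection x, the part of x outside s is again a projection. *)
Lemma chi_outside N (s : seq (irr (GG N))) (x : dualU (GG N)) : uniq s ->
  Wstar x -> S (io x) -> (fun pi => (x pi)^t* *m x pi) = x ->
  0 <= chi (io x) - chi (io (cutoff s x)).
Proof.
move=> us hx Sx px; have [hc Sc _] := chi_cutoff s x.
have e : io (fun pi => -1 *: cutoff s x pi + x pi) = io x - io (cutoff s x).
  by rewrite (iota_linear B (-1) hc hx) scaleN1r addrC.
have hw := Wstar_lin (-1) hc hx.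
rewrite -(chiB hchi Sx Sc) -e; apply: (chi_iota_proj hchi) => //.
  by rewrite e; exact: frakAB.
apply: fam_ext => pi; rewrite cutoffE //; case: ifP => _.
  by rewrite scaleN1r addNr mulmx0.
by rewrite scaler0 add0r; exact: (congr1 (fun f : dualU _ => f pi) px).
Qed.

Lemma weight_sum_le N (s : seq (irr (GG N))) : uniq s ->
  (\sum_(rho <- s) weight rho)%:C%C <= chi cone.
Proof.
move=> us; rewrite -chi_cutoff1 -subr_ge0 -(iota_one B N); apply: chi_outside => //.
- exact: Wstar1.
- by rewrite (iota_one B N); exact: frakA1.
- by apply: fam_ext => pi; rewrite ct1 mulmx1.
Qed.

Lemma weight_sum_le1 N (s : seq (irr (GG N))) : uniq s ->
  \sum_(rho <- s) weight rho <= 1.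
Proof.
move=> /weight_sum_le; have [c -> c1] := chi_cone_le1; rewrite lecR => h.
exact: le_trans h c1.
Qed.

(* The only use of the normalization of chi on C^*(G_N). *)
Lemma weight_tightS N (e : R) : (1 <= N)%N -> 0 < e ->
  exists2 s : seq (irr (GG N)), uniq s & 1 - e <= \sum_(rho <- s) weight rho.
Proof.
move=> N1 e0; have e3 : 0 < e / 3 by rewrite divr_gt0.
have [_ _ /(_ N N1) n1] := hchi.
have [b [x cx xb] [b1 hb]] : exists2 b, Cstar_in B N b &
    nrm b <= 1 /\ 1 - e / 3 < nrm (chi b : C^o).
  apply: contrapT => no.
  have : norm_on (Cstar_in B N) chi <= 1 - e / 3.
    apply: ge_sup.
      apply/set0P/negP => /eqP E0; move: n1; rewrite /norm_on E0 sup0 => /esym/eqP.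
      by rewrite oner_eq0.
    move=> _ [b [Sb b1] <-]; rewrite leNgt; apply/negP => h; apply: no.
    exists b => //; split=> //; by move: b1; rewrite /= nrmE lecR.
  by rewrite n1; lra.
have [hx /(_ _ e3)[y cy xy]] := cx.
have hy := CG_Wstar cy; have [s [us ys]] := CG_decomp cy.
exists s => //; set p := \sum_(rho <- s) _.
have p0 : 0 <= p by apply: sumr_ge0 => rho _; exact: (proj2 (weightE hchi rho)).
have hxy : nrm (io x - io y) <= e / 3.
  have -> : io x - io y = io (fun pi => x pi - y pi).
    have := iota_linear B (-1) hy hx; rewrite scaleN1r addrC => <-.
    by congr io; apply: fam_ext => pi; rewrite scaleN1r addrC.
  have hw : Wstar (fun pi => x pi - y pi).
    have := Wstar_lin (-1) hy hx; congr Wstar; apply: fam_ext => pi.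
    by rewrite scaleN1r addrC.
  by rewrite (nrm_iota B hw) ltW.
have Sx : S (io x) by exact: frakA_Cstar.
have Sy : S (io y) by exact: (frakA_CG cy).
have h1 : 1 - e / 3 - e / 3 <= nrm (chi (io y) : C^o).
  have := @nrm_tri _ C^o (chi (io y)) (chi (io x)) 0.
  rewrite !subr0 -(chiB hchi Sx Sy).
  have := chi_le hchi (frakAB Sx Sy); move: hb; rewrite -xb; lra.
have hyn : nrm (io y) <= 1 + e / 3.
  have := nrm_tri (io x) (io y) 0; rewrite !subr0 nrmB; move: b1; rewrite -xb; lra.
have h2 : nrm (chi (io y) : C^o) <= p * (1 + e / 3).
  have -> : y = cutoff s y by [].
  have [_ _ ->] := chi_cutoff s y; rewrite (le_trans (nrm_sum _ _ _)) // /p mulr_suml.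
  apply: ler_sum => rho _; have w0 := proj2 (weightE hchi rho).
  rewrite nrmCM nrm_real ger0_norm // ler_wpM2l //.
  apply: le_trans hyn; rewrite (nrm_iota B hy).
  exact: le_trans (chi_irr_le _ _) (opnorm_le_Wnorm _ hy).
(* The product on the left is 1 - 2e/3 - e^2/3, below the lower bound 1 - 2e/3 for |chi (io y)|. *)
have h3 : (1 - e) * (1 + e / 3) <= p * (1 + e / 3).
  apply: le_trans (le_trans h1 h2).
  have -> : (1 - e) * (1 + e / 3) = 1 - e / 3 - e / 3 - e ^+ 2 / 3 by field.
  by rewrite lerBlDr lerDl divr_ge0 // sqr_ge0.
by rewrite ler_pM2r // in h3; rewrite ltr_wpDl // ltW.
Qed.

Lemma chi_cone : chi cone = 1.
Proof.
have [c e c1] := chi_cone_le1; rewrite e; congr (_%:C%C).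
apply/eqP; rewrite eq_le c1 /=; apply/ler_addgt0Pr => d d0.
have [s us hs] := weight_tightS (leqnn 1) d0.
by have := weight_sum_le us; rewrite e lecR; lra.
Qed.

(** The norm condition starts at level 1; at level 0 the unit is finitely supported, so its value 1
    is a finite sum of weights. *)
Lemma weight_tight N (e : R) : 0 < e ->
  exists2 s : seq (irr (GG N)), uniq s & 1 - e <= \sum_(rho <- s) weight rho.
Proof.
case: N => [|N]; last exact: weight_tightS.
move=> e0; have [s [us es]] := CG_decomp (trivial_CG triv0 (fun=> 1%:M)).
exists s => //.
have : (\sum_(rho <- s) weight rho)%:C%C = 1 :> C.
  rewrite -chi_cutoff1 -[RHS]chi_cone -(iota_one B 0%N).
  by congr (chi (io _)); exact: esym es.
by move=> /(congr1 (@complex.Re R)) /= ->; rewrite lerBlDr lerDl ltW.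
Qed.

Lemma means_ex : exists E : forall n, (irr (GG n) -> R) -> R,
  forall n, mean (@E n) /\ forall rho, E n (fun y => (y == rho)%:R) = weight rho.
Proof.
have h n := cid (mean_of_weights (fun rho => proj2 (weightE hchi rho))
  (@weight_sum_le1 n) (@weight_tight n)).
by exists (fun n => sval (h n)) => n; exact: (svalP (h n)).
Qed.

End MeansOfState.

(** * Coherence and extremality of the means of a character *)

Section CoherentMeansOfState.
Variables (R : realType) (GG : ind_system R) (B : ind_limit GG).
Variables (tau : R -> B -> B).
Hypothesis htau : induced_flow tau.
Hypothesis triv0 : trivial_cqg (GG 0%N).
Local Notation C := R[i].
Local Notation io := (iota_lim B).
Local Notation S := (frakA B).
Local Notation X := (fun N => irr (GG N)).
Variables (cs : forall n, X n.+1 -> seq (X n)) (cw : forall n, X n.+1 -> X n -> R).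
Hypothesis cw0 : forall n (x : X n.+1) y, 0 <= cw x y.
Hypothesis cw1 : forall n (x : X n.+1), \sum_(y <- cs x) cw x y = 1.
Hypothesis chi_irr_Theta : forall N (pi : irr (GG N.+1)) (x : dualU (GG N)), Wstar x ->
  chi_irr pi (Theta x) = \sum_(rho <- cs pi) (cw pi rho)%:C%C * chi_irr rho x.
Variable chi : B -> C.
Hypothesis hchi : Ch B tau chi.
Local Notation weight := (weight (B := B) chi).
Variable E : forall n, (irr (GG n) -> R) -> R.
Arguments E : clear implicits.
Hypothesis mE : forall n, mean (E n).
Hypothesis E_ind : forall n rho, E n (fun y => (y == rho)%:R) = weight rho.
Local Opaque Theta tau_hat Wstar Wnorm opnorm.
Local Notation down := (cotrans (X := X) cs cw).

Lemma chi_irr_blk1 (G : ucqg R) (pi rho : irr G) :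
  chi_irr pi (@blk _ _ rho 1%:M) = ((pi == rho)%:R : R)%:C%C.
Proof.
rewrite chi_irr_blk mulmx1 divff; last exact: dim_q_neq0.
by rewrite mul1r; case: (pi == rho).
Qed.

Lemma cotrans_ind N (rho : irr (GG N)) pi :
  chi_irr pi (Theta (@blk _ _ rho 1%:M)) = (down (fun y => (y == rho)%:R) pi)%:C%C.
Proof.
rewrite (chi_irr_Theta _ (Wstar_blk _)) /cotrans rmorph_sum /=.
by apply: eq_bigr => sigma _; rewrite chi_irr_blk1 rmorphM.
Qed.

(* Compare chi on y = Theta(1_rho) and on 1 - y with their cutoffs to a finite
   set of large weight; both errors are at most the missing weight. *)
Lemma mean_cotrans_ind N (rho : irr (GG N)) :
  E N.+1 (down (fun y => (y == rho)%:R)) = weight rho.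
Proof.
set f := down _; pose y := Theta (@blk _ _ rho 1%:M).
have f01 pi : 0 <= f pi <= 1.
  have ind01 (sigma : irr (GG N)) : 0 <= ((sigma == rho)%:R : R) <= 1 by case: (sigma == rho); rewrite /= ?lexx ?ler01.
  apply/andP; split; first by apply: cotrans_ge0 => // sigma; case/andP: (ind01 sigma).
  rewrite -[leRHS](cotrans_cst cw1 1 pi); apply: cotrans_le => // sigma.
  by case/andP: (ind01 sigma).
have bf : bdd f.
  by exists 1 => pi; rewrite ger0_norm; case/andP: (f01 pi).
have hb := Wstar_blk (1%:M : 'M[C]_(irr_dim rho)).
have hy : Wstar y by exact: (@Wstar_Theta _ _ B).
have ioy : io y = io (@blk _ _ rho 1%:M) by exact: (iota_Theta B hb).
have Sy : S (io y) by rewrite ioy; apply: frakA_CG; exact: CG_blk.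
have py : (fun pi => (y pi)^t* *m y pi) = y.
  have h := Theta_mul B (Wstar_adj hb) hb; rewrite (Theta_star B hb) in h.
  apply: etrans (esym h) _; congr Theta; apply: fam_ext => pi.
  by rewrite -blk_adj -blkM ct1 mulmx1.
apply/eqP; rewrite -subr_eq0 -normr_le0; apply/ler_addgt0Pr => e e0; rewrite add0r.
have [s us hs] := weight_tight htau triv0 hchi N.+1 e0.
set p := \sum_(sigma <- s) _ in hs.
pose q := \sum_(sigma <- s) weight sigma * f sigma.
have [hc Sc hcut] := chi_cutoff htau triv0 hchi s y.
have cutq : chi (io (cutoff s y)) = q%:C%C.
  rewrite hcut rmorph_sum /=; apply: eq_bigr => sigma _.
  by rewrite rmorphM /= -cotrans_ind.
have chiy : chi (io y) = (weight rho)%:C%C by rewrite ioy (proj1 (weightE hchi rho)).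
have w1 : q <= weight rho.
  have := chi_outside htau triv0 hchi us hy Sy py.
  by rewrite chiy cutq -rmorphB ler0c subr_ge0.
have w2 : weight rho - q <= 1 - p.
  pose z : dualU (GG N.+1) := fun pi => -1 *: y pi + 1%:M.
  have hz : Wstar z := Wstar_lin (-1) hy (@Wstar1 _ _).
  have ioz : io z = cone - io y.
    rewrite /z (iota_linear B (-1) hy (@Wstar1 _ _)) (iota_one B N.+1) scaleN1r.
    by rewrite addrC.
  have Sz : S (io z) by rewrite ioz; apply: frakAB => //; exact: frakA1.
  have pz : (fun pi => (z pi)^t* *m z pi) = z.
    apply: fam_ext => pi.
    have pyp : (y pi)^t* *m y pi = y pi by exact: (congr1 (fun f : dualU _ => f pi) py).
    have sy : (y pi)^t* = y pi by rewrite -pyp ctM trmxCK.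
    have yy : y pi *m y pi = y pi by rewrite -{1}sy.
    have -> : z pi = 1%:M - y pi by rewrite /z scaleN1r addrC.
    by rewrite ctB ct1 sy mulmxBr mulmx1 mulmxBl mul1mx yy subrr subr0.
  have := chi_outside htau triv0 hchi us hz Sz pz.
  have -> : chi (io (cutoff s z)) = (p - q)%:C%C.
    have [_ _ ->] := chi_cutoff htau triv0 hchi s z.
    rewrite rmorphB /= /p /q !rmorph_sum /= -sumrB; apply: eq_bigr => sigma _.
    rewrite /z chi_irr_lin chi_irr1 mulrDr mulr1 addrC; congr (_ + _).
    by rewrite rmorphM /= -cotrans_ind mulN1r mulrN.
  rewrite ioz (chiB hchi (frakA1 triv0) Sy) (chi_cone htau triv0 hchi) chiy.
  by rewrite -[1 : C]/(1%:C%C) -!rmorphB ler0c; lra.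
have ind_s : E N.+1 (fun sigma => f sigma * (sigma \in s)%:R) = q.
  have -> : (fun sigma => f sigma * (sigma \in s)%:R) =
      fun sigma => \sum_(t <- s) f t * (sigma == t)%:R.
    by apply/funext => sigma; rewrite sum_pred1.
  rewrite linear_mean_sum; last by have [] := mE N.+1.
  by apply: eq_bigr => t _; rewrite E_ind mulrC.
have b1 : bdd (fun sigma => (sigma \in s)%:R : R) by exact: (bdd_bool R (mem s)).
have b2 : bdd (fun sigma => (sigma \notin s)%:R : R).
  exact: (bdd_bool R [pred sigma | sigma \notin s]).
have mass : E N.+1 (fun sigma => (sigma \notin s)%:R) = 1 - p.
  have -> : (fun sigma => (sigma \notin s)%:R) = fun sigma => 1 - (sigma \in s)%:R :> R.
    by apply/funext => sigma; case: (sigma \in s); rewrite /= ?subrr ?subr0.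
  rewrite (meanB (mE _)) //; last exact: bdd_cst.
  rewrite (mean_cst (mE _)); congr (_ - _).
  have -> : (fun sigma => (sigma \in s)%:R) = fun sigma => \sum_(t <- s) 1 * (sigma == t)%:R :> R.
    by apply/funext => sigma; rewrite (@sum_pred1 _ _ s (fun=> 1)) // mul1r.
  rewrite (@linear_mean_sum _ _ _ s (fun=> 1)); last by have [] := mE N.+1.
  by apply: eq_bigr => t _; rewrite E_ind mul1r.
have split : E N.+1 f = q + E N.+1 (fun sigma => f sigma * (sigma \notin s)%:R).
  rewrite -ind_s -(meanD (mE _)); [|exact: bddM|exact: bddM].
  congr (E _ _); apply/funext => sigma.
  by case: (sigma \in s); rewrite /= ?mulr1 ?mulr0 ?addr0 ?add0r.
have r0 : 0 <= E N.+1 (fun sigma => f sigma * (sigma \notin s)%:R).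
  apply: (mean_ge0 (mE _)) => [|sigma]; first exact: bddM.
  by rewrite mulr_ge0 //; case/andP: (f01 sigma).
have r1 : E N.+1 (fun sigma => f sigma * (sigma \notin s)%:R) <= 1 - p.
  rewrite -mass; apply: (mean_le (mE _)) => // [|sigma]; first exact: bddM.
  by rewrite ler_piMl //; case/andP: (f01 sigma).
by rewrite split ler_norml; apply/andP; split; lra.
Qed.

Lemma coherent_state_means : coherent (X := X) cs cw E.
Proof.
split=> // N h bh; apply/esym.
apply: (@mean_agree _ _ (E N) (fun h => E N.+1 (down h))) => //.
- move=> c f g bf bg.
  have -> : down (fun x => c * f x + g x) = fun pi => c * down f pi + down g pi.
    by apply/funext => pi; rewrite cotrans_lin.
  by rewrite (mean_lin (mE _)) //; exact: bdd_cotrans.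
- move=> f bf f0; apply: (mean_ge0 (mE _)); first exact: bdd_cotrans.
  by move=> pi; exact: cotrans_ge0.
- have -> : down (fun _ : irr (GG N) => 1) = fun=> 1 by apply/funext => pi; rewrite cotrans_cst.
  exact: mean_cst (mE _) 1.
by move=> rho; rewrite mean_cotrans_ind E_ind.
Qed.

Lemma chi_blk N (rho : irr (GG N)) z : chi (io (@blk _ _ rho z)) =
  (E N (fun y => (y == rho)%:R))%:C%C * (\tr (irr_F rho *m z) / dim_q rho).
Proof.
by rewrite (chi_iota_blk htau triv0 hchi) (proj1 (weightE hchi rho)) E_ind.
Qed.

(** E1 and E2 give quantized characters psi1 and psi2. Their midpoint agrees with chi on all blocks,
    hence on [frakA], and extremality is then applied at the unit of the block rho. *)
Lemma extreme_extremal_mean : extreme_on S (Ch B tau) chi ->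
  extremal_mean (X := X) cs cw E.
Proof.
move=> [_ ext] E1 E2 hE1 hE2 hE N rho.
have [psi1 h1] := state_of_mean_ex B chi_irr_Theta hE1.
have [psi2 h2] := state_of_mean_ex B chi_irr_Theta hE2.
have Ch1 := psi_Ch htau hE1 h1.
have Ch2 := psi_Ch htau hE2 h2.
have half1 : nrm ((2^-1)%:C%C : C^o) = 2^-1 by rewrite nrm_real gtr0_norm.
have half2 : nrm ((1 - 2^-1)%:C%C : C^o) = 2^-1.
  by rewrite nrm_real gtr0_norm; lra.
have psi1_blk n (r : irr (GG n)) z : psi1 (io (@blk _ _ r z)) =
    (E1 n (fun y => (y == r)%:R))%:C%C * (\tr (irr_F r *m z) / dim_q r).
  rewrite (psi_iota h1 (Wstar_blk _)) level_state_blk //.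
  exact: (proj1 hE1).
have psi2_blk n (r : irr (GG n)) z : psi2 (io (@blk _ _ r z)) =
    (E2 n (fun y => (y == r)%:R))%:C%C * (\tr (irr_F r *m z) / dim_q r).
  rewrite (psi_iota h2 (Wstar_blk _)) level_state_blk //.
  exact: (proj1 hE2).
have chiE b : S b -> chi b = (2^-1)%:C%C * psi1 b + (1 - 2^-1)%:C%C * psi2 b.
  move: b; apply: (frakA_functional_eq htau (K := 1)).
  - exact: (chi_lin hchi).
  - move=> c x y Sx Sy; rewrite (chi_lin Ch1 c Sx Sy) (chi_lin Ch2 c Sx Sy); ring.
  - by move=> b Sb; rewrite mul1r (chi_le hchi Sb).
  - move=> b Sb; rewrite (le_trans (nrmD _ _)) // !nrmCM half1 half2.
    by have := chi_le Ch1 Sb; have := chi_le Ch2 Sb; lra.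
  move=> n r z; rewrite psi1_blk psi2_blk chi_blk.
  have br : bdd (fun y => (y == r)%:R : R) by exact: (bdd_bool R (pred1 r)).
  rewrite (hE n _ br); set w := _ / dim_q r; set a := E1 n _; set b := E2 n _.
  have -> : ((a + b) / 2)%:C%C = (2^-1)%:C%C * a%:C%C + (1 - 2^-1)%:C%C * b%:C%C :> C.
    by apply/eqP; rewrite eq_complex /=; apply/andP; split; apply/eqP; lra.
  ring.
have Sb : S (io (@blk _ _ rho 1%:M)) by apply: frakA_CG; exact: CG_blk.
have t0 : 0 < 2^-1 :> R by [].
have t1 : 2^-1 < 1 :> R by lra.
have [+ _] := ext _ _ _ t0 t1 Ch1 Ch2 chiE _ Sb.
rewrite psi1_blk chi_blk mulmx1 divff; last exact: dim_q_neq0.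
by rewrite !mulr1 => /complexI.
Qed.

Lemma chi_irr_Theta_iter K m (x : dualU (GG K)) pi : Wstar x ->
  complex.Re (chi_irr pi (Theta_iter m x)) =
    trans (X := X) cs cw (fun rho => complex.Re (chi_irr rho x)) (m + K)%N pi /\
  complex.Im (chi_irr pi (Theta_iter m x)) =
    trans (X := X) cs cw (fun rho => complex.Im (chi_irr rho x)) (m + K)%N pi.
Proof.
move=> hx; have hW k : Wstar (Theta_iter k x).
  by elim: k => [//|k ih] /=; exact: (@Wstar_Theta _ _ B).
elim: m pi => [|m ih] pi; first by rewrite !trans_id.
have Km : (K <= m + K)%N by exact: leq_addl.
have [-> ->] := cotrans_Re chi_irr_Theta pi (hW m).
rewrite !(@transS _ X cs cw K _ (m + K)%N Km).
have -> : (fun rho => complex.Re (chi_irr rho (Theta_iter m x))) =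
    trans (X := X) cs cw (fun rho => complex.Re (chi_irr rho x)) (m + K)%N.
  by apply/funext => rho; have [] := ih rho.
have -> // : (fun rho => complex.Im (chi_irr rho (Theta_iter m x))) =
    trans (X := X) cs cw (fun rho => complex.Im (chi_irr rho x)) (m + K)%N.
by apply/funext => rho; have [] := ih rho.
Qed.

End CoherentMeansOfState.

(** * The limit along the path *)

Section PathLimit.
Variables (R : realType) (X : nat -> choiceType).
Variables (cs : forall n, X n.+1 -> seq (X n)) (cw : forall n, X n.+1 -> X n -> R).
Hypothesis cw0 : forall n (x : X n.+1) y, 0 <= cw x y.
Hypothesis cw1 : forall n (x : X n.+1), \sum_(y <- cs x) cw x y = 1.
Variables (pi : forall n, X n) (K : nat) (w : X K -> R).
Hypothesis pi_w : forall x : X K,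
  (fun n => trans cs cw (fun y => (y == x)%:R) n (pi n)) @ \oo --> w x.

Lemma trans_path_fin (s : seq (X K)) (a : X K -> R) :
  (fun n => trans cs cw (fun y => \sum_(x <- s) a x * (y == x)%:R) n (pi n)) @ \oo -->
  \sum_(x <- s) a x * w x.
Proof.
elim: s => [|x s ih].
  rewrite big_nil; apply: cvg_near_cst; exists K => // n /= Kn.
  have -> : (fun y => \sum_(x <- [::]) a x * (y == x)%:R) = fun _ : X K => 0 :> R.
    by apply/funext => y; rewrite big_nil.
  by rewrite trans_cst.
rewrite big_cons.
have -> : (fun n => trans cs cw (fun y => \sum_(z <- x :: s) a z * (y == z)%:R) n (pi n)) =
  fun n => a x * trans cs cw (fun y => (y == x)%:R) n (pi n) +
    trans cs cw (fun y => \sum_(z <- s) a z * (y == z)%:R) n (pi n).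
  apply/funext => n; rewrite -trans_lin; congr (trans _ _ _ n (pi n)).
  by apply/funext => y; rewrite big_cons.
by apply: cvgD => //; apply: cvgMr.
Qed.

(** Transport is contractive for the uniform norm, so uniform approximation by finitely supported
    functions transfers the convergence; three errors of e / 4 are added. *)
Lemma trans_path_limit (f : X K -> R) (l : R) :
  (forall e : R, 0 < e -> exists (s : seq (X K)) (a : X K -> R),
     (forall y, `|f y - \sum_(x <- s) a x * (y == x)%:R| <= e) /\
     `|l - \sum_(x <- s) a x * w x| <= e) ->
  forall e : R, 0 < e -> \forall n \near \oo, `|l - trans cs cw f n (pi n)| < e.
Proof.
move=> app e e0; have e4 : 0 < e / 4 by rewrite divr_gt0.
have [s [a [fa la]]] := app _ e4.
have := @trans_path_fin s a => /cvgrPdist_lt/(_ _ e4); apply: filterS => n.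
set g := fun y => \sum_(x <- s) _ in fa *; set m := \sum_(x <- s) _ in la *.
have : `|trans cs cw f n (pi n) - trans cs cw g n (pi n)| <= e / 4.
  have -> : trans cs cw f n (pi n) - trans cs cw g n (pi n) =
      trans cs cw (fun y => -1 * g y + f y) n (pi n).
    by rewrite trans_lin mulN1r addrC.
  apply: trans_abs => // [|y]; first exact: ltW.
  by rewrite mulN1r addrC.
move: la; set u := trans cs cw f n _; set v := trans cs cw g n _.
by rewrite !ler_norml !ltr_norml; lra.
Qed.

End PathLimit.

Section CutoffCharacter.
Variables (R : realType) (G : ucqg R).
Local Notation C := R[i].

Lemma chi_irr_cutoff (s : seq (irr G)) (y : dualU G) rho :
  chi_irr rho (cutoff s y) =
  \sum_(sigma <- s) chi_irr sigma y * ((rho == sigma)%:R : R)%:C%C.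
Proof.
rewrite {1}/chi_irr /cutoff mulmx_sumr linear_sum mulr_suml /=.
apply: eq_bigr => sigma _; have := chi_irr_blk rho (y sigma).
by rewrite {1}/chi_irr => ->; case: (rho == sigma).
Qed.

Lemma Re_sum_real I (s : seq I) (u : I -> C) (r : I -> R) :
  complex.Re (\sum_(i <- s) u i * (r i)%:C%C) = \sum_(i <- s) complex.Re (u i) * r i.
Proof.
rewrite raddf_sum; apply: eq_bigr => i _.
by case: (u i) => a b /=; rewrite mulr0 subr0.
Qed.

Lemma Im_sum_real I (s : seq I) (u : I -> C) (r : I -> R) :
  complex.Im (\sum_(i <- s) u i * (r i)%:C%C) = \sum_(i <- s) complex.Im (u i) * r i.
Proof.
rewrite raddf_sum; apply: eq_bigr => i _.
by case: (u i) => a b /=; rewrite mulr0 add0r.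
Qed.

End CutoffCharacter.

Theorem corollary2p1 (R : realType) (GG : ind_system R)
    (triv0 : trivial_cqg (GG 0%N))
    (B : ind_limit GG) (tau : R -> B -> B) (tau_flow : induced_flow tau)
    (chi : B -> R[i]) (chi_ex : extreme_on (frakA B) (Ch B tau) chi) :
  exists pi : forall N, irr (GG N),
    (forall N, (1 <= N)%N -> prec (pi N) (pi N.+1)) /\
    (forall K, (1 <= K)%N -> forall x : dualU (GG K), Cstar x ->
       (fun m : nat => chi_irr (pi (m + K)%N) (Theta_iter m x) : R[i]^o) @ \oo
         --> (chi (iota_lim B x) : R[i]^o)).
Proof.
have hchi : Ch B tau chi by case: chi_ex.
have cot N (p : irr (GG N.+1)) := cid (cotransition_ex tau_flow p).
pose cs N (p : irr (GG N.+1)) := (sval (cot N p)).1.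
pose cw N (p : irr (GG N.+1)) := (sval (cot N p)).2.
have cw0 N (p : irr (GG N.+1)) y : 0 <= cw N p y.
  by rewrite /cw; case: (cot N p) => q [].
have cw1 N (p : irr (GG N.+1)) : \sum_(y <- cs N p) cw N p y = 1.
  by rewrite /cw /cs; case: (cot N p) => q [].
have cs_prec N (p : irr (GG N.+1)) y : y \in cs N p -> prec y p.
  by rewrite /cs; case: (cot N p) => q [? ? h ?]; exact: h.
have chiT N (p : irr (GG N.+1)) (x : dualU (GG N)) : Wstar x ->
    chi_irr p (Theta x) = \sum_(rho <- cs N p) (cw N p rho)%:C%C * chi_irr rho x.
  by rewrite /cw /cs; case: (cot N p) => q [? ? ? h]; exact: h.
have [E hE] := means_ex tau_flow triv0 hchi.
have mE n : mean (E n) by have [] := hE n.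
have E_ind n rho : E n (fun y => (y == rho)%:R) = weight chi rho by have [] := hE n.
have coh := coherent_state_means tau_flow triv0 cw0 cw1 chiT hchi mE E_ind.
have ext := extreme_extremal_mean tau_flow triv0 chiT hchi E_ind chi_ex.
have [pi [pi_cs pi_lim]] := regular_path cw0 cw1 coh (@isys_countable _ GG)
  (fun k x => extremal_fluctuation cw0 cw1 coh x ext).
exists pi; split=> [N _|K _ x cx]; first exact/cs_prec/pi_cs.
have [hx hxe] := cx.
have Sx : frakA B (iota_lim B x) by exact: frakA_Cstar.
(* A finitely supported y close to x in norm approximates [chi_irr rho x] uniformly in rho and [chi]
   at x with the same error. *)
have approx (e : R) : 0 < e -> exists (s : seq (irr (GG K))) (y : dualU (GG K)),
    [/\ forall rho, nrm (chi_irr rho x - \sum_(sigma <- s)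
          chi_irr sigma y * ((rho == sigma)%:R : R)%:C%C : R[i]^o) <= e
      & nrm (chi (iota_lim B x) - \sum_(sigma <- s)
          chi_irr sigma y * (weight chi sigma)%:C%C : R[i]^o) <= e].
  move=> /hxe[y cy xy]; have hy := CG_Wstar cy.
  have [s [us ys]] := CG_decomp cy; have yE : y = cutoff s y by [].
  have hw := Wstar_lin (-1) hy hx.
  have wE : (fun p => -1 *: y p + x p) = fun p => x p - y p.
    by apply: fam_ext => p; rewrite scaleN1r addrC.
  exists s, y; split=> [rho|].
    rewrite -chi_irr_cutoff -yE.
    have -> : chi_irr rho x - chi_irr rho y = chi_irr rho (fun p => -1 *: y p + x p).
      by rewrite chi_irr_lin mulN1r addrC.
    apply: le_trans (chi_irr_le _ _) _.
    apply: le_trans (opnorm_le_Wnorm _ hw) _; rewrite wE; exact: ltW.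
  have [_ Sy cE] := chi_cutoff tau_flow triv0 hchi s y.
  have -> : \sum_(sigma <- s) chi_irr sigma y * (weight chi sigma)%:C%C =
      chi (iota_lim B y).
    by rewrite {2}yE cE; apply: eq_bigr => sigma _; rewrite mulrC.
  rewrite -yE in Sy; rewrite -(chiB hchi Sx Sy).
  apply: le_trans (chi_le hchi (frakAB Sx Sy)) _.
  have -> : iota_lim B x - iota_lim B y = iota_lim B (fun p => -1 *: y p + x p).
    by rewrite (iota_linear B (-1) hy hx) scaleN1r addrC.
  rewrite (nrm_iota B hw) wE; exact: ltW.
(* Transports and path limits concern real functions, so real and imaginary parts are treated
   separately. *)
have Re_lim : forall e : R, 0 < e -> \forall n \near \oo,
    `|complex.Re (chi (iota_lim B x)) -
      trans cs cw (fun rho => complex.Re (chi_irr rho x)) n (pi n)| < e.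
  apply: (trans_path_limit cw0 cw1 (w := fun rho => weight chi rho)) => [rho|e e0].
    by rewrite -E_ind; exact: pi_lim.
  have [s [y [h1 h2]]] := approx e e0.
  exists s, (fun sigma => complex.Re (chi_irr sigma y)); split=> [rho|].
    by rewrite -Re_sum_real -raddfB; apply: le_trans (h1 rho); exact: Re_le_nrm.
  by rewrite -Re_sum_real -raddfB; apply: le_trans h2; exact: Re_le_nrm.
have Im_lim : forall e : R, 0 < e -> \forall n \near \oo,
    `|complex.Im (chi (iota_lim B x)) -
      trans cs cw (fun rho => complex.Im (chi_irr rho x)) n (pi n)| < e.
  apply: (trans_path_limit cw0 cw1 (w := fun rho => weight chi rho)) => [rho|e e0].
    by rewrite -E_ind; exact: pi_lim.
  have [s [y [h1 h2]]] := approx e e0.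
  exists s, (fun sigma => complex.Im (chi_irr sigma y)); split=> [rho|].
    by rewrite -Im_sum_real -raddfB; apply: le_trans (h1 rho); exact: Im_le_nrm.
  by rewrite -Im_sum_real -raddfB; apply: le_trans h2; exact: Im_le_nrm.
apply/cvgrPdist_lt => e /lt0C[d d0 ->].
have d2 : 0 < d / 2 by rewrite divr_gt0.
have [N1 _ h1] := Re_lim _ d2; have [N2 _ h2] := Im_lim _ d2.
exists (maxn N1 N2) => // m /=; rewrite geq_max => /andP[m1 m2].
have := h1 (m + K)%N (leq_trans m1 (leq_addr _ _)).
have := h2 (m + K)%N (leq_trans m2 (leq_addr _ _)).
have [<- <-] := chi_irr_Theta_iter B cw1 chiT (m := m) (pi (m + K)%N) hx.
rewrite -!raddfB; set z := _ - chi_irr _ _ => i2 r2.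
rewrite nrmE ltcR; have -> : z = Complex (complex.Re z) (complex.Im z) by case: (z).
by apply: le_lt_trans (nrm_Complex _ _) _; move: i2 r2 => /=; lra.
Qed.
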